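(* Let $k$ be a field of characteristic $0$, let $a,b\ge 2$ be integers, and let $q\in k^\times$ be not a root of unity. Let $C_{a,b}$ be the quantum complete intersection, i.e. the quotient of the free algebra $k\{x,y\}$ on two noncommuting indeterminates by the two-sided ideal generated by $x^a$, $yx-qxy$ and $y^b$. Then $$\dim_k HH_n(C_{a,b})=\begin{cases} a+b-1 & \text{if } n=0,\\ a+b-2 & \text{if } n\ge 1.\end{cases}$$
   Context: $HH_n(C)=H_n(C,C)$ denotes the Hochschild homology over $k$ of a unital associative $k$-algebra $C$ with coefficients in itself. *)

(* Defs.v *)
From HB Require Import structures.
From mathcomp Require Import all_boot all_order all_algebra.
From mathcomp Require Import boolp.
From mathcomp Require Import finmap monalg.
From mathcomp Require Import zify.

Set Implicit Arguments.
Unset Strict Implicit.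
Unset Printing Implicit Defensive.

Import GRing.Theory.
Local Open Scope ring_scope.
Local Open Scope quotient_scope.

Section QuotientModule.
Variables (k : fieldType) (V : lmodType k) (S : V -> Prop).

Definition in_span (v : V) : Prop :=
  exists n (c : 'I_n -> k) (s : 'I_n -> V),
    (forall i, S (s i)) /\ v = \sum_i c i *: s i.

Definition span_pred : V -> bool := fun v => `[< in_span v >].

Lemma span_submod_closed : submod_closed span_pred.
Proof.
split=> [|a u v /asboolP [n [c [s [Ss ->]]]] /asboolP [m [d [t [St ->]]]]].
  apply/asboolP; exists 0%N, (fun=> 0), (fun=> 0).
  by split=> [[]|]; rewrite ?big_ord0.
apply/asboolP; exists (n + m)%N.
exists (fun i => match split i with inl j => a * c j | inr j => d j end).
exists (fun i => match split i with inl j => s j | inr j => t j end).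
split=> [i|]; first by case: (split i).
rewrite big_split_ord /= scaler_sumr; congr (_ + _); apply: eq_bigr => i _.
  by rewrite (unsplitK (inl i)) scalerA.
by rewrite (unsplitK (inr i)).
Qed.

HB.instance Definition _ :=
  GRing.isSubmodClosed.Build k V span_pred span_submod_closed.

Lemma span_predP v : reflect (in_span v) (v \in span_pred).
Proof. exact: asboolP. Qed.

Lemma gen_in_span v : S v -> v \in span_pred.
Proof.
move=> Sv; apply/asboolP; exists 1%N, (fun=> 1), (fun=> v).
by split=> //; rewrite big_ord1 scale1r.
Qed.

(* The quotient of V by the submodule spanned by S. *)
Definition lquot := Quotient.quot (GRing.ZmodClosed.clone V span_pred _).
HB.instance Definition _ := GRing.Zmodule.on lquot.
HB.instance Definition _ := ZmodQuotient.on lquot.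

Definition lproj (v : V) : lquot := \pi v.
Definition lrepr (x : lquot) : V := repr x.

Lemma lreprK : cancel lrepr lproj. Proof. exact: reprK. Qed.

Lemma lprojP (u v : V) : reflect (lproj u = lproj v) (u - v \in span_pred).
Proof. by rewrite Quotient.idealrBE; apply: eqP. Qed.

Lemma lprojB : zmod_morphism lproj. Proof. exact: raddfB. Qed.
HB.instance Definition _ := GRing.isZmodMorphism.Build V lquot lproj lprojB.

Definition lquot_scale (a : k) (x : lquot) : lquot := lproj (a *: lrepr x).

Lemma lquot_scaleE a (v : V) : lquot_scale a (lproj v) = lproj (a *: v).
Proof.
by apply/lprojP; rewrite -scalerBr rpredZ //; apply/lprojP; rewrite lreprK.
Qed.

Lemma lquot_scaleA a b x :
  lquot_scale a (lquot_scale b x) = lquot_scale (a * b) x.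
Proof. by rewrite -[x]lreprK !lquot_scaleE scalerA. Qed.

Lemma lquot_scale1 : left_id 1 lquot_scale.
Proof. by move=> x; rewrite -[x]lreprK lquot_scaleE scale1r. Qed.

Lemma lquot_scaleDr : right_distributive lquot_scale +%R.
Proof.
move=> a x y; rewrite -[x]lreprK -[y]lreprK -raddfD !lquot_scaleE.
by rewrite scalerDr raddfD.
Qed.

Lemma lquot_scaleDl x : {morph lquot_scale^~ x : a b / a + b}.
Proof. by move=> a b; rewrite -[x]lreprK !lquot_scaleE scalerDl raddfD. Qed.

HB.instance Definition _ := GRing.Zmodule_isLmodule.Build k lquot
  lquot_scaleA lquot_scale1 lquot_scaleDr lquot_scaleDl.

Lemma lprojZ : scalable lproj.
Proof. by move=> a v; rewrite -lquot_scaleE. Qed.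
HB.instance Definition _ := GRing.isScalable.Build k V lquot *:%R lproj lprojZ.

End QuotientModule.

Section QuotientAlgebra.
Variables (k : fieldType) (A : algType k) (S : A -> Prop).

(* The two-sided ideal generated by S is the span of the products u * s * v. *)
Definition ideal_gens (z : A) : Prop :=
  exists u s v, S s /\ z = u * s * v.

Lemma idealM u v z :
  z \in span_pred ideal_gens -> u * z * v \in span_pred ideal_gens.
Proof.
move=> /span_predP [n [c [s [Ss ->]]]]; rewrite mulr_sumr mulr_suml.
apply: rpred_sum => i _; rewrite -scalerAr -scalerAl rpredZ //.
have [u' [s' [v' [Ss' ->]]]] := Ss i.
apply: gen_in_span; exists (u * u'), s', (v' * v); split=> //.
by rewrite !mulrA.
Qed.

(* MathComp algebras are nontrivial, so the quotient needs a proper ideal. *)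
Hypothesis one_notin : 1 \notin span_pred ideal_gens.

Definition aquot := let _ := one_notin in lquot ideal_gens.
HB.instance Definition _ := GRing.Lmodule.on aquot.

Definition aproj (u : A) : aquot := lproj ideal_gens u.
Definition arepr (x : aquot) : A := lrepr x.

Lemma areprK : cancel arepr aproj. Proof. exact: lreprK. Qed.

Lemma aprojP (u v : A) :
  reflect (aproj u = aproj v) (u - v \in span_pred ideal_gens).
Proof. exact: lprojP. Qed.

Lemma aproj_linear : linear aproj. Proof. exact: linearP. Qed.
HB.instance Definition _ := GRing.isLinear.Build k A aquot *:%R aproj
  aproj_linear.

Definition aquot_one : aquot := aproj 1.
Definition aquot_mul (x y : aquot) : aquot := aproj (arepr x * arepr y).

Lemma aquot_mulE (u v : A) : aquot_mul (aproj u) (aproj v) = aproj (u * v).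
Proof.
apply/aprojP; set u' := arepr _; set v' := arepr _.
have uI : u' - u \in span_pred ideal_gens by apply/aprojP; rewrite areprK.
have vI : v' - v \in span_pred ideal_gens by apply/aprojP; rewrite areprK.
have -> : u' * v' - u * v = 1 * (u' - u) * v' + u * (v' - v) * 1.
  by rewrite mul1r mulr1 mulrBl mulrBr addrA subrK.
by rewrite rpredD // idealM.
Qed.

Lemma aquot_mulA : associative aquot_mul.
Proof.
move=> x y z; rewrite -[x]areprK -[y]areprK -[z]areprK !aquot_mulE.
by rewrite mulrA.
Qed.

Lemma aquot_mul1l : left_id aquot_one aquot_mul.
Proof. by move=> x; rewrite -[x]areprK aquot_mulE mul1r. Qed.

Lemma aquot_mul1r : right_id aquot_one aquot_mul.
Proof. by move=> x; rewrite -[x]areprK aquot_mulE mulr1. Qed.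

Lemma aquot_mulDl : left_distributive aquot_mul +%R.
Proof.
move=> x y z; rewrite -[x]areprK -[y]areprK -[z]areprK.
by rewrite -raddfD !aquot_mulE mulrDl raddfD.
Qed.

Lemma aquot_mulDr : right_distributive aquot_mul +%R.
Proof.
move=> x y z; rewrite -[x]areprK -[y]areprK -[z]areprK.
by rewrite -raddfD !aquot_mulE mulrDr raddfD.
Qed.

Lemma aquot_one_neq0 : aquot_one != 0.
Proof.
apply: contra one_notin => /eqP one0; rewrite -[1]subr0; apply/aprojP.
by rewrite raddf0.
Qed.

HB.instance Definition _ := GRing.Zmodule_isNzRing.Build aquot
  aquot_mulA aquot_mul1l aquot_mul1r aquot_mulDl aquot_mulDr aquot_one_neq0.

Lemma aproj_monoid_morphism : monoid_morphism aproj.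
Proof. by split=> // u v; rewrite -aquot_mulE. Qed.

HB.instance Definition _ := GRing.isMonoidMorphism.Build A aquot aproj
  aproj_monoid_morphism.

Lemma aquot_scaleAl (a : k) (x y : aquot) : a *: (x * y) = a *: x * y.
Proof.
by rewrite -[x]areprK -[y]areprK -rmorphM -!linearZ -rmorphM /= scalerAl.
Qed.

HB.instance Definition _ :=
  GRing.Lmodule_isLalgebra.Build k aquot aquot_scaleAl.

Lemma aquot_scaleAr (a : k) (x y : aquot) : a *: (x * y) = x * (a *: y).
Proof.
by rewrite -[x]areprK -[y]areprK -rmorphM -!linearZ -rmorphM /= scalerAr.
Qed.

HB.instance Definition _ :=
  GRing.Lalgebra_isAlgebra.Build k aquot aquot_scaleAr.

End QuotientAlgebra.

Section QuantumCompleteIntersection.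
Variable k : fieldType.

(* The free algebra k{x,y}: the monoid algebra of the words over bool. *)
Definition free2 := {malg k[{fmonom bool}]}.
HB.instance Definition _ := GRing.Lalgebra.on free2.

Lemma free2_scaleAr (c : k) (u v : {malg k[{fmonom bool}]}) :
  c *: (u * v) = u * (c *: v).
Proof.
apply/malgP=> w; rewrite mcoeffZ.
rewrite [LHS](congr1 (GRing.mul c) (mcoeffMl u v w)).
rewrite (mcoeffMlw _ (fsubset_refl (msupp u)) (msuppZ_le c v)).
rewrite mulr_sumr.
apply: eq_bigr => k1 _; rewrite mulr_sumr; apply: eq_bigr => k2 _.
by rewrite (mcoeffZ c v) mulrnAr mulrCA.
Qed.

HB.instance Definition _ := GRing.Lalgebra_isAlgebra.Build k free2 free2_scaleAr.

Definition varx : free2 := << fmu false >>.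
Definition vary : free2 := << fmu true >>.

Variables (a b : nat) (q : k).

Definition qci_rel (z : free2) : Prop :=
  [\/ z = varx ^+ a, z = vary * varx - q *: (varx * vary) | z = vary ^+ b].

Lemma free2_augmentation : exists eps : {rmorphism free2 -> k},
  [/\ scalable_for *%R eps, eps varx = 0 & eps vary = 0].
Proof.
exists (mcoeff (mone : {fmonom bool})).
by split=> [c u||] /=; rewrite ?mcoeffZ ?mcoeffU ?fm1_eq1.
Qed.

Lemma qci_proper (a_gt1 : (1 < a)%N) (b_gt1 : (1 < b)%N) :
  1 \notin span_pred (ideal_gens qci_rel).
Proof.
have [eps [epsZ epsx epsy]] := free2_augmentation.
have epsC : eps (vary * varx - q *: (varx * vary)) = 0.
  have gen (A : algType k) (f : {rmorphism A -> k}) x y :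
      scalable_for *%R f -> f x = 0 -> f (y * x - q *: (x * y)) = 0.
    by move=> fZ fx; rewrite rmorphB fZ !rmorphM fx mulr0 mul0r mulr0 subrr.
  exact: gen.
have epsS s : qci_rel s -> eps s = 0.
  case=> ->.
  - by rewrite rmorphXn epsx expr0n gtn_eqF // ltnW.
  - exact: epsC.
  - by rewrite rmorphXn epsy expr0n gtn_eqF // ltnW.
apply/span_predP => -[n [c [s [Ss]]]] /(congr1 eps)/eqP.
rewrite rmorph1 rmorph_sum big1 ?oner_eq0 // => i _.
have [u [r [v [/epsS r0 ->]]]] := Ss i.
by rewrite epsZ !rmorphM r0 mulr0 mul0r mulr0.
Qed.

End QuantumCompleteIntersection.

(* The quantum complete intersection C_{a,b}. *)
Definition qci (k : fieldType) (a b : nat) (q : k)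
    (a_gt1 : (1 < a)%N) (b_gt1 : (1 < b)%N) : algType k :=
  aquot (qci_proper q a_gt1 b_gt1).


Section TensorPower.
Variables (k : fieldType) (C : algType k).

Definition upd n (t : {ffun 'I_n -> C}) (p : 'I_n) (u : C) : {ffun 'I_n -> C} :=
  [ffun j => if j == p then u else t j].

Definition multilinear n (V : lmodType k) (h : {ffun 'I_n -> C} -> V) : Prop :=
  forall t p, linear (fun u => h (upd t p u)).

Definition tensor_rel n (z : {malg k[{ffun 'I_n -> C}]}) : Prop :=
  exists t p (c : k) (u v : C),
    z = << upd t p (c *: u + v) >> - (c *: << upd t p u >> + << upd t p v >>).

(* The n-fold tensor power of C over k: the free vector space on n-tuples of
   elements of C modulo multilinearity. *)
Definition tensor n : lmodType k := lquot (@tensor_rel n).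

Definition pure n (t : {ffun 'I_n -> C}) : tensor n :=
  lproj (@tensor_rel n) << t >>.

Lemma pure_multilinear n : multilinear (@pure n).
Proof.
move=> t p c u v; rewrite /pure -linearP; apply/lprojP.
by apply: gen_in_span; exists t, p, c, u, v.
Qed.

Section Lift.
Variables (n : nat) (V : lmodType k) (h : {ffun 'I_n -> C} -> V).

Definition free_ext (z : {malg k[{ffun 'I_n -> C}]}) : V :=
  \sum_(t <- msupp z) z@_t *: h t.

(* Linear, and given by h on pure tensors, as soon as h is multilinear: see
   tensor_lift_linear and tensor_lift_pure. *)
Definition tensor_lift (x : tensor n) : V := free_ext (lrepr x).

Lemma free_extEw (E : {fset {ffun 'I_n -> C}}) z :
  (msupp z `<=` E)%fset -> free_ext z = \sum_(t <- E) z@_t *: h t.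
Proof.
move=> le; rewrite /free_ext (big_fset_incl _ le) // => t _ /mcoeff_outdom ->.
by rewrite scale0r.
Qed.

Lemma free_ext_linear : linear free_ext.
Proof.
move=> c z w.
pose E := (msupp (c *: z + w)%R `|` (msupp z `|` msupp w))%fset.
rewrite !(@free_extEw E) ?fsubsetUl //.
- rewrite scaler_sumr -big_split; apply: eq_bigr => t _ /=.
  by rewrite mcoeffD mcoeffZ scalerDl scalerA.
- by rewrite /E fsubsetU // fsubsetUr orbT.
- by rewrite /E fsubsetU // fsubsetUl orbT.
Qed.

HB.instance Definition _ :=
  GRing.isLinear.Build k {malg k[{ffun 'I_n -> C}]} V *:%R free_ext
    free_ext_linear.

Lemma free_extU t : free_ext << t >> = h t.
Proof.
by rewrite (@free_extEw [fset t]%fset) ?msuppU_le // big_seq_fset1 mcoeffUU scale1r.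
Qed.

Hypothesis h_ml : multilinear h.

Lemma free_ext_rel z : z \in span_pred (@tensor_rel n) -> free_ext z = 0.
Proof.
move=> /span_predP [m [c [s [Ss ->]]]]; rewrite linear_sum big1 // => i _.
have [t [p [d [u [v ->]]]]] := Ss i.
by rewrite linearZ linearB linearP /= !free_extU h_ml subrr scaler0.
Qed.

Lemma tensor_lift_proj z : tensor_lift (lproj (@tensor_rel n) z) = free_ext z.
Proof.
apply/eqP; rewrite -subr_eq0 -linearB; apply/eqP/free_ext_rel.
by apply/lprojP; rewrite lreprK.
Qed.

Lemma tensor_lift_pure t : tensor_lift (pure t) = h t.
Proof. by rewrite tensor_lift_proj free_extU. Qed.

Lemma tensor_lift_linear : linear tensor_lift.
Proof.
move=> c x y; rewrite -[x]lreprK -[y]lreprK -linearP !tensor_lift_proj.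
by rewrite linearP.
Qed.

End Lift.

Lemma tensor_span n (x : tensor n) :
  exists m (c : 'I_m -> k) (t : 'I_m -> {ffun 'I_n -> C}),
    x = \sum_i c i *: pure (t i).
Proof.
pose z := lrepr x; pose s := enum_fset (msupp z).
exists (size s), (fun i => z@_(tnth (in_tuple s) i)), (tnth (in_tuple s)).
rewrite -[x]lreprK -/z {1}[z]monalgE linear_sum big_tnth.
apply: eq_bigr => i _; rewrite -linearZ; congr lproj.
by apply/malgP => t; rewrite mcoeffZ !mcoeffU mulr_natr.
Qed.

Lemma tensor_linear_eq0 n (V : lmodType k) (f : tensor n -> V) :
  linear f -> (forall t, f (pure t) = 0) -> forall x, f x = 0.
Proof.
move=> f_lin f0 x.
pose g : {linear tensor n -> V} := HB.pack f (GRing.isLinear.Build _ _ _ _ f f_lin).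
rewrite -[f]/(g : _ -> _); have [m [c [t ->]]] := tensor_span x.
by rewrite linear_sum big1 // => i _; rewrite linearZ /= f0 scaler0.
Qed.

End TensorPower.

Section Hochschild.
Variables (k : fieldType) (C : algType k).

(* The i-th face of t = (t_0, ..., t_{n+1}): for i <= n it multiplies t_i and
   t_{i+1}; the last one is (t_{n+1} * t_0, t_1, ..., t_n). *)
Definition face n (i : 'I_n.+2) (t : {ffun 'I_n.+2 -> C}) :
    {ffun 'I_n.+1 -> C} :=
  [ffun j : 'I_n.+1 =>
     if i == ord_max then
       if j == ord0 then t ord_max * t ord0 else t (inord j)
     else if (j < i)%N then t (inord j)
     else if j == i :> nat then t (inord j) * t (inord j.+1)
     else t (inord j.+1)].

Definition alt_faces n (t : {ffun 'I_n.+2 -> C}) : tensor C n.+1 :=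
  \sum_(i < n.+2) (-1) ^+ i *: pure (face i t).

(* The module of chains of degree n is tensor C n.+1. In degree 0 the
   differential is the zero map, with the junk codomain tensor C 1. *)
Definition hochschild_d n : tensor C n.+1 -> tensor C n.-1.+1 :=
  match n with
  | 0 => fun=> 0
  | m.+1 => tensor_lift (@alt_faces m)
  end.

Arguments hochschild_d : simpl never.

Lemma face_upd n (i : 'I_n.+2) (t : {ffun 'I_n.+2 -> C}) (p : 'I_n.+2) :
  exists s p' (g : C -> C),
    linear g /\ forall u, face i (upd t p u) = upd s p' (g u).
Proof.
have [->|ni] := eqVneq i ord_max.
  have [->|n0] := eqVneq p ord0.
    exists (face ord_max t), ord0, (fun u => t ord_max * u); split.
      by move=> c u v; rewrite mulrDr scalerAr.
    move=> u; apply/ffunP => j; rewrite !ffunE !eqxx.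
    have [//|j0] := eqVneq j ord0.
    rewrite ifN //; apply: contra j0 => /eqP/(congr1 val) /=.
    by rewrite inordK ?ltnS ?(ltnW (ltn_ord j)) // => E; apply/eqP/val_inj.
  have [->|nm] := eqVneq p ord_max.
    exists (face ord_max t), ord0, (fun u => u * t ord0); split.
      by move=> c u v; rewrite mulrDl scalerAl.
    move=> u; apply/ffunP => j; rewrite !ffunE !eqxx.
    have [//|j0] := eqVneq j ord0.
    rewrite ifN //; apply/eqP => /(congr1 val) /=.
    have jlt := ltn_ord j; rewrite inordK; lia.
  have p1 : (p < n.+1)%N.
    have := ltn_ord p; have : p != n.+1 :> nat by exact: nm. lia.
  exists (face ord_max t), (Ordinal p1), idfun; split=> // u.
  apply/ffunP => j; rewrite !ffunE !eqxx -!val_eqE /=.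
  have := ltn_ord j; move: n0 nm; rewrite -!val_eqE /= => n0 nm jlt.
  rewrite inordK; last lia.
  by case: ifP => [/eqP j0|_]; do ?case: ifP => //; lia.
have i1 : (i < n.+1)%N.
  have := ltn_ord i; move: ni; rewrite -val_eqE /=; lia.
have E u (j : 'I_n.+1) := ffunE (fun=> u : C) j.
case: (ltngtP p i) => pi.
- have p1 : (p < n.+1)%N by lia.
  exists (face i t), (Ordinal p1), idfun; split=> // u.
  apply/ffunP => j; rewrite !ffunE (negPf ni) -!val_eqE /=.
  have := ltn_ord j => jlt.
  rewrite !inordK; try lia.
  by repeat case: ifP => //; lia.
- have [pi1|pi1] := eqVneq (p : nat) i.+1.
    exists (face i t), (Ordinal i1), (fun u => t i * u); split.
      by move=> c u v; rewrite mulrDr scalerAr.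
    move=> u; apply/ffunP => j; rewrite !ffunE (negPf ni) -!val_eqE /=.
    have := ltn_ord j => jlt.
    rewrite !inordK; try lia.
    case: ifP => [|ji1]; last case: ifP => [/eqP ji|ji2].
    + by repeat case: ifP => //; lia.
    + have -> : inord j = i by apply/val_inj; rewrite /= inordK; lia.
      by repeat case: ifP => //; lia.
    + by repeat case: ifP => //; lia.
  have p1 : (p.-1 < n.+1)%N by have := ltn_ord p; lia.
  exists (face i t), (Ordinal p1), idfun; split=> // u.
  apply/ffunP => j; rewrite !ffunE (negPf ni) -!val_eqE /=.
  have := ltn_ord j => jlt.
  rewrite !inordK; try lia.
  by repeat case: ifP => //; lia.
- exists (face i t), (Ordinal i1), (fun u => u * t (inord i.+1)); split.
    by move=> c u v; rewrite mulrDl scalerAl.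
  move=> u; apply/ffunP => j; rewrite !ffunE (negPf ni) -!val_eqE /=.
  have := ltn_ord j => jlt.
  rewrite !inordK; try lia.
  case: ifP => [|ji1]; last case: ifP => [/eqP ->|ji2].
  + by repeat case: ifP => //; lia.
  + by repeat case: ifP => //; lia.
  + by repeat case: ifP => //; lia.
Qed.

Lemma alt_faces_multilinear n : multilinear (@alt_faces n).
Proof.
move=> t p c u v; rewrite /alt_faces scaler_sumr -big_split /=.
apply: eq_bigr => i _; have [s [p' [g [g_lin gE]]]] := face_upd i t p.
by rewrite !gE g_lin pure_multilinear scalerDr !scalerA mulrC.
Qed.

Lemma hochschild_d_linear n : linear (@hochschild_d n).
Proof.
case: n => [|n]; first by move=> c x y; rewrite /hochschild_d scaler0 addr0.
exact/tensor_lift_linear/alt_faces_multilinear.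
Qed.

HB.instance Definition _ n := GRing.isLinear.Build k (tensor C n.+1)
  (tensor C n.-1.+1) *:%R (@hochschild_d n) (@hochschild_d_linear n).

Lemma hochschild_d_pure n (t : {ffun 'I_n.+2 -> C}) :
  hochschild_d (pure t) = \sum_(i < n.+2) (-1) ^+ i *: pure (face i t)
    :> tensor C n.+1.
Proof. exact/tensor_lift_pure/alt_faces_multilinear. Qed.

Lemma face_face n (t : {ffun 'I_n.+3 -> C}) (i : 'I_n.+2) (j : 'I_n.+3) :
  (i < j)%N -> face i (face j t) = face (inord j.-1) (face (inord i) t).
Proof.
move=> ij; apply/ffunP => l; rewrite !ffunE -!val_eqE /=.
have jl := ltn_ord j; have il := ltn_ord i; have ll := ltn_ord l.
have l0 : inord (inord 0 : 'I_n.+1) = ord0 :> 'I_n.+2.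
  by apply/val_inj; rewrite /= !inordK.
rewrite !inordK; try lia.
by repeat (case: ifP => ?); try lia; rewrite ?mulrA;
  do ?[congr (_ * _) | congr (t _)];
  try (apply/val_inj => /=; rewrite ?inordK; lia).
Qed.

Lemma alt_sum_cancel (V : zmodType) n (G : nat -> nat -> V) :
  (forall i j, (i < j <= n)%N -> G i j = - G j.-1 i) ->
  \sum_(0 <= i < n) \sum_(0 <= j < n.+1) G i j = 0.
Proof.
move=> GE.
have split_i i : (i < n)%N -> \sum_(0 <= j < n.+1) G i j =
    \sum_(0 <= j < n | (j <= i)%N) G i j - \sum_(0 <= j < n | (i <= j)%N) G j i.
  move=> ilt; rewrite (bigID (fun j => (j <= i)%N)) /=; congr (_ + _).
    by rewrite big_mkcond big_nat_recr //= -big_mkcond leqNgt ilt addr0.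
  rewrite big_mkcond big_nat_recl //= add0r -big_mkcond -sumrN /=.
  rewrite (eq_bigl (fun j => (i <= j)%N)) => [|j]; last by rewrite -ltnNge.
  rewrite big_nat_cond [RHS]big_nat_cond; apply: eq_bigr => j /andP[/andP[_ jn] ij].
  by rewrite GE // ltnS ij.
rewrite (eq_big_nat _ _ (fun i h => split_i i (andP h).2)) sumrB.
rewrite [X in _ - X](exchange_big_dep_nat xpredT) //=.
by rewrite subrr.
Qed.

Lemma hochschild_dd n (x : tensor C n.+2) :
  hochschild_d (hochschild_d x : tensor C n.+1) = 0.
Proof.
case: n x => [//|n] x.
have dd_pure (t : {ffun 'I_n.+3 -> C}) :
    hochschild_d (hochschild_d (pure t) : tensor C n.+2) = 0.
  rewrite hochschild_d_pure linear_sum.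
  pose G i j : tensor C n.+1 :=
    (-1) ^+ (j + i) *: pure (face (inord i) (face (inord j : 'I_n.+3) t)).
  transitivity (\sum_(j < n.+3) \sum_(i < n.+2) G i j).
    apply: eq_bigr => j _; rewrite linearZ /=.
    rewrite (hochschild_d_pure (face j t)) scaler_sumr.
    apply: eq_bigr => i _.
    by rewrite scalerA -exprD /G !inord_val.
  rewrite exchange_big -(big_mkord xpredT (fun i => \sum_(j < n.+3) G i j)).
  under eq_bigr => i _ do rewrite -(big_mkord xpredT (G i)).
  apply: alt_sum_cancel => i j /andP[ij jn].
  rewrite /G face_face ?inordK; try lia.
  rewrite -scaleNr; congr (_ *: _).
  have -> : (j + i)%N = (i + j.-1).+1 by lia.
  by rewrite exprS mulN1r.
pose dd (y : tensor C n.+3) : tensor C n.+1 :=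
  hochschild_d (hochschild_d y : tensor C n.+2).
apply: (tensor_linear_eq0 (f := dd)) => // c y z.
rewrite /dd (hochschild_d_linear (n := n.+2)).
by rewrite (hochschild_d_linear (n := n.+1)).
Qed.

Definition cycle_pred n : tensor C n.+1 -> bool := fun z => hochschild_d z == 0.

Lemma cycle_submod_closed n : submod_closed (@cycle_pred n).
Proof.
split=> [|c y z /eqP dy /eqP dz]; first by apply/eqP; rewrite linear0.
by apply/eqP; rewrite (hochschild_d_linear c y z) dy dz scaler0 addr0.
Qed.

HB.instance Definition _ n :=
  GRing.isSubmodClosed.Build k (tensor C n.+1) (@cycle_pred n)
    (@cycle_submod_closed n).

Record hcycle n := Hcycle {
  hcycle_val : tensor C n.+1; _ : hcycle_val \in @cycle_pred n }.

HB.instance Definition _ n := [isSub for @hcycle_val n].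
HB.instance Definition _ n := [Choice of hcycle n by <:].
HB.instance Definition _ n := [SubChoice_isSubLmodule of hcycle n by <:].

Definition is_boundary n (z : hcycle n) : Prop :=
  exists y : tensor C n.+2, \val z = hochschild_d y.

(* The boundaries already form a submodule, so lquot adds nothing to them. *)
Definition HH n : lmodType k := lquot (@is_boundary n).

End Hochschild.

Definition has_dim (k : fieldType) (V : lmodType k) (m : nat) : Prop :=
  inhabited (Vector.axiom m V).

(* Main.v *)
Require Import Defs.
From HB Require Import structures.
From mathcomp Require Import all_boot all_order all_algebra.
From mathcomp Require Import boolp finmap monalg zify ring.

Set Implicit Arguments.
Unset Strict Implicit.
Unset Printing Implicit Defensive.

Import GRing.Theory.
Local Open Scope ring_scope.

(** The monomials x^i y^j with i < a and j < b form a basis of the quantum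
complete intersection C, and the product of two of them is a power of q times
a monomial, or 0. Divide the word m_0 | ... | m_n of the Hochschild complex by
the power of q that its product picks up ([gauge]). All faces but the last
become those of the truncated polynomial algebra k[x,y]/(x^a, y^b), and the
last one, which moves m_n to the front, is multiplied by q^(-s) for each x in
m_n and by q^r for each y in m_n, where (r, s) is the total weight of the word
([face_merge], [face_last], [psi_boundary]). So the Hochschild complex of C
is, weight by weight, the Hochschild complex of a commutative algebra with
coefficients twisted by scalars that depend on the weight only.

Let K be the tensor product of the two periodic bimodule resolutions of
k[x]/(x^a) and k[y]/(y^b), with generators e_ij. In weight (r, s) the small
complex given by K has one-dimensional pieces; its differential in the
direction of x multiplies alternately by 1 - q^(-s) and by the sum of the
q^(-cs) for c < a, and similarly in the direction of y with q^r and b. As q is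
not a root of unity, these scalars do not vanish in the direction of x when
s > 0, so such a weight contributes nothing when r > 0 also. On the axes the
scalars are alternately 0 and a, or 0 and b, and a, b are not 0 in k: in each
degree a - 1 words in x and b - 1 words in y survive, and in degree 0 the
word 1 as well ([small_homotopy], [criticalP]).

The two complexes are compared inside K tensored with the bar resolution,
augmented on both sides, with total differential [dtot]. Contracting the bar
resolution shows that the complex with its column of empty words (the small
complex) is acyclic ([dtot_exact]). Contracting K shows that the part with
nonempty words resolves the Hochschild complex ([row_exact], [augm_lift]). A
Hochschild cycle x and a small cycle y therefore represent the same class when
some z satisfies augm z = x and dtot z = y, and this relation ([hh_rel])
computes the homology ([relation_has_dim]). *)

(** * Free modules *)
Section FreeModule.
Variables (k : fieldType) (T : choiceType).

(** A free module is used only through its universal property and through the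
fact that its generators span. *)
Record free_module_on := FreeModuleOn {
  free_sort :> lmodType k;
  free_gen : T -> free_sort;
  free_ext_to : forall W : lmodType k, (T -> W) -> {linear free_sort -> W};
  free_ext_gen : forall (W : lmodType k) (f : T -> W) t,
    free_ext_to f (free_gen t) = f t;
  free_span : forall z : free_sort, exists (s : seq T) (c : T -> k),
    uniq s /\ z = \sum_(t <- s) c t *: free_gen t
}.

Section Extension.
Local Notation V := {malg k[T]}.
Variable W : lmodType k.

Definition ext_fun (f : T -> W) (z : V) : W := \sum_(t <- msupp z) z@_t *: f t.

Lemma ext_funEw (f : T -> W) (E : {fset T}) z :
  (msupp z `<=` E)%fset -> ext_fun f z = \sum_(t <- E) z@_t *: f t.
Proof.
move=> le; rewrite /ext_fun (big_fset_incl _ le) // => t _ /mcoeff_outdom ->.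
by rewrite scale0r.
Qed.

Lemma ext_fun_linear (f : T -> W) : linear (ext_fun f).
Proof.
move=> c z w.
pose E := (msupp (c *: z + w)%R `|` (msupp z `|` msupp w))%fset.
rewrite !(@ext_funEw f E) ?fsubsetUl //.
- rewrite scaler_sumr -big_split; apply: eq_bigr => t _ /=.
  by rewrite mcoeffD mcoeffZ scalerDl scalerA.
- by rewrite /E fsubsetU // fsubsetUr orbT.
- by rewrite /E fsubsetU // fsubsetUl orbT.
Qed.

HB.instance Definition _ (f : T -> W) :=
  GRing.isLinear.Build k V W *:%R (ext_fun f) (ext_fun_linear f).

Lemma ext_funU (f : T -> W) t : ext_fun f << t >> = f t.
Proof.
rewrite (@ext_funEw f [fset t]%fset) ?msuppU_le //.
by rewrite big_seq_fset1 mcoeffUU scale1r.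
Qed.

End Extension.

Lemma malg_gen_sum (z : {malg k[T]}) : z = \sum_(t <- msupp z) z@_t *: << t >>.
Proof.
rewrite {1}[z]monalgE; apply: eq_bigr => t _.
by apply/malgP => t'; rewrite mcoeffZ !mcoeffU mulr_natr.
Qed.

Lemma free_module : free_module_on.
Proof.
apply: (@FreeModuleOn {malg k[T]} (fun t => << t >>)
  (fun W f => ext_fun f : {linear _ -> _}) ext_funU) => z.
exists (msupp z), (fun t => z@_t); split; first exact: fset_uniq.
exact: malg_gen_sum.
Qed.

End FreeModule.

Section FreeModuleTheory.
Variables (k : fieldType) (T : choiceType).
Local Notation V := (free_module k T).

Definition gen (t : T) : V := free_gen _ t.
Definition ext (W : lmodType k) (f : T -> W) : {linear V -> W} := free_ext_to _ f.

Lemma extU (W : lmodType k) (f : T -> W) t : ext f (gen t) = f t.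
Proof. exact: free_ext_gen. Qed.

Lemma lin_ext (W : lmodType k) (f g : {linear V -> W}) :
  (forall t, f (gen t) = g (gen t)) -> f =1 g.
Proof.
move=> fg z; have [s [c [_ ->]]] := free_span z; rewrite !linear_sum.
by apply: eq_bigr => t _; rewrite !linearZ /= [f _]fg.
Qed.

Definition coef (t : T) : {linear V -> k^o} :=
  ext (fun t' => (t' == t)%:R : k^o).

Lemma coef_gen t t' : coef t (gen t') = (t' == t)%:R.
Proof. exact: extU. Qed.

Lemma coef_sum (z : V) : exists s : seq T, z = \sum_(t <- s) coef t z *: gen t.
Proof.
have [s [c [us zE]]] := free_span z; exists s; rewrite {1}zE.
rewrite big_seq [RHS]big_seq; apply: eq_bigr => t ts; congr (_ *: _).
rewrite zE linear_sum (bigD1_seq t) //= linearZ /= coef_gen eqxx.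
rewrite big1 => [|t' /negPf tt']; last by rewrite linearZ /= coef_gen tt' scaler0.
by rewrite addr0 [RHS]mulr1.
Qed.

(** The submodule spanned by the generators that satisfy P; gradings and
filtrations of a free module are all given in this form. *)
Definition supported (P : pred T) : {pred V} :=
  fun z => `[< forall t, coef t z != 0 -> P t >].

Lemma supportedP (P : pred T) z :
  reflect (forall t, coef t z != 0 -> P t) (z \in supported P).
Proof. exact: asboolP. Qed.

Lemma supported_closed (P : pred T) : submod_closed (supported P).
Proof.
split=> [|c z w /supportedP Pz /supportedP Pw].
  by apply/supportedP => t; rewrite linear0 eqxx.
apply/supportedP => t; rewrite linearP /=.
have [z0|z0 _] := eqVneq (coef t z) 0; last exact: Pz.
by rewrite z0 scaler0 add0r; apply: Pw.
Qed.

HB.instance Definition _ (P : pred T) :=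
  GRing.isSubmodClosed.Build k V (supported P) (supported_closed P).

Lemma supportedU (P : pred T) t : P t -> gen t \in supported P.
Proof.
move=> Pt; apply/supportedP => t'; rewrite coef_gen.
by have [<- //|_] := eqVneq t t'; rewrite eqxx.
Qed.

Lemma supported_ind (P : pred T) (W : lmodType k) (S : submodClosed W)
    (f : {linear V -> W}) z :
  (forall t, P t -> f (gen t) \in S) -> z \in supported P -> f z \in S.
Proof.
move=> fS /supportedP zP; have [s zE] := coef_sum z; rewrite zE linear_sum.
rewrite rpred_sum // => t _.
have [->|z0] := eqVneq (coef t z) 0; first by rewrite scale0r linear0 rpred0.
by rewrite linearZ rpredZ // fS // zP.
Qed.

Lemma supportedS (P Q : pred T) z :
  (forall t, P t -> Q t) -> z \in supported P -> z \in supported Q.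
Proof. by move=> PQ /supportedP zP; apply/supportedP => t /zP /PQ. Qed.

Lemma lin_ext_supp (P : pred T) (W : lmodType k) (f g : {linear V -> W}) z :
  (forall t, P t -> f (gen t) = g (gen t)) -> z \in supported P -> f z = g z.
Proof.
move=> fg /supportedP zP; have [s zE] := coef_sum z; rewrite {1 2}zE !linear_sum.
apply: eq_bigr => t _.
have [->|z0] := eqVneq (coef t z) 0; first by rewrite !scale0r !linear0.
by rewrite !linearZ /= fg // zP.
Qed.

End FreeModuleTheory.

(** * Words of monomials *)

Definition madd (m n : nat * nat) : nat * nat := (m.1 + n.1, m.2 + n.2)%N.

Lemma maddA m n p : madd m (madd n p) = madd (madd m n) p.
Proof. by rewrite /madd /= !addnA. Qed.

Lemma maddC m n : madd m n = madd n m.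
Proof. by rewrite /madd addnC [(m.2 + _)%N]addnC. Qed.

Lemma maddCA m n p : madd m (madd n p) = madd n (madd m p).
Proof. by rewrite !maddA (maddC m). Qed.

Lemma madd0 m : madd (0, 0)%N m = m.
Proof. by case: m. Qed.

Section Monomials.
Variables (k : fieldType) (a b : nat).

Definition mon := ('I_a * 'I_b)%type.
(** A word (l, e, u, s) stands for the tensor u e [s] of weight label l. Here
e = (i, j) is the generator e_ij of the periodic resolution K, u is its left
coefficient, the first letter of s is its right coefficient, and the other
letters are the bar part. The empty s is the augmentation of the bar
resolution, where the right coefficient has been moved cyclically into u.
Words with e = (0, 0) also serve as Hochschild chains u | s. The label is
kept independent of the word, so that l can be the parameter of the twist while
the letters of the word vary. *)
Definition word := ((nat * nat) * (nat * nat) * mon * seq mon)%type.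
Definition cx : lmodType k := free_module k word.

Definition in_range (m : nat * nat) := (m.1 < a)%N && (m.2 < b)%N.

Definition ins (m : nat * nat) : option mon :=
  if insub m.1 is Some i then
    if insub m.2 is Some j then Some (i, j) else None
  else None.

Definition exps (m : mon) : nat * nat := (val m.1, val m.2).

Lemma insK m : ins (exps m) = Some m.
Proof. by rewrite /ins /= !valK; case: m. Qed.

Lemma in_range_exps m : in_range (exps m).
Proof. by rewrite /in_range /= !ltn_ord. Qed.

Lemma ins_out m : ~~ in_range m -> ins m = None.
Proof.
rewrite negb_and /ins => /orP[] h; first by rewrite insubN.
by case: insub => // i; rewrite insubN.
Qed.

Lemma ins_in m : in_range m -> exists2 m', m = exps m' & ins m = Some m'.
Proof.
case: m => i j /andP[/= hi hj]; exists (Ordinal hi, Ordinal hj) => //.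
by rewrite -insK.
Qed.

Fixpoint ins_seq (s : seq (nat * nat)) : option (seq mon) :=
  if s is m :: s' then
    if ins m is Some m' then omap (cons m') (ins_seq s') else None
  else Some [::].

Lemma ins_seqK s : ins_seq (map exps s) = Some s.
Proof. by elim: s => //= m s ->; rewrite insK. Qed.

Lemma ins_seq_out s : ~~ all in_range s -> ins_seq s = None.
Proof.
elim: s => //= m s IHs; rewrite negb_and => /orP[/ins_out-> //|/IHs->].
by case: ins.
Qed.

Lemma ins_seq_in s :
  all in_range s -> exists2 s', s = map exps s' & ins_seq s = Some s'.
Proof.
elim: s => [|m s IHs] /=; first by exists [::].
case/andP=> /ins_in[m' -> _] /IHs[s' -> _]; exists (m' :: s') => //.
by rewrite insK ins_seqK.
Qed.

End Monomials.

Arguments exps {a b} m.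

(** The word with exponents u and s, read as 0 as soon as an exponent leaves
the range, since x^a = y^b = 0. Thanks to this convention the formulas below
hold for all exponents. *)
HB.lock Definition bas (k : fieldType) (a b : nat) (l e u : nat * nat)
    (s : seq (nat * nat)) : cx k a b :=
  if ins_seq a b (u :: s) is Some (u' :: s') then gen k (l, e, u', s') else 0.

Section Words.
Variables (k : fieldType) (a b : nat).
Local Notation cx := (cx k a b).
Local Notation word := (word a b).
Local Notation in_range := (in_range a b).
Local Notation bas := (bas k a b).

Lemma bas_exps l e u s : bas l e (exps u) (map exps s) = gen k (l, e, u, s).
Proof. by rewrite bas.unlock /= insK ins_seqK. Qed.

Lemma bas_out l e u s : ~~ all in_range (u :: s) -> bas l e u s = 0.
Proof. by rewrite bas.unlock => /ins_seq_out->. Qed.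

Lemma bas_in l e u s : all in_range (u :: s) ->
  exists u' s', [/\ u = exps u', s = map exps s' & bas l e u s = gen k (l, e, u', s')].
Proof.
case/andP=> /ins_in[u' -> _] /ins_seq_in[s' -> _]; exists u', s'.
by rewrite bas_exps.
Qed.

Lemma cx_ext (W : lmodType k) (f g : {linear cx -> W}) :
  (forall l e u s, all in_range (u :: s) -> f (bas l e u s) = g (bas l e u s)) ->
  f =1 g.
Proof.
move=> fg; apply: lin_ext => -[[[l e] u] s]; rewrite -bas_exps fg //=.
by rewrite in_range_exps; apply/allP => _ /mapP[m _ ->]; exact: in_range_exps.
Qed.

Section Operator.
Variable W : lmodType k.
Implicit Type F : nat * nat -> nat * nat -> nat * nat -> seq (nat * nat) -> W.

Definition word_ext F : {linear cx -> W} :=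
  ext (fun t : word => let: (l, e, u, s) := t in F l e (exps u) (map exps s)).

Lemma word_extE_in F l e u s : all in_range (u :: s) -> word_ext F (bas l e u s) = F l e u s.
Proof. by case/(bas_in l e) => u' [s' [-> -> ->]]; rewrite /word_ext extU. Qed.

(** The formula holds beyond the range when it vanishes there itself. *)
Lemma word_extE F l e u s : (~~ all in_range (u :: s) -> F l e u s = 0) ->
  word_ext F (bas l e u s) = F l e u s.
Proof.
have [/word_extE_in-> //|out ->//] := boolP (all _ _).
by rewrite bas_out // linear0.
Qed.

End Operator.

Definition wpred := nat * nat -> nat * nat -> nat * nat -> seq (nat * nat) -> bool.

Definition supp (P : wpred) : {pred cx} :=
  @supported k _ (fun t : word => let: (l, e, u, s) := t in P l e (exps u) (map exps s)).

Lemma supp_bas (P : wpred) l e u s : P l e u s -> bas l e u s \in supp P.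
Proof.
move=> Ps; have [/(bas_in l e)[u' [s' [Eu Es ->]]]|/bas_out->] := boolP (all in_range (u :: s)).
  by apply: supportedU; rewrite -Eu -Es.
exact: rpred0.
Qed.

Lemma supp_ind (P : wpred) (W : lmodType k) (S : submodClosed W) (f : {linear cx -> W}) z :
  (forall l e u s, all in_range (u :: s) -> P l e u s -> f (bas l e u s) \in S) ->
  z \in supp P -> f z \in S.
Proof.
move=> fS; apply: supported_ind => -[[[l e] u] s] Ps; rewrite -bas_exps; apply: fS => //=.
by rewrite in_range_exps; apply/allP => _ /mapP[m _ ->]; exact: in_range_exps.
Qed.

Lemma cx_ext_supp (P : wpred) (W : lmodType k) (f g : {linear cx -> W}) z :
  (forall l e u s, all in_range (u :: s) -> P l e u s ->
     f (bas l e u s) = g (bas l e u s)) ->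
  z \in supp P -> f z = g z.
Proof.
move=> fg; apply: lin_ext_supp => -[[[l e] u] s] Ps; rewrite -bas_exps fg //=.
by rewrite in_range_exps; apply/allP => _ /mapP[m _ ->]; exact: in_range_exps.
Qed.

Lemma supp_sub (P Q : wpred) z :
  (forall l e u s, P l e u s -> Q l e u s) -> z \in supp P -> z \in supp Q.
Proof. by move=> PQ; apply: supportedS => -[[[l e] u] s]; apply: PQ. Qed.

End Words.

Arguments word_ext {k a b W} F.
Arguments supp {k a b} P.

(** * The twisted bar differential *)

(** The scalar by which the monomial m is multiplied when it passes from the
end of a word of label l to its front. *)
Definition chi (k : fieldType) (zeta xi : nat * nat -> k) (l m : nat * nat) : k :=
  zeta l ^+ m.1 * xi l ^+ m.2.

HB.lock Definition lmul (k : fieldType) (a b : nat) (m : nat * nat) :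
    cx k a b -> cx k a b :=
  word_ext (fun l e u s => bas k a b l e (madd m u) s).

(** Right multiplication acts on the right coefficient; that of an empty word
has been moved to the front, which costs the factor [chi]. *)
HB.lock Definition rmul (k : fieldType) (a b : nat) (zeta xi : nat * nat -> k)
    (m : nat * nat) : cx k a b -> cx k a b :=
  word_ext (fun l e u s =>
    if s is v :: s' then bas k a b l e u (madd m v :: s')
    else chi zeta xi l m *: bas k a b l e (madd m u) [::]).

HB.lock Definition push (k : fieldType) (a b : nat) (m : nat * nat) :
    cx k a b -> cx k a b :=
  word_ext (fun l e u s => bas k a b l e u (m :: s)).

(** Shifts and signs in K: phi e is a coefficient and the new degree. *)
HB.lock Definition emap (k : fieldType) (a b : nat)
    (phi : nat * nat -> k * (nat * nat)) : cx k a b -> cx k a b :=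
  word_ext (fun l e u s => (phi e).1 *: bas k a b l (phi e).2 u s).

(** The alternating sum of the faces that multiply two consecutive letters of
s, and of the twisted cyclic face. Peeling off the first letter v gives a
recursion: the face that uses v is a right multiplication, and the other ones
leave v in place. [bar_sum] gives the explicit sum. *)
Fixpoint bar_word (k : fieldType) (a b : nat) (zeta xi : nat * nat -> k)
    (l e u : nat * nat) (s : seq (nat * nat)) : cx k a b :=
  if s is v :: s' then
    rmul zeta xi v (bas k a b l e u s') - push v (bar_word a b zeta xi l e u s')
  else 0.

HB.lock Definition bar (k : fieldType) (a b : nat) (zeta xi : nat * nat -> k) :
    cx k a b -> cx k a b :=
  word_ext (bar_word a b zeta xi).

Section Operators.
Variables (k : fieldType) (a b : nat).
Variables (zeta xi : nat * nat -> k).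
Local Notation V := (cx k a b).
Local Notation bas := (bas k a b).
Local Notation in_range := (in_range a b).
Local Notation chi := (chi zeta xi).
Local Notation lmul := (@lmul k a b).
Local Notation rmul := (@rmul k a b zeta xi).
Local Notation push := (@push k a b).
Local Notation emap := (@emap k a b).
Local Notation bar_word := (bar_word a b zeta xi).
Local Notation bar := (@bar k a b zeta xi).

Fact lmul_linear m : linear (lmul m).
Proof. by rewrite lmul.unlock; exact: linearP. Qed.
Fact rmul_linear m : linear (rmul m).
Proof. by rewrite rmul.unlock; exact: linearP. Qed.
Fact push_linear m : linear (push m).
Proof. by rewrite push.unlock; exact: linearP. Qed.
Fact emap_linear phi : linear (emap phi).
Proof. by rewrite emap.unlock; exact: linearP. Qed.
Fact bar_linear : linear bar.
Proof. by rewrite bar.unlock; exact: linearP. Qed.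
HB.instance Definition _ m := GRing.isLinear.Build k V V *:%R (lmul m) (lmul_linear m).
HB.instance Definition _ m := GRing.isLinear.Build k V V *:%R (rmul m) (rmul_linear m).
HB.instance Definition _ m := GRing.isLinear.Build k V V *:%R (push m) (push_linear m).
HB.instance Definition _ phi := GRing.isLinear.Build k V V *:%R (emap phi) (emap_linear phi).
HB.instance Definition _ := GRing.isLinear.Build k V V *:%R bar bar_linear.

Lemma chiM l m n : chi l (madd m n) = chi l m * chi l n.
Proof. by rewrite /chi /= !exprD mulrACA. Qed.

Lemma in_range_madd m n : in_range (madd m n) -> in_range n.
Proof. by rewrite /in_range /=; lia. Qed.

Lemma lmulE m l e u s : lmul m (bas l e u s) = bas l e (madd m u) s.
Proof.
rewrite lmul.unlock; apply: word_extE => out; apply: bas_out; apply: contra out => /= /andP[h ->].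
by rewrite (in_range_madd h).
Qed.

Lemma rmul_cons m l e u v s :
  rmul m (bas l e u (v :: s)) = bas l e u (madd m v :: s).
Proof.
rewrite rmul.unlock; apply: word_extE => out; apply: bas_out; apply: contra out => /= /and3P[-> h ->].
by rewrite (in_range_madd h).
Qed.

Lemma rmul_nil m l e u :
  rmul m (bas l e u [::]) = chi l m *: bas l e (madd m u) [::].
Proof.
rewrite rmul.unlock; apply: word_extE => out; rewrite bas_out ?scaler0 //; apply: contra out => /=.
by rewrite !andbT => /in_range_madd.
Qed.

Lemma pushE m l e u s : push m (bas l e u s) = bas l e u (m :: s).
Proof.
by rewrite push.unlock; apply: word_extE => out; apply: bas_out; apply: contra out => /= /and3P[-> _ ->].
Qed.

Lemma emapE phi l e u s :
  emap phi (bas l e u s) = (phi e).1 *: bas l (phi e).2 u s.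
Proof. by rewrite emap.unlock; apply: word_extE => out; rewrite bas_out ?scaler0. Qed.

Lemma lmulM m n z : lmul m (lmul n z) = lmul (madd m n) z.
Proof.
suff h : lmul m \o lmul n =1 lmul (madd m n) by exact: h.
apply: cx_ext => l e u s _ /=.
by rewrite !lmulE maddA.
Qed.

Lemma rmulM m n z : rmul m (rmul n z) = rmul (madd m n) z.
Proof.
suff h : rmul m \o rmul n =1 rmul (madd m n) by exact: h.
apply: cx_ext => l e u [|v s] _ /=.
  by rewrite !rmul_nil linearZ /= rmul_nil scalerA maddA chiM mulrC.
by rewrite !rmul_cons maddA.
Qed.

Lemma lmulC m n z : lmul m (lmul n z) = lmul n (lmul m z).
Proof. by rewrite !lmulM maddC. Qed.

Lemma rmulC m n z : rmul m (rmul n z) = rmul n (rmul m z).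
Proof. by rewrite !rmulM maddC. Qed.

Lemma rmul0 z : rmul (0, 0)%N z = z.
Proof.
suff h : rmul (0, 0)%N =1 (idfun : V -> V) by exact: h.
apply: cx_ext => l e u [|v s] _ /=.
  by rewrite rmul_nil madd0 /chi !expr0 mulr1 scale1r.
by rewrite rmul_cons madd0.
Qed.

Lemma lmul_out m z : ~~ in_range m -> lmul m z = 0.
Proof.
move=> out; suff h : lmul m =1 (\0 : V -> V) by exact: h.
apply: cx_ext => l e u s _ /=.
rewrite lmulE bas_out //; apply: contra out => /= /andP[h _].
by move: h; rewrite maddC => /in_range_madd.
Qed.

Lemma rmul_out m z : ~~ in_range m -> rmul m z = 0.
Proof.
move=> out; suff h : rmul m =1 (\0 : V -> V) by exact: h.
apply: cx_ext => l e u [|v s] _ /=.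
  rewrite rmul_nil bas_out ?scaler0 //; apply: contra out => /= /andP[h _].
  by move: h; rewrite maddC => /in_range_madd.
rewrite rmul_cons bas_out //; apply: contra out => /= /and3P[_ h _].
by move: h; rewrite maddC => /in_range_madd.
Qed.

Lemma lmul_rmul m n z : lmul m (rmul n z) = rmul n (lmul m z).
Proof.
suff h : lmul m \o rmul n =1 rmul n \o lmul m by exact: h.
apply: cx_ext.
move=> l e u [|v s] _ /=; rewrite lmulE.
  by rewrite !rmul_nil linearZ /= lmulE maddCA.
by rewrite !rmul_cons lmulE.
Qed.

Lemma lmul_push m n z : lmul m (push n z) = push n (lmul m z).
Proof.
suff h : lmul m \o push n =1 push n \o lmul m by exact: h.
apply: cx_ext.
by move=> l e u s _ /=; rewrite !(lmulE, pushE).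
Qed.

Lemma rmul_push m n z : rmul m (push n z) = push (madd m n) z.
Proof.
suff h : rmul m \o push n =1 push (madd m n) by exact: h.
apply: cx_ext.
by move=> l e u s _ /=; rewrite !pushE rmul_cons.
Qed.

Lemma emap_lmul phi m z : emap phi (lmul m z) = lmul m (emap phi z).
Proof.
suff h : emap phi \o lmul m =1 lmul m \o emap phi by exact: h.
apply: cx_ext.
by move=> l e u s _ /=; rewrite !lmulE !emapE linearZ /= lmulE.
Qed.

Lemma emap_rmul phi m z : emap phi (rmul m z) = rmul m (emap phi z).
Proof.
suff h : emap phi \o rmul m =1 rmul m \o emap phi by exact: h.
apply: cx_ext.
move=> l e u [|v s] _ /=; rewrite emapE linearZ /=.
  by rewrite !rmul_nil linearZ /= emapE !scalerA mulrC.
by rewrite !rmul_cons emapE.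
Qed.

Lemma emap_push phi m z : emap phi (push m z) = push m (emap phi z).
Proof.
suff h : emap phi \o push m =1 push m \o emap phi by exact: h.
apply: cx_ext.
by move=> l e u s _ /=; rewrite !pushE !emapE linearZ /= pushE.
Qed.

Lemma emap_emap phi psi z : emap phi (emap psi z) =
  emap (fun e => ((psi e).1 * (phi (psi e).2).1, (phi (psi e).2).2)) z.
Proof.
pose phipsi e := ((psi e).1 * (phi (psi e).2).1, (phi (psi e).2).2).
suff h : emap phi \o emap psi =1 emap phipsi by exact: h.
apply: cx_ext => l e u s _ /=.
by rewrite !emapE linearZ /= emapE scalerA.
Qed.

Lemma eq_emap phi psi z : (forall e, (phi e).1 = (psi e).1) ->
  (forall e, (phi e).1 != 0 -> (phi e).2 = (psi e).2) -> emap phi z = emap psi z.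
Proof.
move=> h1 h2; apply: cx_ext => l e u s _ /=; rewrite !emapE -h1.
by have [->|/h2->//] := eqVneq (phi e).1 0; rewrite !scale0r.
Qed.

Lemma bar_nil l e u : bar (bas l e u [::]) = 0.
Proof. by rewrite bar.unlock; exact: word_extE. Qed.

Lemma push_out m z : ~~ in_range m -> push m z = 0.
Proof.
move=> out; suff h : push m =1 (\0 : V -> V) by exact: h.
apply: cx_ext => l e u s _ /=.
by rewrite pushE bas_out //; apply: contra out => /= /and3P[].
Qed.

(** For m = (0, 0), the unit, right multiplication is the identity: pushing 1
is then a contraction of [bar]. *)
Lemma bar_push m z : bar (push m z) = rmul m z - push m (bar z).
Proof.
have [in_m|out] := boolP (in_range m); last first.
  by rewrite rmul_out // !push_out // linear0 subr0.
suff h : bar \o push m =1 (rmul m \- (push m \o bar)) by exact: h.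
apply: cx_ext => l e u s us /=.
have barE s' : all in_range (u :: s') -> bar (bas l e u s') = bar_word l e u s'.
  by rewrite bar.unlock; exact: word_extE_in.
by rewrite pushE !barE //=; case/andP: us => ? ?; apply/and3P.
Qed.

Lemma bar_lmul m z : bar (lmul m z) = lmul m (bar z).
Proof.
suff h : bar \o lmul m =1 lmul m \o bar by exact: h.
apply: cx_ext => l e u s _ /=.
rewrite lmulE; elim: s => [|v s IHs]; first by rewrite !bar_nil linear0.
rewrite -!pushE !bar_push linearB /= lmul_push -IHs.
by rewrite lmul_rmul lmulE.
Qed.

Lemma bar_rmul m z : bar (rmul m z) = rmul m (bar z).
Proof.
suff h : bar \o rmul m =1 rmul m \o bar by exact: h.
apply: cx_ext => l e u [|v s] _ /=.
  by rewrite rmul_nil linearZ /= !bar_nil scaler0 linear0.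
rewrite -pushE rmul_push !bar_push linearB /=.
by rewrite rmulM rmul_push.
Qed.

Lemma emap_bar phi z : emap phi (bar z) = bar (emap phi z).
Proof.
suff h : emap phi \o bar =1 bar \o emap phi by exact: h.
apply: cx_ext => l e u s _ /=.
rewrite emapE linearZ /=; elim: s => [|v s IHs].
  by rewrite !bar_nil linear0 scaler0.
rewrite -!pushE !bar_push linearB /= emap_rmul emap_push IHs emapE.
by rewrite scalerBr !linearZ.
Qed.

Lemma bar_bar z : bar (bar z) = 0.
Proof.
suff h : bar \o bar =1 (\0 : V -> V) by exact: h.
apply: cx_ext => l e u s _ /=.
elim: s => [|v s IHs]; first by rewrite bar_nil linear0.
by rewrite -pushE bar_push linearB /= bar_push IHs linear0 subr0 bar_rmul subrr.
Qed.

End Operators.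

(** * Periodic differentials in one variable *)

Definition mscale (c : nat) (g : nat * nat) : nat * nat := (c * g.1, c * g.2)%N.

Lemma mscale1 g : mscale 1 g = g.
Proof. by case: g => x y; rewrite /mscale !mul1n. Qed.

(** Left minus right multiplication by g, that is, by g (x) 1 - 1 (x) g. *)
HB.lock Definition comm_diff (k : fieldType) (a b : nat)
    (zeta xi : nat * nat -> k) (g : nat * nat) (z : cx k a b) : cx k a b :=
  lmul g z - rmul zeta xi g z.

(** The sum of the g^c (x) g^(N-1-c). The two operators annihilate each other
because g^N = 0; alternating them gives the periodic resolution of
k[g]/(g^N) by free bimodules. *)
HB.lock Definition comm_norm (k : fieldType) (a b : nat)
    (zeta xi : nat * nat -> k) (N : nat) (g : nat * nat) (z : cx k a b) : cx k a b :=
  \sum_(c < N) lmul (mscale c g) (rmul zeta xi (mscale (N.-1 - c) g) z).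

(** The periodic differential: lo and le are meant as the parts of the shift by
one degree that leave odd, respectively positive even, degrees. *)
HB.lock Definition koszul (k : fieldType) (a b : nat) (zeta xi : nat * nat -> k)
    (N : nat) (g : nat * nat) (lo le : nat * nat -> k * (nat * nat))
    (z : cx k a b) : cx k a b :=
  comm_diff zeta xi g (emap lo z) + comm_norm zeta xi N g (emap le z).

Section Koszul.
Variables (k : fieldType) (a b : nat).
Variables (zeta xi : nat * nat -> k).
Local Notation V := (cx k a b).
Local Notation lmul := (@lmul k a b).
Local Notation rmul := (@rmul k a b zeta xi).
Local Notation emap := (@emap k a b).
Local Notation bar := (@bar k a b zeta xi).
Local Notation koszul := (@koszul k a b zeta xi).
Local Notation comm_diff := (@comm_diff k a b zeta xi).
Local Notation comm_norm := (@comm_norm k a b zeta xi).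

Lemma comm_diffE g z : comm_diff g z = lmul g z - rmul g z.
Proof. by rewrite comm_diff.unlock. Qed.

Lemma comm_normE N g z : comm_norm N g z =
  \sum_(c < N) lmul (mscale c g) (rmul (mscale (N.-1 - c) g) z).
Proof. by rewrite comm_norm.unlock. Qed.

Section One.
Variables (N : nat) (g : nat * nat).

Local Notation comm_diff := (comm_diff g).
Local Notation comm_norm := (comm_norm N g).

Lemma koszulE lo le z :
  koszul N g lo le z = comm_diff (emap lo z) + comm_norm (emap le z).
Proof. by rewrite koszul.unlock. Qed.

Fact comm_diff_linear : linear comm_diff.
Proof.
by move=> c z w; rewrite !comm_diffE !linearP /= addrACA -scalerDr.
Qed.
HB.instance Definition _ := GRing.isLinear.Build k V V *:%R comm_diff comm_diff_linear.

Fact comm_norm_linear : linear comm_norm.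
Proof.
move=> c z w; rewrite !comm_normE scaler_sumr -big_split; apply: eq_bigr => i _ /=.
by rewrite !linearP.
Qed.
HB.instance Definition _ := GRing.isLinear.Build k V V *:%R comm_norm comm_norm_linear.

Fact koszul_linear lo le : linear (koszul N g lo le).
Proof.
by move=> c z w; rewrite !koszulE !linearP /= addrACA -scalerDr.
Qed.
HB.instance Definition _ lo le :=
  GRing.isLinear.Build k V V *:%R (koszul N g lo le) (koszul_linear lo le).

Section Commute.
Variable f : {linear V -> V}.
Hypothesis f_lmul : forall c z, f (lmul (mscale c g) z) = lmul (mscale c g) (f z).
Hypothesis f_rmul : forall c z, f (rmul (mscale c g) z) = rmul (mscale c g) (f z).

Lemma comm_diffC z : f (comm_diff z) = comm_diff (f z).
Proof.
by have:= (f_lmul 1 z, f_rmul 1 z); rewrite mscale1 !comm_diffE linearB /= => -[-> ->].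
Qed.

Lemma comm_normC z : f (comm_norm z) = comm_norm (f z).
Proof.
by rewrite !comm_normE linear_sum; apply: eq_bigr => c _ /=; rewrite f_lmul f_rmul.
Qed.

End Commute.

Lemma comm_diff_lmul m z : lmul m (comm_diff z) = comm_diff (lmul m z).
Proof. by apply: comm_diffC => *; first [exact: lmulC | exact: lmul_rmul]. Qed.

Lemma comm_diff_rmul m z : rmul m (comm_diff z) = comm_diff (rmul m z).
Proof. by apply: comm_diffC => *; first [exact: rmulC | exact/esym/lmul_rmul]. Qed.

Lemma comm_norm_lmul m z : lmul m (comm_norm z) = comm_norm (lmul m z).
Proof. by apply: comm_normC => *; first [exact: lmulC | exact: lmul_rmul]. Qed.

Lemma comm_norm_rmul m z : rmul m (comm_norm z) = comm_norm (rmul m z).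
Proof. by apply: comm_normC => *; first [exact: rmulC | exact/esym/lmul_rmul]. Qed.

Lemma emap_comm_diff phi z : emap phi (comm_diff z) = comm_diff (emap phi z).
Proof.
by apply: (comm_diffC (f := emap phi)) => *; rewrite /= (emap_lmul, emap_rmul).
Qed.

Lemma emap_comm_norm phi z : emap phi (comm_norm z) = comm_norm (emap phi z).
Proof.
by apply: (comm_normC (f := emap phi)) => *; rewrite /= (emap_lmul, emap_rmul).
Qed.

Lemma koszul_cons lo le l e u v s :
  koszul N g lo le (bas k a b l e u (v :: s)) =
  (lo e).1 *: (bas k a b l (lo e).2 (madd g u) (v :: s)
               - bas k a b l (lo e).2 u (madd g v :: s))
  + (le e).1 *: \sum_(c < N) bas k a b l (le e).2 (madd (mscale c g) u)
                               (madd (mscale (N.-1 - c) g) v :: s).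
Proof.
rewrite koszulE !emapE !linearZ /= comm_diffE comm_normE lmulE rmul_cons.
congr (_ + _ *: _); apply: eq_bigr => c _.
by rewrite rmul_cons lmulE.
Qed.

Lemma koszul_nil lo le l e u :
  koszul N g lo le (bas k a b l e u [::]) =
  ((lo e).1 * (1 - chi zeta xi l g)) *: bas k a b l (lo e).2 (madd g u) [::]
  + ((le e).1 * \sum_(c < N) chi zeta xi l (mscale (N.-1 - c) g)) *:
    bas k a b l (le e).2 (madd (mscale N.-1 g) u) [::].
Proof.
rewrite koszulE !emapE !linearZ /= comm_diffE comm_normE lmulE rmul_nil.
rewrite -(scalerA (lo e).1) -(scalerA (le e).1) scalerBl scale1r scaler_suml; congr (_ + _ *: _).
apply: eq_bigr => -[c cN] _ /=; rewrite rmul_nil linearZ /= lmulE maddA.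
by congr (_ *: bas _ _ _ _ _ (madd _ _) _); rewrite /madd /mscale /= -!mulnDl subnKC //; lia.
Qed.

Hypothesis N_gt0 : (0 < N)%N.
Hypothesis gN : ~~ in_range a b (mscale N g).

(** The product telescopes to g^N (x) 1 - 1 (x) g^N, which is 0. *)
Lemma diff_norm z : comm_diff (comm_norm z) = 0.
Proof.
pose f c := lmul (mscale c g) (rmul (mscale (N - c) g) z).
transitivity (\sum_(0 <= c < N) (f c.+1 - f c)); last first.
  rewrite telescope_sumr // /f subnn subn0 lmul_out // rmul_out // linear0 subrr.
  by [].
rewrite big_mkord comm_normE linear_sum; apply: eq_bigr => -[c cN] _ /=.
rewrite !comm_diffE /f -lmul_rmul rmulM lmulM.
congr (lmul _ (rmul _ _) - lmul _ (rmul _ _)); rewrite /madd /mscale /=;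
  congr pair; rewrite -?mulSn ?(subnS, subn1) //; congr (_ * _)%N; lia.
Qed.

Lemma norm_diff z : comm_norm (comm_diff z) = 0.
Proof.
rewrite -(diff_norm z); apply: (comm_diffC (f := comm_norm)) => m w.
  by rewrite /= comm_norm_lmul.
by rewrite comm_norm_rmul.
Qed.

Lemma koszul_koszul lo le z :
  (forall z, emap lo (emap lo z) = 0) -> (forall z, emap le (emap le z) = 0) ->
  koszul N g lo le (koszul N g lo le z) = 0.
Proof.
move=> lo0 le0; rewrite !koszulE !linearD /= !emap_comm_diff !emap_comm_norm.
by rewrite lo0 le0 diff_norm norm_diff !linear0 !addr0.
Qed.

Lemma bar_koszul lo le z : bar (koszul N g lo le z) = koszul N g lo le (bar z).
Proof.
rewrite !koszulE linearD /= !emap_bar.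
by congr (_ + _); [apply: (comm_diffC (f := bar))|apply: (comm_normC (f := bar))]
  => m w; rewrite /= (bar_lmul, bar_rmul).
Qed.

Lemma lmul_koszul lo le m z :
  lmul m (koszul N g lo le z) = koszul N g lo le (lmul m z).
Proof. by rewrite !koszulE linearD /= comm_diff_lmul comm_norm_lmul !emap_lmul. Qed.

Lemma rmul_koszul lo le m z :
  rmul m (koszul N g lo le z) = koszul N g lo le (rmul m z).
Proof. by rewrite !koszulE linearD /= comm_diff_rmul comm_norm_rmul !emap_rmul. Qed.

Lemma koszulC (f : {linear V -> V}) lo le lo' le' z :
  (forall c z, f (lmul (mscale c g) z) = lmul (mscale c g) (f z)) ->
  (forall c z, f (rmul (mscale c g) z) = rmul (mscale c g) (f z)) ->
  f (emap lo z) = emap lo' (f z) -> f (emap le z) = emap le' (f z) ->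
  f (koszul N g lo le z) = koszul N g lo' le' (f z).
Proof.
move=> fl fr flo fle.
by rewrite !koszulE linearD /= comm_diffC // comm_normC // flo fle.
Qed.

End One.

Lemma koszul_comm N g lo le N' g' lo' le' z :
  (forall z, emap lo (emap lo' z) = emap lo' (emap lo z)) ->
  (forall z, emap lo (emap le' z) = emap le' (emap lo z)) ->
  (forall z, emap le (emap lo' z) = emap lo' (emap le z)) ->
  (forall z, emap le (emap le' z) = emap le' (emap le z)) ->
  koszul N g lo le (koszul N' g' lo' le' z) =
  koszul N' g' lo' le' (koszul N g lo le z).
Proof.
move=> h1 h2 h3 h4.
have emapC phi : emap lo (emap phi z) = emap phi (emap lo z) ->
    emap le (emap phi z) = emap phi (emap le z) ->
    koszul N g lo le (emap phi z) = emap phi (koszul N g lo le z).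
  by move=> hlo hle; apply/esym/(koszulC N (f := emap phi)) => * /=;
     rewrite ?emap_lmul ?emap_rmul.
apply: (koszulC N' (f := koszul N g lo le)) => * /=;
  by rewrite ?lmul_koszul ?rmul_koszul ?emapC.
Qed.

End Koszul.

(** The contraction of the periodic resolution of k[g]/(g^N), as a complex of
right modules. Here beta i u v is g^u e_i g^v. In even degrees the homotopy
divides g^u (x) 1 - 1 (x) g^u by g (x) 1 - 1 (x) g; in odd degrees it sees
only the leading term g^(N-1) of the norm element. *)
Section Slice.
Variables (k : fieldType) (W : lmodType k) (d s : {linear W -> W}).
Variables (N : nat) (beta : nat -> nat -> nat -> W).
Hypothesis beta_out : forall i u v, (N <= u)%N || (N <= v)%N -> beta i u v = 0.
Hypothesis d0 : forall u v, d (beta 0 u v) = 0.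
Hypothesis dS : forall i u v, d (beta i.+1 u v) =
  if odd i then \sum_(c < N) beta i (c + u) (N.-1 - c + v)
  else beta i u.+1 v - beta i u v.+1.
Hypothesis sE : forall i u v, (u < N)%N -> s (beta i u v) =
  if odd i then (if u == N.-1 then beta i.+1 0 v else 0)
  else \sum_(c < u) beta i.+1 c (u.-1 - c + v).

Lemma slice_contraction i u v : (u < N)%N ->
  d (s (beta i u v)) + s (d (beta i u v)) =
  beta i u v - (if i == 0%N then beta 0 0 (u + v) else 0).
Proof.
move=> uN; have [oi|ei] := boolP (odd i).
  rewrite sE // oi; case: i oi => //= i ei.
  rewrite dS (negPf ei) linearB subr0 /= (sE _ v.+1) // (negPf ei).
  have [uE|u_neq] := eqVneq u N.-1.
    have -> : beta i u.+1 v = 0 by apply: beta_out; rewrite uE; lia.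
    rewrite linear0 sub0r dS /= (negPf ei) /=.
    case: N uN uE beta_out => // n _ /= -> _; rewrite big_ord_recr /= addn0.
    rewrite subnn add0n -[RHS]add0r addrAC; congr (_ + _).
    apply/eqP; rewrite subr_eq0; apply/eqP; apply: eq_bigr => -[c cn] _ /=.
    by rewrite addn0; congr (beta _ _ _); lia.
  rewrite linear0 add0r sE; last lia.
  rewrite (negPf ei) big_ord_recr /= subnn add0n -[RHS]add0r addrAC; congr (_ + _).
  apply/eqP; rewrite subr_eq0; apply/eqP; apply: eq_bigr => -[c cn] _ /=.
  by congr (beta _ _ _); lia.
rewrite sE // (negPf ei) linear_sum.
pose f c := beta i c (u - c + v).
have -> : \sum_(c < u) d (beta i.+1 c (u.-1 - c + v)) = beta i u v - beta i 0 (u + v).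
  transitivity (\sum_(0 <= c < u) (f c.+1 - f c)).
    rewrite big_mkord; apply: eq_bigr => -[c cu] _ /=; rewrite dS (negPf ei) /f.
    by congr (beta _ _ _ - beta _ _ _); lia.
  by rewrite telescope_sumr // /f subnn add0n subn0.
rewrite -addrA; congr (_ + _).
case: i ei {f} => [|i] /= oi; first by rewrite d0 linear0 addr0.
rewrite negbK in oi; rewrite dS oi linear_sum oppr0 /=.
have cN : (N.-1 - u < N)%N by lia.
rewrite (bigD1 (Ordinal cN)) //= big1 => [|[c cltN] /eqP ne]; last first.
  have [cuN|cuN] := ltnP (c + u) N; last by rewrite beta_out ?linear0 ?cuN.
  rewrite sE // oi ifN //; apply/eqP => /= E; case: ne; apply/val_inj => /=; lia.
rewrite addr0 sE; last lia.
rewrite oi ifT; last by apply/eqP; lia.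
by apply/eqP; rewrite addrC subr_eq0; apply/eqP; congr (beta _ _ _); lia.
Qed.

End Slice.

(** * Augmentation, section and contractions *)

(** The augmentation of K, sending u e_00 v to u v: it takes nonempty words of
degree (0, 0) to Hochschild chains. *)
HB.lock Definition augm (k : fieldType) (a b : nat) : cx k a b -> cx k a b :=
  word_ext (fun l e u s => if s is v :: s' then
    if e == (0, 0)%N then bas k a b l e (madd u v) s' else 0 else 0).

(** The section of the augmentation sending u to 1 e_00 u. *)
HB.lock Definition sect (k : fieldType) (a b : nat) : cx k a b -> cx k a b :=
  word_ext (fun l e u s => bas k a b l e (0, 0)%N (u :: s)).

HB.lock Definition empty_part (k : fieldType) (a b : nat) : cx k a b -> cx k a b :=
  word_ext (fun l e u s => if s is v :: s' then 0 else bas k a b l e u s).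

(** In degree 0 in the direction of x, move the power of x from the left
coefficient to the right one: section after augmentation for the variable x
alone. *)
HB.lock Definition collapseA (k : fieldType) (a b : nat) : cx k a b -> cx k a b :=
  word_ext (fun l e u s => if s is v :: s' then
    if e.1 == 0%N then bas k a b l e (0, u.2)%N ((u.1 + v.1, v.2)%N :: s') else 0
  else 0).

HB.lock Definition collapseB (k : fieldType) (a b : nat) : cx k a b -> cx k a b :=
  word_ext (fun l e u s => if s is v :: s' then
    if e.2 == 0%N then bas k a b l e (u.1, 0)%N ((v.1, u.2 + v.2)%N :: s') else 0
  else 0).

(** The homotopy of [slice_contraction] in the direction of x, applied to the
left and right coefficients of e_ij. *)
HB.lock Definition contrA (k : fieldType) (a b : nat) : cx k a b -> cx k a b :=
  word_ext (fun l e u s => if s is v :: s' then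
    if odd e.1 then
      if u.1 == a.-1 then bas k a b l (e.1.+1, e.2) (0, u.2)%N (v :: s') else 0
    else \sum_(c < u.1)
      bas k a b l (e.1.+1, e.2) (c : nat, u.2) ((u.1.-1 - c + v.1, v.2)%N :: s')
  else 0).

HB.lock Definition contrB (k : fieldType) (a b : nat) : cx k a b -> cx k a b :=
  word_ext (fun l e u s => if s is v :: s' then
    if odd e.2 then
      if u.2 == b.-1 then bas k a b l (e.1, e.2.+1) (u.1, 0)%N (v :: s') else 0
    else \sum_(c < u.2)
      bas k a b l (e.1, e.2.+1) (u.1, c : nat) ((v.1, u.2.-1 - c + v.2)%N :: s')
  else 0).

Section Resolution.
Variables (k : fieldType) (a b : nat).
Variables (zeta xi : nat * nat -> k).
Local Notation V := (cx k a b).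
Local Notation bas := (bas k a b).
Local Notation in_range := (in_range a b).
Local Notation lmul := (@lmul k a b).
Local Notation rmul := (@rmul k a b zeta xi).
Local Notation emap := (@emap k a b).
Local Notation koszul := (@koszul k a b zeta xi).
Local Notation augm := (@augm k a b).
Local Notation sect := (@sect k a b).
Local Notation empty_part := (@empty_part k a b).
Local Notation collapseA := (@collapseA k a b).
Local Notation collapseB := (@collapseB k a b).
Local Notation contrA := (@contrA k a b).
Local Notation contrB := (@contrB k a b).

Fact augm_linear : linear augm.
Proof. by rewrite augm.unlock; exact: linearP. Qed.
Fact sect_linear : linear sect.
Proof. by rewrite sect.unlock; exact: linearP. Qed.
Fact empty_part_linear : linear empty_part.
Proof. by rewrite empty_part.unlock; exact: linearP. Qed.
Fact collapseA_linear : linear collapseA.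
Proof. by rewrite collapseA.unlock; exact: linearP. Qed.
Fact collapseB_linear : linear collapseB.
Proof. by rewrite collapseB.unlock; exact: linearP. Qed.
Fact contrA_linear : linear contrA.
Proof. by rewrite contrA.unlock; exact: linearP. Qed.
Fact contrB_linear : linear contrB.
Proof. by rewrite contrB.unlock; exact: linearP. Qed.
HB.instance Definition _ := GRing.isLinear.Build k V V *:%R augm augm_linear.
HB.instance Definition _ := GRing.isLinear.Build k V V *:%R sect sect_linear.
HB.instance Definition _ := GRing.isLinear.Build k V V *:%R empty_part empty_part_linear.
HB.instance Definition _ :=
  GRing.isLinear.Build k V V *:%R collapseA collapseA_linear.
HB.instance Definition _ :=
  GRing.isLinear.Build k V V *:%R collapseB collapseB_linear.
HB.instance Definition _ := GRing.isLinear.Build k V V *:%R contrA contrA_linear.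
HB.instance Definition _ := GRing.isLinear.Build k V V *:%R contrB contrB_linear.

Lemma augm_cons l e u v s : augm (bas l e u (v :: s)) =
  if e == (0, 0)%N then bas l e (madd u v) s else 0.
Proof.
rewrite augm.unlock; apply: word_extE; case: eqP => // _ out; apply: bas_out.
by apply: contra out; rewrite /= /in_range /=; case: all; lia.
Qed.

Lemma augm_nil l e u : augm (bas l e u [::]) = 0.
Proof. by rewrite augm.unlock; apply: word_extE. Qed.

Lemma sectE l e u s : sect (bas l e u s) = bas l e (0, 0)%N (u :: s).
Proof.
rewrite sect.unlock; apply: word_extE => out; apply: bas_out.
by apply: contra out => /= /andP[].
Qed.

Lemma empty_part_cons l e u v s : empty_part (bas l e u (v :: s)) = 0.
Proof. by rewrite empty_part.unlock; apply: word_extE. Qed.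

Lemma empty_part_nil l e u : empty_part (bas l e u [::]) = bas l e u [::].
Proof. by rewrite empty_part.unlock; apply: word_extE => out; apply: bas_out. Qed.

Lemma collapseA_cons l e u v s : collapseA (bas l e u (v :: s)) =
  if e.1 == 0%N then bas l e (0, u.2)%N ((u.1 + v.1, v.2)%N :: s) else 0.
Proof.
rewrite collapseA.unlock; apply: word_extE; case: eqP => // _ out; apply: bas_out.
by apply: contra out; rewrite /= /in_range /=; case: all; lia.
Qed.

Lemma collapseB_cons l e u v s : collapseB (bas l e u (v :: s)) =
  if e.2 == 0%N then bas l e (u.1, 0)%N ((v.1, u.2 + v.2)%N :: s) else 0.
Proof.
rewrite collapseB.unlock; apply: word_extE; case: eqP => // _ out; apply: bas_out.
by apply: contra out; rewrite /= /in_range /=; case: all; lia.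
Qed.

Lemma collapseA_nil l e u : collapseA (bas l e u [::]) = 0.
Proof. by rewrite collapseA.unlock; apply: word_extE. Qed.

Lemma contrA_cons l e u v s : (u.1 < a)%N -> contrA (bas l e u (v :: s)) =
  if odd e.1 then
    if u.1 == a.-1 then bas l (e.1.+1, e.2) (0, u.2)%N (v :: s) else 0
  else \sum_(c < u.1)
    bas l (e.1.+1, e.2) (c : nat, u.2) ((u.1.-1 - c + v.1, v.2)%N :: s).
Proof.
move=> ua; rewrite contrA.unlock; apply: word_extE => out.
case: ifP => _; [case: eqP => // _|apply: big1 => -[c cu] _]; apply: bas_out;
  by apply: contra out; rewrite /= /in_range /=; case: all; lia.
Qed.

Lemma contrB_cons l e u v s : (u.2 < b)%N -> contrB (bas l e u (v :: s)) =
  if odd e.2 then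
    if u.2 == b.-1 then bas l (e.1, e.2.+1) (u.1, 0)%N (v :: s) else 0
  else \sum_(c < u.2)
    bas l (e.1, e.2.+1) (u.1, c : nat) ((v.1, u.2.-1 - c + v.2)%N :: s).
Proof.
move=> ub; rewrite contrB.unlock; apply: word_extE => out.
case: ifP => _; [case: eqP => // _|apply: big1 => -[c cu] _]; apply: bas_out;
  by apply: contra out; rewrite /= /in_range /=; case: all; lia.
Qed.

Lemma contrA_nil l e u : contrA (bas l e u [::]) = 0.
Proof. by rewrite contrA.unlock; apply: word_extE. Qed.

Lemma contrB_nil l e u : contrB (bas l e u [::]) = 0.
Proof. by rewrite contrB.unlock; apply: word_extE. Qed.

Lemma cx_ext_cons (W : lmodType k) (f g : {linear V -> W}) :
  (forall l e u, in_range u -> f (bas l e u [::]) = g (bas l e u [::])) ->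
  (forall l e u v s, in_range u -> in_range v -> all in_range s ->
     f (bas l e u (v :: s)) = g (bas l e u (v :: s))) ->
  f =1 g.
Proof.
move=> h0 h1; apply: cx_ext => l e u [|v s] /=; first by rewrite andbT => /h0.
by case/and3P; apply: h1.
Qed.

Lemma emap_empty_part phi z : emap phi (empty_part z) = empty_part (emap phi z).
Proof.
suff h : emap phi \o empty_part =1 empty_part \o emap phi by exact: h.
apply: cx_ext_cons => [l e u _|l e u v s _ _ _] /=; rewrite !emapE linearZ /=.
  by rewrite !empty_part_nil emapE.
by rewrite !empty_part_cons linear0 scaler0.
Qed.

Lemma empty_part_koszul N g lo le z :
  empty_part (koszul N g lo le z) = koszul N g lo le (empty_part z).
Proof.
apply: (koszulC N (f := empty_part)) => [c w|c w||] /=; rewrite ?emap_empty_part //.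
  suff h : empty_part \o lmul (mscale c g) =1 lmul (mscale c g) \o empty_part by exact: h.
  apply: cx_ext_cons => [l e u _|l e u v s _ _ _] /=; rewrite lmulE.
    by rewrite !empty_part_nil lmulE.
  by rewrite !empty_part_cons linear0.
suff h : empty_part \o rmul (mscale c g) =1 rmul (mscale c g) \o empty_part by exact: h.
apply: cx_ext_cons => [l e u _|l e u v s _ _ _] /=.
  by rewrite empty_part_nil !rmul_nil linearZ /= empty_part_nil.
by rewrite rmul_cons !empty_part_cons linear0.
Qed.

Lemma contrA_empty_part z : contrA (empty_part z) = 0.
Proof.
suff h : contrA \o empty_part =1 (\0 : V -> V) by exact: h.
apply: cx_ext_cons => [l e u _|l e u v s _ _ _] /=.
  by rewrite empty_part_nil contrA_nil.
by rewrite empty_part_cons linear0.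
Qed.

Lemma contrB_empty_part z : contrB (empty_part z) = 0.
Proof.
suff h : contrB \o empty_part =1 (\0 : V -> V) by exact: h.
apply: cx_ext_cons => [l e u _|l e u v s _ _ _] /=.
  by rewrite empty_part_nil contrB_nil.
by rewrite empty_part_cons linear0.
Qed.

Lemma collapseA_empty_part z : collapseA (empty_part z) = 0.
Proof.
suff h : collapseA \o empty_part =1 (\0 : V -> V) by exact: h.
apply: cx_ext_cons => [l e u _|l e u v s _ _ _] /=.
  by rewrite empty_part_nil collapseA_nil.
by rewrite empty_part_cons linear0.
Qed.

Lemma contrA_lmul m z : m.1 = 0%N -> contrA (lmul m z) = lmul m (contrA z).
Proof.
move=> m0; suff h : contrA \o lmul m =1 lmul m \o contrA by exact: h.
apply: cx_ext_cons => [l e u _|l e u v s ru _ _] /=; rewrite lmulE.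
  by rewrite !contrA_nil linear0.
case/andP: ru => ua ub; rewrite !contrA_cons //= ?m0 //.
case: ifP => _; first by case: eqP; rewrite ?linear0 // lmulE /madd m0.
by rewrite linear_sum; apply: eq_bigr => c _; rewrite /= lmulE /madd m0.
Qed.

Lemma contrB_lmul m z : m.2 = 0%N -> contrB (lmul m z) = lmul m (contrB z).
Proof.
move=> m0; suff h : contrB \o lmul m =1 lmul m \o contrB by exact: h.
apply: cx_ext_cons => [l e u _|l e u v s ru _ _] /=; rewrite lmulE.
  by rewrite !contrB_nil linear0.
case/andP: ru => ua ub; rewrite !contrB_cons //= ?m0 //.
case: ifP => _; first by case: eqP; rewrite ?linear0 // lmulE /madd m0.
by rewrite linear_sum; apply: eq_bigr => c _; rewrite /= lmulE /madd m0.
Qed.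

Lemma contrA_rmul m z : m.1 = 0%N -> contrA (rmul m z) = rmul m (contrA z).
Proof.
move=> m0; suff h : contrA \o rmul m =1 rmul m \o contrA by exact: h.
apply: cx_ext_cons => [l e u _|l e u v s ru _ _] /=.
  by rewrite rmul_nil linearZ /= !contrA_nil scaler0 linear0.
case/andP: ru => ua ub; rewrite rmul_cons !contrA_cons //= ?m0 //.
case: ifP => _; first by case: eqP; rewrite ?linear0 // rmul_cons.
by rewrite linear_sum; apply: eq_bigr => c _; rewrite /= rmul_cons /madd m0.
Qed.

Lemma contrB_rmul m z : m.2 = 0%N -> contrB (rmul m z) = rmul m (contrB z).
Proof.
move=> m0; suff h : contrB \o rmul m =1 rmul m \o contrB by exact: h.
apply: cx_ext_cons => [l e u _|l e u v s ru _ _] /=.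
  by rewrite rmul_nil linearZ /= !contrB_nil scaler0 linear0.
case/andP: ru => ua ub; rewrite rmul_cons !contrB_cons //= ?m0 //.
case: ifP => _; first by case: eqP; rewrite ?linear0 // rmul_cons.
by rewrite linear_sum; apply: eq_bigr => c _; rewrite /= rmul_cons /madd m0.
Qed.

Lemma collapseA_lmul m z : m.1 = 0%N -> collapseA (lmul m z) = lmul m (collapseA z).
Proof.
move=> m0; suff h : collapseA \o lmul m =1 lmul m \o collapseA by exact: h.
apply: cx_ext_cons => [l e u _|l e u v s _ _ _] /=; rewrite lmulE.
  by rewrite !collapseA_nil linear0.
rewrite !collapseA_cons; case: ifP => _; last by rewrite linear0.
by rewrite lmulE /madd m0.
Qed.

Lemma collapseA_rmul m z : m.1 = 0%N -> collapseA (rmul m z) = rmul m (collapseA z).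
Proof.
move=> m0; suff h : collapseA \o rmul m =1 rmul m \o collapseA by exact: h.
apply: cx_ext_cons => [l e u _|l e u v s _ _ _] /=.
  by rewrite rmul_nil linearZ /= !collapseA_nil scaler0 linear0.
rewrite rmul_cons !collapseA_cons; case: ifP => _; last by rewrite linear0.
by rewrite rmul_cons /madd m0.
Qed.

Lemma contrA_emap phi psi z :
  (forall i j, (phi (i, j)).2.1 = i) ->
  (forall i j, psi (i.+1, j) = ((phi (i, j)).1, (i.+1, (phi (i, j)).2.2))) ->
  contrA (emap phi z) = emap psi (contrA z).
Proof.
move=> h1 h2; suff h : contrA \o emap phi =1 emap psi \o contrA by exact: h.
apply: cx_ext_cons => [l [i j] u _|l [i j] u v s ru _ _] /=;
  rewrite emapE linearZ /=.
  by rewrite !contrA_nil scaler0 linear0.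
case/andP: ru => ua ub; rewrite !contrA_cons //= h1.
case: ifP => _; first case: eqP => _; rewrite ?linear0 ?scaler0 //.
  by rewrite emapE h2.
by rewrite scaler_sumr linear_sum; apply: eq_bigr => c _; rewrite /= emapE h2.
Qed.

Lemma contrB_emap phi psi z :
  (forall i j, (phi (i, j)).2.2 = j) ->
  (forall i j, psi (i, j.+1) = ((phi (i, j)).1, ((phi (i, j)).2.1, j.+1))) ->
  contrB (emap phi z) = emap psi (contrB z).
Proof.
move=> h1 h2; suff h : contrB \o emap phi =1 emap psi \o contrB by exact: h.
apply: cx_ext_cons => [l [i j] u _|l [i j] u v s ru _ _] /=;
  rewrite emapE linearZ /=.
  by rewrite !contrB_nil scaler0 linear0.
case/andP: ru => ua ub; rewrite !contrB_cons //= h1.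
case: ifP => _; first case: eqP => _; rewrite ?linear0 ?scaler0 //.
  by rewrite emapE h2.
by rewrite scaler_sumr linear_sum; apply: eq_bigr => c _; rewrite /= emapE h2.
Qed.

Lemma collapseA_emap phi psi z :
  (forall i j, (phi (i, j)).2.1 = i) -> (forall j, psi (0%N, j) = phi (0%N, j)) ->
  collapseA (emap phi z) = emap psi (collapseA z).
Proof.
move=> h1 h2; suff h : collapseA \o emap phi =1 emap psi \o collapseA by exact: h.
apply: cx_ext_cons => [l [i j] u _|l [i j] u v s _ _ _] /=;
  rewrite emapE linearZ /=.
  by rewrite !collapseA_nil scaler0 linear0.
rewrite !collapseA_cons /= h1; case: eqP => [->|_]; last by rewrite scaler0 linear0.
by rewrite emapE h2.
Qed.

Lemma emap_collapseA0 phi z : (forall j, (phi (0%N, j)).1 = 0) ->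
  emap phi (collapseA z) = 0.
Proof.
move=> h1; suff h : emap phi \o collapseA =1 (\0 : V -> V) by exact: h.
apply: cx_ext_cons => [l [i j] u _|l [i j] u v s _ _ _] /=.
  by rewrite !collapseA_nil linear0.
rewrite !collapseA_cons /=; case: eqP => [->|_]; last by rewrite linear0.
by rewrite emapE h1 scale0r.
Qed.

Lemma emap_collapseA1 phi z : (forall j, phi (0%N, j) = (1, (0%N, j))) ->
  emap phi (collapseA z) = collapseA z.
Proof.
move=> h1; suff h : emap phi \o collapseA =1 collapseA by exact: h.
apply: cx_ext_cons => [l [i j] u _|l [i j] u v s _ _ _] /=.
  by rewrite !collapseA_nil linear0.
rewrite !collapseA_cons /=; case: eqP => [->|_]; last by rewrite linear0.
by rewrite emapE h1 scale1r.
Qed.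

End Resolution.

(** * The two directions of the periodic resolution *)

Section Directions.
Variable k : fieldType.
Implicit Type e : nat * nat.
(** The shifts that leave odd (lo) and positive even (le) degrees. In degree 0
both coefficients are 0, and the predecessor is a default value. *)
Definition loA e : k * (nat * nat) := ((odd e.1)%:R, (e.1.-1, e.2)).
Definition leA e : k * (nat * nat) := ((~~ odd e.1 && (0 < e.1)%N)%:R, (e.1.-1, e.2)).
Definition loB e : k * (nat * nat) := ((odd e.2)%:R, (e.1, e.2.-1)).
Definition leB e : k * (nat * nat) := ((~~ odd e.2 && (0 < e.2)%N)%:R, (e.1, e.2.-1)).
Definition signA e : k * (nat * nat) := ((-1) ^+ e.1, e).
Definition signB e : k * (nat * nat) := ((-1) ^+ e.2, e).
Definition negate (phi : nat * nat -> k * (nat * nat)) e : k * (nat * nat) :=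
  (- (phi e).1, (phi e).2).
End Directions.

Arguments loA {k}. Arguments leA {k}. Arguments loB {k}. Arguments leB {k}.
Arguments signA {k}. Arguments signB {k}.

Section Total.
Variables (k : fieldType) (a b : nat).
Hypotheses (a_gt0 : (0 < a)%N) (b_gt0 : (0 < b)%N).
Variables (zeta xi : nat * nat -> k).
Local Notation V := (cx k a b).
Local Notation bas := (bas k a b).
Local Notation in_range := (in_range a b).
Local Notation emap := (@emap k a b).
Local Notation koszul := (@koszul k a b zeta xi).
Local Notation augm := (@augm k a b).
Local Notation sect := (@sect k a b).
Local Notation empty_part := (@empty_part k a b).
Local Notation collapseA := (@collapseA k a b).
Local Notation collapseB := (@collapseB k a b).
Local Notation contrA := (@contrA k a b).
Local Notation contrB := (@contrB k a b).
Local Notation dA := (koszul a (1, 0)%N loA leA).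
Local Notation dB := (koszul b (0, 1)%N loB leB).
Local Notation tA := (emap signA).
Local Notation tB := (emap signB).

Lemma emap_negate phi z : emap (negate phi) z = - emap phi z.
Proof.
suff h : emap (negate phi) =1 \- (emap phi) by exact: h.
by apply: cx_ext => l e u s _ /=; rewrite !emapE scaleNr.
Qed.

Lemma koszul_emap N g lo le phi psi z :
  (forall z, emap lo (emap phi z) = emap psi (emap lo z)) ->
  (forall z, emap le (emap phi z) = emap psi (emap le z)) ->
  koszul N g lo le (emap phi z) = emap psi (koszul N g lo le z).
Proof.
by move=> h1 h2; rewrite !koszulE linearD /= emap_comm_diff emap_comm_norm h1 h2.
Qed.

Lemma dA_tA z : dA (tA z) = - tA (dA z).
Proof.
rewrite -emap_negate; apply: koszul_emap => w; rewrite !emap_emap;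
  by apply: eq_emap => -[[|i] j] //=; rewrite ?(mulr0, mul0r, exprS) //; ring.
Qed.

Lemma dB_tB z : dB (tB z) = - tB (dB z).
Proof.
rewrite -emap_negate; apply: koszul_emap => w; rewrite !emap_emap;
  by apply: eq_emap => -[i [|j]] //=; rewrite ?(mulr0, mul0r, exprS) //; ring.
Qed.

Lemma dB_tA z : dB (tA z) = tA (dB z).
Proof.
apply: koszul_emap => w; rewrite !emap_emap.
  by apply: eq_emap => -[i j] //=; rewrite mulrC.
by apply: eq_emap => -[i j] //=; rewrite mulrC.
Qed.

Lemma dA_tB z : dA (tB z) = tB (dA z).
Proof.
apply: koszul_emap => w; rewrite !emap_emap.
  by apply: eq_emap => -[i j] //=; rewrite mulrC.
by apply: eq_emap => -[i j] //=; rewrite mulrC.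
Qed.

Lemma emap_id phi z : (forall e, phi e = (1, e)) -> emap phi z = z.
Proof.
move=> h1; suff h : emap phi =1 (idfun : V -> V) by exact: h.
by apply: cx_ext => l e u s _ /=; rewrite emapE h1 scale1r.
Qed.

Lemma tAK z : tA (tA z) = z.
Proof. by rewrite emap_emap; apply: emap_id => e /=; rewrite -expr2 sqrr_sign. Qed.

Lemma tBK z : tB (tB z) = z.
Proof. by rewrite emap_emap; apply: emap_id => e /=; rewrite -expr2 sqrr_sign. Qed.

Lemma tA_tB z : tA (tB z) = tB (tA z).
Proof. by rewrite !emap_emap; apply: eq_emap => e //=; rewrite mulrC. Qed.

Lemma dA_dB z : dA (dB z) = dB (dA z).
Proof.
by apply: koszul_comm => w; rewrite !emap_emap; apply: eq_emap => -[i j] //=;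
   rewrite mulrC.
Qed.

Lemma emap0 phi z : (forall e, (phi e).1 = 0) -> emap phi z = 0.
Proof.
move=> h1; suff h : emap phi =1 (\0 : V -> V) by exact: h.
by apply: cx_ext => l e u s _ /=; rewrite emapE h1 scale0r.
Qed.

Lemma dA_dA z : dA (dA z) = 0.
Proof.
apply: koszul_koszul => [//||w|w].
- by rewrite /in_range /= muln1 ltnn.
- rewrite emap_emap; apply: emap0 => -[[|i] j] /=; rewrite ?mul0r //.
  by case: odd; rewrite ?mulr0 ?mul0r.
- rewrite emap_emap; apply: emap0 => -[[|i] j] /=; rewrite ?mul0r //.
  by case: odd; rewrite ?mulr0 ?mul0r.
Qed.

Lemma dB_dB z : dB (dB z) = 0.
Proof.
apply: koszul_koszul => [//||w|w].
- by rewrite /in_range /= muln1 ltnn andbF.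
- rewrite emap_emap; apply: emap0 => -[i [|j]] /=; rewrite ?mul0r //.
  by case: odd; rewrite ?mulr0 ?mul0r.
- rewrite emap_emap; apply: emap0 => -[i [|j]] /=; rewrite ?mul0r //.
  by case: odd; rewrite ?mulr0 ?mul0r.
Qed.

Lemma dA_cons l i j ux uy vx vy s :
  dA (bas l (i, j) (ux, uy) ((vx, vy) :: s)) =
  if i is i'.+1 then
    if odd i' then \sum_(c < a) bas l (i', j) (c + ux, uy)%N ((a.-1 - c + vx, vy)%N :: s)
    else bas l (i', j) (ux.+1, uy) ((vx, vy) :: s)
         - bas l (i', j) (ux, uy) ((vx.+1, vy) :: s)
  else 0.
Proof.
rewrite koszul_cons /=; case: i => [|i] /=; first by rewrite !scale0r addr0.
case: (odd i) => /=; rewrite scale0r scale1r ?add0r ?addr0 //.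
apply: eq_bigr => c _; congr (bas _ _ _ (_ :: _));
  by rewrite /madd /mscale /= muln0 muln1 add0n.
Qed.

Lemma dB_cons l i j ux uy vx vy s :
  dB (bas l (i, j) (ux, uy) ((vx, vy) :: s)) =
  if j is j'.+1 then
    if odd j' then \sum_(c < b) bas l (i, j') (ux, c + uy)%N ((vx, b.-1 - c + vy)%N :: s)
    else bas l (i, j') (ux, uy.+1) ((vx, vy) :: s)
         - bas l (i, j') (ux, uy) ((vx, vy.+1) :: s)
  else 0.
Proof.
rewrite koszul_cons /=; case: j => [|j] /=; first by rewrite !scale0r addr0.
case: (odd j) => /=; rewrite scale0r scale1r ?add0r ?addr0 //.
apply: eq_bigr => c _; congr (bas _ _ _ (_ :: _));
  by rewrite /madd /mscale /= muln0 muln1 add0n.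
Qed.

(** The words with empty s have no right coefficient to contract into, and are
left out of the contraction. *)
Lemma contractionA z :
  dA (contrA z) + contrA (dA z) = z - collapseA z - empty_part z.
Proof.
suff h : (dA \o contrA) \+ (contrA \o dA) =1 (idfun \- collapseA) \- empty_part by exact: h.
apply: cx_ext_cons => [l e u _|l [i j] [ux uy] [vx vy] s] /=.
  rewrite contrA_nil linear0 -{1}empty_part_nil -empty_part_koszul contrA_empty_part.
  by rewrite collapseA_nil empty_part_nil subr0 addr0 subrr.
case/andP=> /= ua ub _ _; rewrite empty_part_cons subr0 collapseA_cons /=.
pose beta i' u v := bas l (i', j) (u, uy) ((v, vy) :: s).
rewrite -/(beta i ux vx).
rewrite (slice_contraction (N := a) (beta := beta)) //.
- by case: eqP => [->|].
- move=> i' u v h; apply: bas_out; rewrite /= /in_range /=.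
  by case: all; lia.
- by move=> u v; rewrite /= dA_cons.
- by move=> i' u v; rewrite /= dA_cons.
- by move=> i' u v u_lt; rewrite /= contrA_cons.
Qed.

Lemma contractionB z :
  dB (contrB z) + contrB (dB z) = z - collapseB z - empty_part z.
Proof.
suff h : (dB \o contrB) \+ (contrB \o dB) =1 (idfun \- collapseB) \- empty_part by exact: h.
apply: cx_ext_cons => [l e u _|l [i j] [ux uy] [vx vy] s] /=.
  rewrite contrB_nil linear0 -{1}empty_part_nil -empty_part_koszul contrB_empty_part.
  by rewrite collapseB.unlock word_extE // empty_part_nil subr0 addr0 subrr.
case/andP=> /= ua ub _ _; rewrite empty_part_cons subr0 collapseB_cons /=.
pose beta j' u v := bas l (i, j') (ux, u) ((vx, v) :: s).
rewrite -/(beta j uy vy).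
rewrite (slice_contraction (N := b) (beta := beta)) //.
- by case: eqP => [->|].
- move=> i' u v h; apply: bas_out; rewrite /= /in_range /=.
  by case: all; lia.
- by move=> u v; rewrite /= dB_cons.
- by move=> i' u v; rewrite /= dB_cons.
- by move=> i' u v u_lt; rewrite /= contrB_cons.
Qed.

Lemma contrA_dB z : contrA (dB z) = dB (contrA z).
Proof.
apply: (koszulC b (f := contrA)) => [c w|c w||] /=.
- by apply: contrA_lmul; rewrite /= muln0.
- by apply: contrA_rmul; rewrite /= muln0.
- exact: contrA_emap.
- exact: contrA_emap.
Qed.

Lemma contrB_dA z : contrB (dA z) = dA (contrB z).
Proof.
apply: (koszulC a (f := contrB)) => [c w|c w||] /=.
- by apply: contrB_lmul; rewrite /= muln0.
- by apply: contrB_rmul; rewrite /= muln0.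
- exact: contrB_emap.
- exact: contrB_emap.
Qed.

Lemma contrA_tA z : contrA (tA z) = - tA (contrA z).
Proof.
rewrite -emap_negate; apply: contrA_emap => //= i j.
by rewrite /negate /= exprS mulN1r opprK.
Qed.

Lemma contrB_tA z : contrB (tA z) = tA (contrB z).
Proof. exact: contrB_emap. Qed.

Lemma collapseA_dB z : collapseA (dB z) = dB (collapseA z).
Proof.
apply: (koszulC b (f := collapseA)) => [c w|c w||] /=.
- by apply: collapseA_lmul; rewrite /= muln0.
- by apply: collapseA_rmul; rewrite /= muln0.
- exact: collapseA_emap.
- exact: collapseA_emap.
Qed.

Lemma dA_collapseA z : dA (collapseA z) = 0.
Proof. by rewrite koszulE !emap_collapseA0 // !linear0 addr0. Qed.

Lemma collapseA_dA z : collapseA (dA z) = 0.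
Proof.
suff h : collapseA \o dA =1 (\0 : V -> V) by exact: h.
apply: cx_ext_cons => [l e u _|l [i j] [ux uy] [vx vy] s _ _ _] /=.
  by rewrite -empty_part_nil -empty_part_koszul collapseA_empty_part.
rewrite dA_cons; case: i => [|i]; first by rewrite linear0.
case: ifP => [oi|_].
  rewrite linear_sum big1 // => c _ /=; rewrite collapseA_cons /=.
  by case: i oi.
rewrite linearB /= !collapseA_cons /=; case: i => [|i] /=; last by rewrite subrr.
by rewrite addSnnS subrr.
Qed.

Lemma collapseA_tA z : collapseA (tA z) = collapseA z.
Proof.
rewrite (collapseA_emap (psi := signA)) // emap_collapseA1 //.
Qed.

Lemma tA_collapseA z : tA (collapseA z) = collapseA z.
Proof. exact: emap_collapseA1. Qed.

(** Collapsing in both variables is the section after the augmentation of the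
tensor product K. *)
Lemma collapseAB z : collapseA (collapseB z) = sect (augm z).
Proof.
suff h : collapseA \o collapseB =1 sect \o augm by exact: h.
apply: cx_ext_cons => [l e u _|l [i j] u v s _ _ _] /=.
  by rewrite augm_nil collapseB.unlock word_extE // !linear0.
rewrite collapseB_cons augm_cons xpair_eqE /=.
case: (j == 0%N); rewrite ?andbF ?andbT ?linear0 // collapseA_cons /=.
by case: eqP => [->|_]; rewrite ?linear0 // sectE.
Qed.

End Total.

(** * The total differential, weights and lengths *)

Definition msum (s : seq (nat * nat)) := foldr madd (0, 0)%N s.
Definition tot (u : nat * nat) s := madd u (msum s).

(** A condition on a word through its label l, its degree e, the total exponent
of u and s (without the weight of e), and the length of s. *)
Definition grading := nat * nat -> nat * nat -> nat * nat -> nat -> bool.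

Definition wsupp (k : fieldType) (a b : nat) (R : grading) : {pred cx k a b} :=
  @supp k a b (fun l e u s => R l e (tot u s) (size s)).

(** The signs make the three differentials, which commute pairwise, anticommute. *)
HB.lock Definition dtot (k : fieldType) (a b : nat) (zeta xi : nat * nat -> k)
    (z : cx k a b) : cx k a b :=
  koszul zeta xi a (1, 0)%N loA leA z
  + emap signA (koszul zeta xi b (0, 1)%N loB leB z)
  + emap signA (emap signB (bar zeta xi z)).

(** The usual homotopy on a tensor product of two contracted complexes. *)
HB.lock Definition rowh (k : fieldType) (a b : nat) (z : cx k a b) : cx k a b :=
  contrA z + collapseA (contrB z).

HB.lock Definition colh (k : fieldType) (a b : nat) (z : cx k a b) : cx k a b :=
  emap signA (emap signB (push (0, 0)%N z)).

Section Supports.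
Variables (k : fieldType) (a b : nat).
Variables (zeta xi : nat * nat -> k).
Implicit Types R : grading.
Local Notation V := (cx k a b).
Local Notation bas := (bas k a b).
Local Notation wsupp := (@wsupp k a b).

Lemma wsupp_bas R l e u s : R l e (tot u s) (size s) -> bas l e u s \in wsupp R.
Proof. exact: (@supp_bas k a b (fun l e u s => R l e (tot u s) (size s))). Qed.

Lemma wsupp_ind R (W : lmodType k) (S : submodClosed W) (f : {linear V -> W}) z :
  (forall l e u s, R l e (tot u s) (size s) -> f (bas l e u s) \in S) ->
  z \in wsupp R -> f z \in S.
Proof. by move=> h; apply: supp_ind => l e u s _; apply: h. Qed.

Lemma wsuppS R R' z : (forall l e t n, R l e t n -> R' l e t n) ->
  z \in wsupp R -> z \in wsupp R'.
Proof. by move=> h; apply: supp_sub => l e u s; apply: h. Qed.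

Lemma wsupp_lmul R R' m z :
  (forall l e t n, R l e t n -> R' l e (madd m t) n) ->
  z \in wsupp R -> lmul m z \in wsupp R'.
Proof.
move=> h; apply: (wsupp_ind (f := lmul m)) => l e u s Rs /=.
by rewrite lmulE; apply: wsupp_bas; rewrite /tot -maddA; apply: h.
Qed.

Lemma wsupp_rmul R R' m z :
  (forall l e t n, R l e t n -> R' l e (madd m t) n) ->
  z \in wsupp R -> rmul zeta xi m z \in wsupp R'.
Proof.
move=> h; apply: (wsupp_ind (f := rmul zeta xi m)) => l e u [|v s] Rs /=.
  by rewrite rmul_nil rpredZ // wsupp_bas // /tot -maddA; apply: h.
rewrite rmul_cons; apply: wsupp_bas.
have := h _ _ _ _ Rs; congr (is_true (R' _ _ _ _)); rewrite /tot /= maddCA.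
by rewrite -maddA.
Qed.

Lemma wsupp_push R R' m z :
  (forall l e t n, R l e t n -> R' l e (madd m t) n.+1) ->
  z \in wsupp R -> push m z \in wsupp R'.
Proof.
move=> h; apply: (wsupp_ind (f := push m)) => l e u s Rs /=.
by rewrite pushE; apply: wsupp_bas; rewrite /tot /= maddCA; apply: h.
Qed.

Lemma wsupp_emap R R' phi z :
  (forall l e t n, (phi e).1 != 0 -> R l e t n -> R' l (phi e).2 t n) ->
  z \in wsupp R -> emap phi z \in wsupp R'.
Proof.
move=> h; apply: (wsupp_ind (f := emap phi)) => l e u s Rs /=.
rewrite emapE; have [->|ne0] := eqVneq (phi e).1 0; first by rewrite scale0r rpred0.
by rewrite rpredZ // wsupp_bas // h.
Qed.

Lemma wsupp_bar R R' z :
  (forall l e t n, R l e t n.+1 -> R' l e t n) ->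
  z \in wsupp R -> bar zeta xi z \in wsupp R'.
Proof.
move=> h; apply: (wsupp_ind (f := bar zeta xi)) => l e u s Rs /=.
pose Q l e t n : grading := fun l' e' t' n' =>
  [&& l' == l, e' == e, t' == t & n'.+1 == n].
suff: bar zeta xi (bas l e u s) \in wsupp (Q l e (tot u s) (size s)).
  apply: wsuppS => l' e' t' n' /and4P[/eqP-> /eqP-> /eqP-> /eqP E].
  by apply: h; rewrite E.
elim: s {Rs} => [|v s IHs]; first by rewrite bar_nil rpred0.
rewrite -pushE bar_push rpredB //.
  apply: (@wsupp_rmul (fun l' e' t' n' =>
    [&& l' == l, e' == e, t' == tot u s & n' == size s])).
    move=> l' e' t' n' /and4P[/eqP-> /eqP-> /eqP-> /eqP->].
    by rewrite /Q !eqxx /= andbT /tot /= maddCA.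
  by apply: wsupp_bas; rewrite !eqxx.
apply: wsupp_push IHs => l' e' t' n' /and4P[/eqP-> /eqP-> /eqP-> /eqP E].
by rewrite /Q !eqxx /= E eqxx andbT /tot /= maddCA.
Qed.

Lemma wsupp_koszul R R' N g lo le z : (0 < N)%N ->
  (forall l e t n, (lo e).1 != 0 -> R l e t n -> R' l (lo e).2 (madd g t) n) ->
  (forall l e t n, (le e).1 != 0 -> R l e t n ->
     R' l (le e).2 (madd (mscale N.-1 g) t) n) ->
  z \in wsupp R -> koszul zeta xi N g lo le z \in wsupp R'.
Proof.
move=> N0 hlo hle Rz; rewrite koszulE rpredD // ?comm_diffE ?comm_normE.
  pose Q l e t n := R' l e (madd g t) n.
  have hz : emap lo z \in wsupp Q by apply: wsupp_emap Rz => l e t n; apply: hlo.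
  by rewrite rpredB //; [apply: wsupp_lmul hz|apply: wsupp_rmul hz].
pose Q l e t n := R' l e (madd (mscale N.-1 g) t) n.
have hz : emap le z \in wsupp Q by apply: wsupp_emap Rz => l e t n; apply: hle.
apply: rpred_sum => -[c cN] _ /=.
apply: (@wsupp_lmul (fun l e t n => R' l e (madd (mscale c g) t) n)) => //.
apply: wsupp_rmul hz => l e t n; rewrite /Q maddA; congr (R' _ _ (madd _ _) _).
by rewrite /madd /mscale /= -!mulnDl addnC subnK //; lia.
Qed.

Lemma wsupp_empty_part R R' z : (forall l e t, R l e t 0%N -> R' l e t 0%N) ->
  z \in wsupp R -> empty_part z \in wsupp R'.
Proof.
move=> h; apply: (wsupp_ind (f := @empty_part k a b)) => l e u [|v s] Rs /=.
  by rewrite empty_part_nil; apply: wsupp_bas; apply: h.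
by rewrite empty_part_cons rpred0.
Qed.

Lemma wsupp_sect R R' z : (forall l e t n, R l e t n -> R' l e t n.+1) ->
  z \in wsupp R -> sect z \in wsupp R'.
Proof.
move=> h; apply: (wsupp_ind (f := @sect k a b)) => l e u s Rs /=.
by rewrite sectE; apply: wsupp_bas; rewrite /tot madd0; apply: h.
Qed.

Lemma wsupp_augm R R' z :
  (forall l t n, R l (0, 0)%N t n.+1 -> R' l (0, 0)%N t n) ->
  z \in wsupp R -> augm z \in wsupp R'.
Proof.
move=> h; apply: (wsupp_ind (f := @augm k a b)) => l e u [|v s] Rs /=.
  by rewrite augm_nil rpred0.
rewrite augm_cons; case: eqP Rs => [->|] Rs; last by rewrite rpred0.
by apply: wsupp_bas; rewrite /tot -maddA; apply: h.
Qed.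

Lemma wsupp_collapseA R z : z \in wsupp R -> collapseA z \in wsupp R.
Proof.
apply: (wsupp_ind (f := @collapseA k a b)) => l e u [|v s] Rs /=.
  by rewrite collapseA_nil rpred0.
rewrite collapseA_cons; case: eqP => _; last by rewrite rpred0.
apply: wsupp_bas; move: Rs; congr (is_true (R _ _ _ _)); rewrite /tot /madd /=.
by congr pair; lia.
Qed.

Lemma wsupp_contrA R R' z :
  (forall l i j t n, odd i -> (a.-1 <= t.1)%N -> R l (i, j) t n ->
     R' l (i.+1, j) (t.1 - a.-1, t.2)%N n) ->
  (forall l i j t n, ~~ odd i -> (0 < t.1)%N -> R l (i, j) t n ->
     R' l (i.+1, j) (t.1.-1, t.2)%N n) ->
  z \in wsupp R -> contrA z \in wsupp R'.
Proof.
move=> h1 h2; apply: (supp_ind (f := @contrA k a b)) => l [i j] [ux uy] [|v s] ru Rs /=.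
  by rewrite contrA_nil rpred0.
rewrite contrA_cons; last by case/andP: ru => /andP[].
case: ifP => [oi|/negbT ei].
  case: eqP => [/= uE|_]; last by rewrite rpred0.
  apply: wsupp_bas; have := h1 _ _ _ _ _ oi _ Rs; rewrite /= uE leq_addr.
  by move/(_ isT); congr (is_true (R' _ _ _ _)); rewrite /tot /madd /= addKn.
apply: rpred_sum => -[c /= cu] _; apply: wsupp_bas.
have := h2 _ _ _ _ _ ei _ Rs; rewrite /= addn_gt0 (leq_ltn_trans _ cu) //.
by move/(_ isT); congr (is_true (R' _ _ _ _)); rewrite /tot /madd /=; congr pair; lia.
Qed.

Lemma wsupp_contrB R R' z :
  (forall l i j t n, odd j -> (b.-1 <= t.2)%N -> R l (i, j) t n ->
     R' l (i, j.+1) (t.1, t.2 - b.-1)%N n) ->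
  (forall l i j t n, ~~ odd j -> (0 < t.2)%N -> R l (i, j) t n ->
     R' l (i, j.+1) (t.1, t.2.-1)%N n) ->
  z \in wsupp R -> contrB z \in wsupp R'.
Proof.
move=> h1 h2; apply: (supp_ind (f := @contrB k a b)) => l [i j] [ux uy] [|v s] ru Rs /=.
  by rewrite contrB_nil rpred0.
rewrite contrB_cons; last by case/andP: ru => /andP[].
case: ifP => [oi|/negbT ei].
  case: eqP => [/= uE|_]; last by rewrite rpred0.
  apply: wsupp_bas; have := h1 _ _ _ _ _ oi _ Rs; rewrite /= uE leq_addr.
  by move/(_ isT); congr (is_true (R' _ _ _ _)); rewrite /tot /madd /= addKn.
apply: rpred_sum => -[c /= cu] _; apply: wsupp_bas.
have := h2 _ _ _ _ _ ei _ Rs; rewrite /= addn_gt0 (leq_ltn_trans _ cu) //.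
by move/(_ isT); congr (is_true (R' _ _ _ _)); rewrite /tot /madd /=; congr pair; lia.
Qed.

End Supports.

(** * Acyclicity of the rows and columns *)

(** The weight of the generator e_i of the periodic resolution of
k[g]/(g^N): the differential leaving odd degrees carries one factor g, and the
one leaving positive even degrees N - 1 of them. *)
Definition exponent (N i : nat) : nat := (N * i./2 + odd i)%N.

Lemma exponentS N i : (0 < N)%N ->
  exponent N i.+1 = (exponent N i + (if odd i then N.-1 else 1))%N.
Proof.
move=> N0; have E : i.+1./2 = (odd i + i./2)%N by lia.
by rewrite /exponent E /= mulnDr; case: (odd i) => /=; lia.
Qed.

(** Words of total degree n whose label is their weight, that of the generator
included. *)
Definition graded (a b n : nat) : grading := fun l e t m =>
  (l == madd (exponent a e.1, exponent b e.2) t) && (e.1 + e.2 + m == n)%N.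
Definition size_le (m : nat) : grading := fun _ _ _ n => (n <= m)%N.
Definition low (p : nat) : grading := fun _ e _ _ => (e.1 + e.2 < p)%N.
Definition base : grading := fun _ e _ _ => e == (0, 0)%N.

Section Homotopies.
Variables (k : fieldType) (a b : nat).
Hypotheses (a_gt0 : (0 < a)%N) (b_gt0 : (0 < b)%N).
Variables (zeta xi : nat * nat -> k).
Local Notation V := (cx k a b).
Local Notation wsupp := (@wsupp k a b).
Local Notation emap := (@emap k a b).
Local Notation push := (@push k a b).
Local Notation bar := (@bar k a b zeta xi).
Local Notation augm := (@augm k a b).
Local Notation sect := (@sect k a b).
Local Notation empty_part := (@empty_part k a b).
Local Notation collapseA := (@collapseA k a b).
Local Notation contrA := (@contrA k a b).
Local Notation contrB := (@contrB k a b).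
Local Notation dA := (koszul zeta xi a (1, 0)%N loA leA).
Local Notation dB := (koszul zeta xi b (0, 1)%N loB leB).
Local Notation tA := (emap signA).
Local Notation tB := (emap signB).
Local Notation dtot := (@dtot k a b zeta xi).
Local Notation rowh := (@rowh k a b).
Local Notation colh := (@colh k a b).
Local Notation gr n := (wsupp (graded a b n)).
Local Notation szle m := (wsupp (size_le m)).
Local Notation lowp p := (wsupp (low p)).
Local Notation ez := (wsupp base).

Lemma dtotE z : dtot z = dA z + tA (dB z) + tA (tB (bar z)).
Proof. by rewrite dtot.unlock. Qed.
Lemma rowhE z : rowh z = contrA z + collapseA (contrB z).
Proof. by rewrite rowh.unlock. Qed.
Lemma colhE z : colh z = tA (tB (push (0, 0)%N z)).
Proof. by rewrite colh.unlock. Qed.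

Fact dtot_linear : linear dtot.
Proof.
move=> c z w; rewrite !dtotE !linearP /=.
by rewrite [X in X + _ = _]addrACA -scalerDr addrACA -scalerDr.
Qed.
Fact rowh_linear : linear rowh.
Proof. by move=> c z w; rewrite !rowhE !linearP /= addrACA -scalerDr. Qed.
Fact colh_linear : linear colh.
Proof. by move=> c z w; rewrite !colhE !linearP. Qed.
HB.instance Definition _ := GRing.isLinear.Build k V V *:%R dtot dtot_linear.
HB.instance Definition _ := GRing.isLinear.Build k V V *:%R rowh rowh_linear.
HB.instance Definition _ := GRing.isLinear.Build k V V *:%R colh colh_linear.

Lemma dtot_dtot z : dtot (dtot z) = 0.
Proof.
rewrite [dtot z]dtotE !linearD /= !dtotE.
rewrite dA_dA // !dA_tA !dA_tB !dB_tA !dB_tB dB_dB // -dA_dB !linear0 !tAK.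
rewrite -!emap_bar bar_bar -!bar_koszul !linear0 !tA_tB tAK !add0r !addr0.
by rewrite [X in X + _ = _]addrACA subrr add0r -opprD subrr.
Qed.

(** The bar differential does not commute with the contraction of K, but it
shortens words: the last term is an error of smaller length. *)
Lemma rowh_homotopy z :
  dtot (rowh z) + rowh (dtot z) =
  z - sect (augm z) - empty_part z + (tA (tB (bar (rowh z))) + rowh (tA (tB (bar z)))).
Proof.
rewrite [dtot (rowh z)]dtotE [dtot z]dtotE [rowh (_ + tA (tB _))]linearD /=.
rewrite addrACA; congr (_ + _).
rewrite !rowhE !linearD /= dA_collapseA addr0.
rewrite contrA_tA contrA_dB // contrB_dA // collapseA_dA // contrB_tA collapseA_tA.
rewrite -collapseA_dB tA_collapseA add0r -[contrA _ - _ + _]addrA addrACA contractionA //.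
rewrite [X in _ + X]addrACA subrr add0r -linearD /= contractionB //.
rewrite !linearB /= collapseA_empty_part subr0 collapseAB.
by rewrite addrAC addrA subrK.
Qed.

(** Symmetrically, the error term lowers the degree in K. *)
Lemma colh_homotopy z :
  dtot (colh z) + colh (dtot z) =
  z + (dA (colh z) + tA (dB (colh z)) + colh (dA z + tA (dB z))).
Proof.
rewrite [dtot (colh z)]dtotE [dtot z]dtotE [colh (_ + tA (tB _))]linearD /=.
rewrite addrACA [RHS]addrC; congr (_ + _).
rewrite !colhE -!emap_bar -!emap_push bar_push rmul0 !tA_tB !tAK !tBK.
by rewrite subrK.
Qed.

Lemma augm_empty_part z : augm (empty_part z) = 0.
Proof.
suff h : augm \o empty_part =1 (\0 : V -> V) by exact: h.
apply: cx_ext_cons => [l e u _|l e u v s _ _ _] /=.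
  by rewrite empty_part_nil augm_nil.
by rewrite empty_part_cons linear0.
Qed.

Lemma augm_emap phi z : (forall e, (phi e).2 = e) -> phi (0, 0)%N = (1, (0, 0)%N) ->
  augm (emap phi z) = augm z.
Proof.
move=> h1 h2; suff h : augm \o emap phi =1 augm by exact: h.
apply: cx_ext_cons => [l e u _|l e u v s _ _ _] /=; rewrite emapE linearZ /=.
  by rewrite !augm_nil scaler0.
by rewrite !augm_cons h1; case: eqP => [->|_]; rewrite ?h2 ?scale1r ?scaler0.
Qed.

Lemma augm_dA z : augm (dA z) = 0.
Proof.
suff h : augm \o dA =1 (\0 : V -> V) by exact: h.
apply: cx_ext_cons => [l e u _|l [i j] [ux uy] [vx vy] s _ _ _] /=.
  by rewrite -empty_part_nil -empty_part_koszul augm_empty_part.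
rewrite dA_cons; case: i => [|i]; first by rewrite linear0.
case: ifP => [oi|_].
  rewrite linear_sum big1 // => c _ /=; rewrite augm_cons xpair_eqE /=.
  by case: i oi.
by rewrite linearB /= !augm_cons /madd /= addSnnS subrr.
Qed.

Lemma augm_dB z : augm (dB z) = 0.
Proof.
suff h : augm \o dB =1 (\0 : V -> V) by exact: h.
apply: cx_ext_cons => [l e u _|l [i j] [ux uy] [vx vy] s _ _ _] /=.
  by rewrite -empty_part_nil -empty_part_koszul augm_empty_part.
rewrite dB_cons; case: j => [|j]; first by rewrite linear0.
case: ifP => [oi|_].
  rewrite linear_sum big1 // => c _ /=; rewrite augm_cons xpair_eqE /=.
  by case: j oi => [|j] //= _; rewrite andbF.
by rewrite linearB /= !augm_cons /madd /= addSnnS subrr.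
Qed.

Definition at_base (e : nat * nat) : k * (nat * nat) := ((e == (0, 0)%N)%:R, e).

Lemma augm_at_base z : augm (emap at_base z) = augm z.
Proof. exact: augm_emap. Qed.

Lemma augm_push m z : augm (push m z) = lmul m (emap at_base z).
Proof.
suff h : augm \o push m =1 lmul m \o emap at_base by exact: h.
apply: cx_ext => l e u s _ /=; rewrite pushE augm_cons emapE /=.
by case: eqP => _; rewrite linearZ /= ?scale1r ?scale0r // lmulE maddC.
Qed.

Lemma augm_rmul m z : augm (rmul zeta xi m z) = augm (lmul m z).
Proof.
suff h : augm \o rmul zeta xi m =1 augm \o lmul m by exact: h.
apply: cx_ext_cons => [l e u _|l e u v s _ _ _] /=.
  by rewrite rmul_nil lmulE linearZ /= !augm_nil scaler0.
by rewrite rmul_cons lmulE !augm_cons maddCA maddA.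
Qed.

Lemma augm_bar z : augm (bar z) = augm (augm z) - bar (augm z).
Proof.
suff h : augm \o bar =1 (augm \o augm) \- (bar \o augm) by exact: h.
apply: cx_ext => l e u [|v s] _ /=.
  by rewrite bar_nil augm_nil !linear0 addr0.
rewrite -pushE bar_push linearB /= augm_rmul !augm_push bar_lmul emap_bar.
by rewrite -emap_lmul augm_at_base.
Qed.

(** [augm] - [bar] is the Hochschild differential on words of degree (0, 0):
the augmentation supplies the face that multiplies the first two letters, and
the recursion of [bar] starts with the next one. So this says that the
augmentation is a chain map. *)
Lemma augm_dtot z : augm (dtot z) = augm (augm z) - bar (augm z).
Proof.
rewrite dtotE !linearD /= !(augm_emap (phi := signA)) // (augm_emap (phi := signB)) //.
by rewrite augm_dA augm_dB !add0r augm_bar.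
Qed.

Lemma augm_rowh z : augm (rowh z) = 0.
Proof.
suff h : augm \o rowh =1 (\0 : V -> V) by exact: h.
apply: cx_ext_cons => [l e u _|l [i j] u v s ru _ _] /=; rewrite rowhE.
  by rewrite contrA_nil contrB_nil linear0 addr0 linear0.
case/andP: ru => ua ub; rewrite contrA_cons // contrB_cons // linearD /=.
rewrite (_ : augm _ = 0); last first.
  case: ifP => _; first case: eqP => _; rewrite ?linear0 ?augm_cons //.
  by rewrite linear_sum big1 // => c _ /=; rewrite augm_cons.
rewrite add0r; case: ifP => _; first case: eqP => _; rewrite ?linear0 //.
  by rewrite collapseA_cons /=; case: eqP => _; rewrite ?linear0 // augm_cons xpair_eqE andbF.
rewrite !linear_sum big1 // => c _ /=; rewrite collapseA_cons /=.
by case: eqP => _; rewrite ?linear0 // augm_cons xpair_eqE andbF.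
Qed.

Lemma augm_sect z : z \in ez -> augm (sect z) = z.
Proof.
apply: (cx_ext_supp (f := augm \o sect) (g := idfun)) => l e u s _ /= /eqP->.
by rewrite sectE augm_cons eqxx madd0.
Qed.

Lemma szle0_empty_part z : z \in szle 0 -> empty_part z = z.
Proof.
apply: (cx_ext_supp (f := empty_part) (g := idfun)) => l e u [|v s] //= _ _.
by rewrite empty_part_nil.
Qed.

Lemma empty_part_szle0 z : empty_part z \in szle 0.
Proof.
apply: (@wsupp_empty_part _ _ _ (fun _ _ _ _ => true)) => //.
by apply/supportedP => -[[[l e] u] s].
Qed.

Lemma rowh_szle0 z : z \in szle 0 -> rowh z = 0.
Proof.
by move/szle0_empty_part<-; rewrite rowhE contrA_empty_part contrB_empty_part linear0 addr0.
Qed.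

Lemma augm_szle0 z : z \in szle 0 -> augm z = 0.
Proof. by move/szle0_empty_part<-; rewrite augm_empty_part. Qed.

Lemma lowp0 z : z \in lowp 0 -> z = 0.
Proof. exact: (cx_ext_supp (f := idfun) (g := \0)). Qed.

Lemma rowh_szle m z : z \in szle m -> rowh z \in szle m.
Proof.
move=> zm; rewrite rowhE rpredD //; first by apply: wsupp_contrA zm.
by apply: wsupp_collapseA; apply: wsupp_contrB zm.
Qed.

Lemma bar_szle m z : z \in szle m.+1 -> bar z \in szle m.
Proof. exact: wsupp_bar. Qed.

Lemma emap_szle phi m z : z \in szle m -> emap phi z \in szle m.
Proof. exact: wsupp_emap. Qed.

Lemma dA_gr n z : z \in gr n.+1 -> dA z \in gr n.
Proof.
apply: wsupp_koszul => // l [i j] t m; rewrite /graded /=;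
  case: i => [|i] /=; rewrite ?eqxx // exponentS //; case: (odd i) => //=;
  rewrite ?eqxx //= => _ /andP[/eqP-> /eqP ijm]; apply/andP; split;
  by rewrite /madd /mscale /= ?xpair_eqE; lia.
Qed.

Lemma dB_gr n z : z \in gr n.+1 -> dB z \in gr n.
Proof.
apply: wsupp_koszul => // l [i j] t m; rewrite /graded /=;
  case: j => [|j] /=; rewrite ?eqxx // exponentS //; case: (odd j) => //=;
  rewrite ?eqxx //= => _ /andP[/eqP-> /eqP ijm]; apply/andP; split;
  by rewrite /madd /mscale /= ?xpair_eqE; lia.
Qed.

Lemma bar_gr n z : z \in gr n.+1 -> bar z \in gr n.
Proof.
by apply: wsupp_bar => l e t m; rewrite /graded addnS eqSS.
Qed.

Lemma sign_gr phi n z : (forall e, (phi e).2 = e) -> z \in gr n -> emap phi z \in gr n.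
Proof. by move=> h; apply: wsupp_emap => l e t m; rewrite h. Qed.

Lemma dtot_gr n z : z \in gr n.+1 -> dtot z \in gr n.
Proof.
move=> zn; rewrite dtotE !rpredD //; first exact: dA_gr.
  by apply: sign_gr => //; apply: dB_gr.
by do 2!apply: sign_gr => //; apply: bar_gr.
Qed.

Lemma rowh_gr n z : z \in gr n -> rowh z \in gr n.+1.
Proof.
move=> zn; rewrite rowhE rpredD //; last apply: wsupp_collapseA.
  apply: wsupp_contrA zn => // l i j t m oi ti; rewrite /graded /= exponentS //.
    by rewrite oi => /andP[/eqP-> /eqP ijm]; rewrite /madd /= ?xpair_eqE; lia.
  by rewrite (negPf oi) => /andP[/eqP-> /eqP ijm]; rewrite /madd /= ?xpair_eqE; lia.
apply: wsupp_contrB zn => // l i j t m oi ti; rewrite /graded /= exponentS //.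
  by rewrite oi => /andP[/eqP-> /eqP ijm]; rewrite /madd /= ?xpair_eqE; lia.
by rewrite (negPf oi) => /andP[/eqP-> /eqP ijm]; rewrite /madd /= ?xpair_eqE; lia.
Qed.

Lemma colh_gr n z : z \in gr n -> colh z \in gr n.+1.
Proof.
move=> zn; rewrite colhE; do 2!apply: sign_gr => //.
by apply: wsupp_push zn => l e t m; rewrite madd0 /graded addnS eqSS.
Qed.

Lemma augm_gr n z : z \in gr n.+1 -> augm z \in gr n.
Proof. by apply: wsupp_augm => l t m; rewrite /graded addnS eqSS. Qed.

Lemma augm_base z : augm z \in ez.
Proof.
apply: (@wsupp_augm _ _ _ (fun _ _ _ _ => true)) => //.
by apply/supportedP => -[[[l e] u] s].
Qed.

Lemma sect_gr n z : z \in gr n -> sect z \in gr n.+1.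
Proof. by apply: wsupp_sect => l e t m; rewrite /graded addnS eqSS. Qed.

Lemma gr_szle n z : z \in gr n -> z \in szle n.
Proof. by apply: wsuppS => l e t m /andP[_ /eqP<-]; apply: leq_addl. Qed.

Lemma gr_lowp n z : z \in gr n -> z \in lowp n.+1.
Proof. by apply: wsuppS => l e t m /andP[_ /eqP<-]; rewrite /low ltnS leq_addr. Qed.

Lemma dh_lowp p z : z \in lowp p.+1 -> dA z + tA (dB z) \in lowp p.
Proof.
move=> zp; rewrite rpredD //.
  by apply: wsupp_koszul zp => // l [[|i] j] t m; rewrite /low /= ?eqxx.
apply: (@wsupp_emap _ _ _ (low p)) => //.
by apply: wsupp_koszul zp => // l [i [|j]] t m; rewrite /low /= ?eqxx //; lia.
Qed.

Lemma colh_lowp p z : z \in lowp p -> colh z \in lowp p.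
Proof.
move=> zp; rewrite colhE; apply: (@wsupp_emap _ _ _ (low p)) => //.
apply: (@wsupp_emap _ _ _ (low p)) => //.
by apply: wsupp_push zp.
Qed.

(** By induction on the length, the rows of nonempty words resolve the
Hochschild complex: subtracting dtot (rowh z) leaves empty words and shorter
words. *)
Lemma row_exact m n z : z \in szle m -> z \in gr n -> augm z = 0 ->
  dtot z \in szle 0 ->
  exists2 w, w \in gr n.+1 & augm w = 0 /\ z - dtot w \in szle 0.
Proof.
elim: m z => [|m IHm] z zm zn z0 dz0.
  by exists 0; [exact: rpred0|rewrite !linear0 addr0].
pose z' := z - dtot (rowh z).
have z'E : z' = empty_part z - (tA (tB (bar (rowh z))) + rowh (tA (tB (bar z)))).
  have := rowh_homotopy z; rewrite z0 linear0 subr0 [rowh (dtot z)]rowh_szle0 // addr0 /z' => ->.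
  by rewrite opprD opprB addrA addrCA subrr addr0.
have [||||w' w'n [w'0 dw']] := IHm z'.
- rewrite z'E rpredB //.
    by apply: wsuppS (empty_part_szle0 z) => l e t p; rewrite /size_le leqn0 => /eqP->.
  by rewrite rpredD //; [|apply: rowh_szle]; do 2!apply: emap_szle;
     apply: bar_szle => //; apply: rowh_szle.
- by rewrite rpredB // dtot_gr // rowh_gr.
- by rewrite linearB /= z0 augm_dtot augm_rowh !linear0 addr0 subr0.
- by rewrite linearB /= dtot_dtot subr0.
exists (rowh z + w'); first by rewrite rpredD // rowh_gr.
by rewrite !linearD /= augm_rowh w'0 addr0 addrA.
Qed.

(** The section is not a chain map, but as x is a cycle, dtot (sect x) is a
cycle that augments to 0; [row_exact] writes it as dtot w up to empty words,
and sect x - w is the lift. *)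
Lemma augm_lift n x : x \in ez -> x \in gr n -> augm x - bar x = 0 ->
  exists2 z, z \in gr n.+1 & augm z = x /\ dtot z \in szle 0.
Proof.
move=> xe xn bx0; pose z1 := dtot (sect x).
have z1n : z1 \in gr n by rewrite dtot_gr // sect_gr.
have [||w wn [w0 dw]] := row_exact (gr_szle z1n) z1n.
- by rewrite augm_dtot augm_sect.
- by rewrite dtot_dtot rpred0.
exists (sect x - w); first by rewrite rpredB // sect_gr.
by rewrite !linearB /= w0 subr0 augm_sect.
Qed.

(** By induction on the degree in K, the complex augmented by the column of
empty words is acyclic, as is the augmented bar resolution. *)
Lemma col_exact p n z : z \in lowp p -> z \in gr n -> dtot z = 0 ->
  exists2 w, w \in gr n.+1 & z = dtot w.
Proof.
elim: p z => [|p IHp] z zp zn dz0.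
  by exists 0; [exact: rpred0|rewrite linear0 (lowp0 zp)].
pose z' := z - dtot (colh z).
have z'E : z' = - (dA (colh z) + tA (dB (colh z)) + colh (dA z + tA (dB z))).
  have := colh_homotopy z; rewrite dz0 linear0 addr0 /z' => ->.
  by rewrite opprD addrA subrr add0r.
have [|||w' w'n z'w'] := IHp z'.
- by rewrite z'E rpredN rpredD // ?dh_lowp ?colh_lowp // dh_lowp.
- by rewrite rpredB // dtot_gr // colh_gr.
- by rewrite linearB /= dz0 dtot_dtot subr0.
exists (colh z + w'); first by rewrite rpredD // colh_gr.
by rewrite linearD /= -z'w' addrC subrK.
Qed.

Lemma dtot_exact n z : z \in gr n -> dtot z = 0 ->
  exists2 w, w \in gr n.+1 & z = dtot w.
Proof. by move=> zn; apply: col_exact (gr_lowp zn) zn. Qed.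

End Homotopies.

(** * The small complex *)

(** The power of g in the differential leaving degree i. *)
Definition step (N i : nat) : nat := if odd i then 1%N else N.-1.
Arguments step : simpl never.

Definition small (a b n : nat) : grading := fun l e t m =>
  graded a b n l e t m && (m == 0)%N.

Section Small.
Variables (k : fieldType) (a b : nat).
Hypotheses (a_gt1 : (1 < a)%N) (b_gt1 : (1 < b)%N).
Variables (zeta xi : nat * nat -> k).
Hypothesis zeta1 : forall l, l.2 = 0%N -> zeta l = 1.
Hypothesis xi1 : forall l, l.1 = 0%N -> xi l = 1.
Hypothesis zetaX : forall l m, (0 < l.2)%N -> (0 < m)%N -> zeta l ^+ m != 1.
Hypothesis char0 : forall m, (0 < m)%N -> (m%:R : k) != 0.
Local Notation V := (cx k a b).
Local Notation bas := (bas k a b).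
Local Notation in_range := (in_range a b).
Local Notation wsupp := (@wsupp k a b).
Local Notation dA := (koszul zeta xi a (1, 0)%N loA leA).
Local Notation dB := (koszul zeta xi b (0, 1)%N loB leB).
Local Notation dtot := (@dtot k a b zeta xi).
Local Notation gr n := (wsupp (graded a b n)).
Local Notation szle m := (wsupp (size_le m)).
Local Notation sm n := (wsupp (small a b n)).

(** The scalar by which the differential leaving degree i acts on empty words
of label l; the value 0 in degree 0 accounts for the end of the complex. *)
Definition coeffA l i : k :=
  if i == 0%N then 0 else if odd i then 1 - zeta l else \sum_(c < a) zeta l ^+ c.
Definition coeffB l i : k :=
  if i == 0%N then 0 else if odd i then 1 - xi l else \sum_(c < b) xi l ^+ c.

Lemma dA_nil l i j m p :
  dA (bas l (i, j) (m, p) [::]) =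
  coeffA l i *: bas l (i.-1, j) (step a i + m, p)%N [::].
Proof.
rewrite koszul_nil /= /coeffA /step; case: i => [|i] /=.
  by rewrite !mul0r !scale0r addr0.
case: (odd i); rewrite /= mul0r mul1r scale0r ?add0r ?addr0.
  rewrite /madd /mscale /= muln1 muln0 add0n; congr (_ *: _).
  rewrite (reindex_inj rev_ord_inj); apply: eq_bigr => -[c ca] _ /=.
  by rewrite /chi /= muln1 muln0 mulr1; congr (_ ^+ _); lia.
by rewrite /chi /= mulr1.
Qed.

Lemma dB_nil l i j m p :
  dB (bas l (i, j) (m, p) [::]) =
  coeffB l j *: bas l (i, j.-1) (m, step b j + p)%N [::].
Proof.
rewrite koszul_nil /= /coeffB /step; case: j => [|j] /=.
  by rewrite !mul0r !scale0r addr0.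
case: (odd j); rewrite /= mul0r mul1r scale0r ?add0r ?addr0.
  rewrite /madd /mscale /= muln1 muln0 add0n; congr (_ *: _).
  rewrite (reindex_inj rev_ord_inj); apply: eq_bigr => -[c ca] _ /=.
  by rewrite /chi /= muln1 muln0 mul1r; congr (_ ^+ _); lia.
by rewrite /chi /= mul1r.
Qed.

Lemma dtot_nil l i j m p :
  dtot (bas l (i, j) (m, p) [::]) =
  coeffA l i *: bas l (i.-1, j) (step a i + m, p)%N [::] +
  ((-1) ^+ i * coeffB l j) *: bas l (i, j.-1) (m, step b j + p)%N [::].
Proof.
rewrite dtotE bar_nil !linear0 addr0 dA_nil dB_nil linearZ /= emapE /=.
by rewrite scalerA mulrC.
Qed.

(** Divide by the differential in the direction of x if the weight involves x,
and in the direction of y otherwise. Since 1/0 = 0, the formula also makes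
sense when the coefficient vanishes. *)
Definition small_word (l e u : nat * nat) (s : seq (nat * nat)) : V :=
  if s is [::] then
    if (0 < l.1)%N then
      if (step a e.1.+1 <= u.1)%N then
        (coeffA l e.1.+1)^-1 *:
          bas l (e.1.+1, e.2) (u.1 - step a e.1.+1, u.2)%N [::]
      else 0
    else if (step b e.2.+1 <= u.2)%N then
        (coeffB l e.2.+1)^-1 *:
          bas l (e.1, e.2.+1) (u.1, u.2 - step b e.2.+1)%N [::]
      else 0
  else 0.
Definition smallh : {linear V -> V} := locked (word_ext small_word).

(** In one direction, words are joined in pairs by the differential: by
[stepS], a word either is hit by the differential from degree i + 1 or is
not killed for reasons of range by the one leaving degree i. This is the
coefficient of the differential within the pair. *)
Definition weightA l i m : k :=
  if (step a i.+1 <= m)%N then coeffA l i.+1 else coeffA l i.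
Definition weightB l j m : k :=
  if (step b j.+1 <= m)%N then coeffB l j.+1 else coeffB l j.

(** The words on which the homotopy fails, as the differential vanishes on
their pair, or as they have no pair. *)
Definition critical (l e u : nat * nat) : bool :=
  if (0 < l.1)%N then weightA l e.1 u.1 == 0 else weightB l e.2 u.2 == 0.

Definition crit_word (l e u : nat * nat) (s : seq (nat * nat)) : V :=
  if s is [::] then if critical l e u then bas l e u [::] else 0 else 0.
Definition critp : {linear V -> V} := locked (word_ext crit_word).

Lemma smallhA l i j m p : (0 < l.1)%N -> (m < a)%N ->
  smallh (bas l (i, j) (m, p) [::]) =
  if (step a i.+1 <= m)%N then
    (coeffA l i.+1)^-1 *: bas l (i.+1, j) (m - step a i.+1, p)%N [::]
  else 0.
Proof.
move=> l1 ma; rewrite /smallh -lock word_extE /small_word /= l1 // => out.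
case: ifP => // _; rewrite bas_out ?scaler0 //; apply: contra out.
by rewrite /= /in_range /=; lia.
Qed.

Lemma smallhB l i j m p : l.1 = 0%N -> (p < b)%N ->
  smallh (bas l (i, j) (m, p) [::]) =
  if (step b j.+1 <= p)%N then
    (coeffB l j.+1)^-1 *: bas l (i, j.+1) (m, p - step b j.+1)%N [::]
  else 0.
Proof.
move=> l1 ma; rewrite /smallh -lock word_extE /small_word /= l1 //= => out.
case: ifP => // _; rewrite bas_out ?scaler0 //; apply: contra out.
by rewrite /= /in_range /=; lia.
Qed.

Lemma stepS N i : (0 < N)%N -> (step N i + step N i.+1)%N = N.
Proof. by rewrite /step /=; case: (odd i) => /=; lia. Qed.

(** In the direction of x the contribution of the other differential cancels,
by the sign in [dtot]; what remains on each word is c / c for the coefficient c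
of its pair, which is 1, or 0 for critical words. *)
Lemma small_homotopy n z : z \in sm n ->
  dtot (smallh z) + smallh (dtot z) = z - critp z.
Proof.
apply: (cx_ext_supp (f := (dtot \o smallh) \+ (smallh \o dtot)) (g := idfun \- critp)).
move=> l [i j] [m p] s /= rg /andP[/andP[/eqP lE _]]; case: s rg lE => // rg lE _.
case/andP: (rg) => /andP[/= ma pb] _.
rewrite /critp -lock word_extE_in // /crit_word /critical /=.
have [l1|l1] := ltnP 0 l.1.
  rewrite dtot_nil linearD !linearZ /= [smallh (bas l (i, j) _ _)]smallhA //.
  have -> : coeffA l i *: smallh (bas l (i.-1, j) ((step a i + m)%N, p) [::]) =
      (if (step a i.+1 <= m)%N then 0 else coeffA l i / coeffA l i) *:
        bas l (i, j) (m, p) [::].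
    have := stepS i (ltnW a_gt1); case: i {rg lE} => [|i] sE.
      by rewrite /coeffA eqxx scale0r mul0r if_same scale0r.
    case: ifP => sm; first by rewrite bas_out ?linear0 ?scaler0 ?scale0r //;
      rewrite /= /in_range /=; lia.
    rewrite smallhA //=; last by lia.
    by rewrite leq_addr scalerA addKn.
  have -> : smallh (bas l (i, j.-1) (m, (step b j + p)%N) [::]) =
      if (step a i.+1 <= m)%N then (coeffA l i.+1)^-1 *:
        bas l (i.+1, j.-1) (m - step a i.+1, step b j + p)%N [::] else 0.
    exact: smallhA.
  rewrite /weightA; case: ifP => sm.
    rewrite linearZ /= dtot_nil /= scale0r add0r subnKC // scalerDr !scalerA.
    rewrite -addrA -scalerDl exprS mulN1r mulNr mulrN [_^-1 * (_ * _)]mulrC.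
    rewrite addNr scale0r addr0.
    have [->|c0] := eqVneq (coeffA l i.+1) 0; first by rewrite mulr0 scale0r subrr.
    by rewrite mulVf // scale1r subr0.
  rewrite linear0 scaler0 add0r addr0.
  have [->|c0] := eqVneq (coeffA l i) 0; first by rewrite mul0r scale0r subrr.
  by rewrite mulfV // scale1r subr0.
have l0 : l.1 = 0%N by lia.
have i0 : i = 0%N.
  move: lE => /(congr1 fst) /=; rewrite l0; case: (i) => // i' /esym/eqP.
  by rewrite exponentS ?addn_eq0; [case: odd => /=; lia|lia].
have m0 : m = 0%N by move: lE => /(congr1 fst) /=; rewrite l0; lia.
subst i m.
rewrite dtot_nil /= scale0r add0r mul1r linearZ /= [smallh (bas l (0%N, j) _ _)]smallhB //.
have -> : coeffB l j *: smallh (bas l (0%N, j.-1) (0%N, (step b j + p)%N) [::]) =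
    (if (step b j.+1 <= p)%N then 0 else coeffB l j / coeffB l j) *:
      bas l (0%N, j) (0%N, p) [::].
  have := stepS j (ltnW b_gt1); case: j {rg lE} => [|j] sE.
    by rewrite /coeffB eqxx scale0r mul0r if_same scale0r.
  case: ifP => sm; first by rewrite bas_out ?linear0 ?scaler0 ?scale0r //;
      rewrite /= /in_range /=; lia.
  rewrite smallhB //=; last by lia.
  by rewrite leq_addr scalerA addKn.
rewrite /weightB; case: ifP => sm.
  rewrite linearZ /= dtot_nil /coeffA /= !scale0r add0r addr0 mul1r subnKC // scalerA.
  have [->|c0] := eqVneq (coeffB l j.+1) 0; first by rewrite mulr0 scale0r subrr.
  by rewrite mulVf // scale1r subr0.
rewrite linear0 add0r.
have [->|c0] := eqVneq (coeffB l j) 0; first by rewrite mul0r scale0r subrr.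
by rewrite mulfV // scale1r subr0.
Qed.

Lemma sm_gr n z : z \in sm n -> z \in gr n.
Proof. by apply: wsuppS => l e t m /andP[]. Qed.

Lemma sm_szle n z : z \in sm n -> z \in szle 0.
Proof. by apply: wsuppS => l e t m /andP[_ /eqP->]. Qed.

Lemma gr_szle_sm n z : z \in gr n -> z \in szle 0 -> z \in sm n.
Proof.
move=> /supportedP gz /supportedP sz; apply/supportedP => -[[[l e] u] s] z0.
by have := gz _ z0; have := sz _ z0; rewrite /small /size_le leqn0 => -> ->.
Qed.

Lemma dtot_sm n z : z \in sm n.+1 -> dtot z \in sm n.
Proof.
have a0 := ltnW a_gt1; have b0 := ltnW b_gt1.
move=> zn; apply: gr_szle_sm; first exact/dtot_gr/sm_gr.
have z0 := sm_szle zn; rewrite dtotE !rpredD //.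
- exact: wsupp_koszul z0.
- by apply: emap_szle; apply: wsupp_koszul z0.
- by do 2!apply: emap_szle; apply: wsupp_bar z0.
Qed.

Lemma coeffA_neq0 l i : (0 < l.2)%N -> (0 < i)%N -> coeffA l i != 0.
Proof.
move=> l2; rewrite /coeffA lt0n => /negPf->; case: ifP => _.
  by rewrite subr_eq0 eq_sym -[zeta l]expr1 zetaX.
have := zetaX l2 (ltnW a_gt1); rewrite -subr_eq0 subrX1.
by apply: contraNneq => ->; rewrite mulr0.
Qed.

Lemma coeffA_eq0 l i : l.2 = 0%N -> (coeffA l i == 0) = (i == 0%N) || odd i.
Proof.
move/zeta1=> z1; rewrite /coeffA z1; have [_|_] := eqVneq i 0%N; first by rewrite eqxx.
rewrite /=; case: ifP => _; first by rewrite subrr eqxx.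
under eq_bigr do rewrite expr1n.
by rewrite sumr_const card_ord; apply/negbTE/char0/ltnW.
Qed.

Lemma coeffB_eq0 l i : l.1 = 0%N -> (coeffB l i == 0) = (i == 0%N) || odd i.
Proof.
move/xi1=> z1; rewrite /coeffB z1; have [_|_] := eqVneq i 0%N; first by rewrite eqxx.
rewrite /=; case: ifP => _; first by rewrite subrr eqxx.
under eq_bigr do rewrite expr1n.
by rewrite sumr_const card_ord; apply/negbTE/char0/ltnW.
Qed.

Definition hh_dim (n : nat) : nat := if n == 0%N then (a + b - 1)%N else (a + b - 2)%N.

(** The critical words of degree n, numbered by c < hh_dim n: first the powers
of x, then those of y, with the word 1 of degree 0 among the latter. In even
positive degrees the exponent starts at 1, as the pair of the word of exponent
0 has coefficient a or b. *)
Definition crit_deg n (c : nat) : nat * nat :=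
  if (c < a.-1)%N then (n, 0)%N else (0, n)%N.
Definition crit_exp n (c : nat) : nat * nat :=
  if (c < a.-1)%N then (c + ~~ odd n, 0)%N
  else (0, c - a.-1 + ((0 < n) && ~~ odd n))%N.
Definition crit_label n c : nat * nat :=
  madd (exponent a (crit_deg n c).1, exponent b (crit_deg n c).2) (crit_exp n c).
Definition crit_bas n c : V := bas (crit_label n c) (crit_deg n c) (crit_exp n c) [::].
Definition crit_coef n c : {linear V -> k^o} := locked (word_ext (fun l e u s =>
  ([&& l == crit_label n c, e == crit_deg n c, u == crit_exp n c & s == [::]]%:R : k^o))).

Lemma exponent_eq0 N i : (0 < N)%N -> (exponent N i == 0%N) = (i == 0%N).
Proof.
move=> N0; rewrite /exponent addn_eq0 muln_eq0 (gtn_eqF N0) /=.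
by apply/idP/idP; case: (boolP (odd i)); lia.
Qed.

(** In weights with both x and y no pair has coefficient 0, because q is not a
root of unity. On an axis the coefficient is 0 when the differential of the
pair leaves an odd degree, and a or b, hence nonzero, when it leaves a positive
even one; the word 1 of degree 0 belongs to no pair. *)
Lemma criticalP n l e u : in_range u ->
  l = madd (exponent a e.1, exponent b e.2) u -> (e.1 + e.2)%N = n ->
  reflect (exists2 c, (c < hh_dim n)%N & e = crit_deg n c /\ u = crit_exp n c)
    (critical l e u).
Proof.
have a0 := ltnW a_gt1; have b0 := ltnW b_gt1.
case: e u => [i j] [m p] /andP[/= ma pb] lE ijn.
have l1E : l.1 = (exponent a i + m)%N by rewrite lE.
have l2E : l.2 = (exponent b j + p)%N by rewrite lE.
rewrite /critical /=; have [l1|l1] := ltnP 0 l.1.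
  have [l2|l2] := posnP l.2; last first.
    have wn0 : weightA l i m != 0.
      rewrite /weightA; case: ifP => sm; first exact: coeffA_neq0.
      apply: coeffA_neq0 => //; rewrite lt0n; apply/eqP => i0.
      by move: sm l1; rewrite l1E i0 /step /exponent /= muln0 !add0n => ->.
    rewrite (negPf wn0); apply: ReflectF => -[c _ []].
    rewrite /crit_deg /crit_exp; case: ifP => _ [ei ej] [em ep].
      by move: l2; rewrite l2E ej ep /exponent /= muln0.
    by move: l1; rewrite l1E ei em /exponent /= muln0.
  have j0 : j = 0%N by apply/eqP; rewrite -(exponent_eq0 j b0); lia.
  have p0 : p = 0%N by lia.
  subst j p; rewrite addn0 in ijn; subst i.
  have wE : (weightA l n m == 0) = if odd n then (m < a.-1)%N else (0 < m)%N.
    rewrite /weightA /step /=; case: (boolP (odd n)) => on /=.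
      by case: leqP => am; rewrite coeffA_eq0 //= on ?orbT.
    case: posnP => [m0|m0]; rewrite coeffA_eq0 //= ?on // (negPf on) orbF.
    by apply/negbTE; move: l1; rewrite l1E m0 addn0 !lt0n exponent_eq0.
  rewrite wE; apply: (iffP idP) => [h|[c cd []]].
    exists (m - ~~ odd n)%N.
      by move: h; rewrite /hh_dim; case: eqP => [->|_] /=; case: (odd n) => /=; lia.
    have cA : (m - ~~ odd n < a.-1)%N by move: h; case: (odd n) => /=; lia.
    rewrite /crit_deg /crit_exp cA; split=> //; congr pair.
    by move: h; case: (odd n) => /=; lia.
  rewrite /crit_deg /crit_exp; case: ifP => [ca _ [->]|_ [n0 _] [m0 _]].
    by case: (odd n); lia.
  by move: l1; rewrite l1E n0 m0 /exponent /= muln0.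
have l10 : l.1 = 0%N by lia.
have i0 : i = 0%N by apply/eqP; rewrite -(exponent_eq0 i a0); lia.
have m0 : m = 0%N by lia.
subst i m; rewrite add0n in ijn; subst j.
have wE : (weightB l n p == 0) =
    if odd n then (p < b.-1)%N else (n == 0)%N || (0 < p)%N.
  rewrite /weightB /step /=; case: (boolP (odd n)) => on /=.
    by case: leqP => am; rewrite coeffB_eq0 //= on ?orbT.
  by case: posnP => [p0|p0]; rewrite coeffB_eq0 //= ?on ?orbT // (negPf on) !orbF.
rewrite wE; apply: (iffP idP) => [h|[c cd []]].
  exists (a.-1 + p - ((0 < n) && ~~ odd n))%N.
    by move: h; rewrite /hh_dim; case: (posnP n) => [->|n0] /=; rewrite ?gtn_eqF //=;
      case: (odd n) => /=; lia.
  have cA : (a.-1 + p - ((0 < n) && ~~ odd n) < a.-1)%N = false.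
    by move: h; case: (posnP n) => [->|n0] /=; rewrite ?gtn_eqF //=;
      case: (odd n) => /=; lia.
  rewrite /crit_deg /crit_exp cA; split=> //; congr pair.
  by move: h; case: (posnP n) => [->|n0] /=; rewrite ?gtn_eqF //=;
    case: (odd n) => /=; lia.
rewrite /crit_deg /crit_exp; case: ifP => [ca [n0] [/eqP]|ca _ [pE]].
  by rewrite -n0 /= addn1.
move: cd; rewrite pE /hh_dim; case: (posnP n) => [->|n0] //=; rewrite ?gtn_eqF //.
by case: (odd n) => /=; lia.
Qed.

Lemma crit_exp_in (n c : nat) : (c < hh_dim n)%N -> in_range (crit_exp n c).
Proof.
rewrite /hh_dim /crit_exp /in_range; case: (posnP n) => [->|n0] /=;
  case: ifP => /=; try (case: (odd n)); lia.
Qed.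

Lemma crit_bas_sm n c : crit_bas n c \in sm n.
Proof.
apply: wsupp_bas; rewrite /small /graded /= [tot _ _]maddC madd0 /crit_label eqxx.
by rewrite /= andbT addn0 /crit_deg; case: ifP => /=; rewrite ?addn0 ?add0n eqxx.
Qed.

Lemma dtot_crit_bas (n c : nat) : (c < hh_dim n)%N -> dtot (crit_bas n c) = 0.
Proof.
have a0 := ltnW a_gt1; have b0 := ltnW b_gt1.
rewrite /crit_bas /hh_dim => cd.
have [cA|cB] := ltnP c a.-1.
  rewrite [crit_deg n c]/crit_deg [crit_exp n c]/crit_exp cA dtot_nil.
  rewrite /coeffB /= mulr0 scale0r addr0.
  case: (boolP (odd n)) => on.
    have : coeffA (crit_label n c) n == 0.
      rewrite coeffA_eq0 ?on ?orbT //.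
      by rewrite /crit_label /crit_deg /crit_exp cA /= /exponent /= muln0.
    by move/eqP->; rewrite scale0r.
  rewrite bas_out ?scaler0 // /= /in_range /step (negPf on) /=; lia.
rewrite [crit_deg n c]/crit_deg [crit_exp n c]/crit_exp ltnNge cB /= dtot_nil.
rewrite /coeffA /= scale0r add0r mul1r.
have cBE : coeffB (crit_label n c) n == 0 \/ [/\ ~~ odd n & (0 < n)%N].
  case: (boolP (odd n)) => on; last first.
    by case: (posnP n) => [->|]; [left; rewrite /coeffB|right].
  left; rewrite coeffB_eq0 ?on ?orbT //.
  by rewrite /crit_label /crit_deg /crit_exp ltnNge cB /= /exponent /= muln0.
case: cBE => [/eqP->|[on n0]]; first by rewrite scale0r.
rewrite bas_out ?scaler0 // /= /in_range /step (negPf on) n0 /=; lia.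
Qed.

Lemma crit_inj (n c c' : nat) : (c < hh_dim n)%N -> (c' < hh_dim n)%N ->
  crit_deg n c = crit_deg n c' -> crit_exp n c = crit_exp n c' -> c = c'.
Proof.
move=> cd cd' /eqP + /eqP; rewrite /crit_deg /crit_exp.
have odd_gt0 : odd n ==> (0 < n)%N by lia.
by case: (ltnP c a.-1) => h1; case: (ltnP c' a.-1) => h2; rewrite !xpair_eqE /=;
  move: odd_gt0; case: (odd n) => /=; lia.
Qed.

Lemma crit_coef_in n c l e u s : all in_range (u :: s) ->
  crit_coef n c (bas l e u s) =
  [&& l == crit_label n c, e == crit_deg n c, u == crit_exp n c & s == [::]]%:R.
Proof. by move=> us; rewrite /crit_coef -lock word_extE_in. Qed.

Lemma crit_coef_bas (n c c' : nat) : (c < hh_dim n)%N -> (c' < hh_dim n)%N ->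
  crit_coef n c (crit_bas n c') = (c' == c)%:R.
Proof.
move=> cd cd'; rewrite crit_coef_in ?[all _ _]andbT ?[all _ _]crit_exp_in //=; last first.
  by rewrite crit_exp_in.
have [->|ne] := eqVneq c' c; first by rewrite !eqxx.
case: eqP => //= _; case: eqP => //= ed; case: eqP => //= eu.
by rewrite (crit_inj cd' cd ed eu) eqxx in ne.
Qed.

Definition crit_sum n (z : V) : V :=
  \sum_(c < hh_dim n) crit_coef n c z *: crit_bas n c.

Fact crit_sum_linear n : linear (crit_sum n).
Proof.
move=> x z w; rewrite /crit_sum scaler_sumr -big_split; apply: eq_bigr => c _ /=.
by rewrite linearP scalerDl scalerA.
Qed.
HB.instance Definition _ n :=
  GRing.isLinear.Build k V V *:%R (crit_sum n) (crit_sum_linear n).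

Lemma critp_bas n l e u : in_range u -> graded a b n l e (tot u [::]) 0 ->
  critical l e u ->
  exists2 c, (c < hh_dim n)%N & [/\ l = crit_label n c, e = crit_deg n c & u = crit_exp n c].
Proof.
move=> ru /andP[/eqP lE /eqP]; rewrite [tot _ _]maddC madd0 addn0 in lE *.
move=> en /(criticalP ru lE en)[c cd [ec uc]]; exists c => //; split=> //.
by rewrite lE ec uc.
Qed.

Lemma critp_sum n z : z \in sm n -> critp z = crit_sum n z.
Proof.
apply: cx_ext_supp => l e u [|v s] rg /andP[] //= gru _; case/andP: (rg) => ru _.
rewrite /critp -lock word_extE_in //= /crit_sum.
case: ifP => [/(critp_bas ru gru)[c cd [-> -> ->]]|/negP ncr].
  rewrite (bigD1 (Ordinal cd)) //= crit_coef_bas // eqxx scale1r big1 ?addr0 //.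
  by move=> c' /eqP ne; rewrite crit_coef_bas // (_ : (c == c') = false) ?scale0r //;
     apply/eqP => E; apply/ne/val_inj.
rewrite big1 // => c _; rewrite crit_coef_in //.
case: and4P => [[/eqP lE /eqP eE /eqP uE _]|_]; last by rewrite scale0r.
case: ncr; case/andP: gru => /eqP lE' /eqP; rewrite [tot _ _]maddC madd0 in lE' *.
by rewrite addn0 => en; apply/(criticalP ru lE' en); exists c.
Qed.

Lemma crit_coef_critp (n c : nat) z : (c < hh_dim n)%N -> z \in sm n ->
  crit_coef n c (critp z) = crit_coef n c z.
Proof.
move=> cd zn; rewrite (critp_sum zn) /crit_sum linear_sum (bigD1 (Ordinal cd)) //=.
rewrite linearZ /= crit_coef_bas // eqxx big1 => [|c' /eqP ne].
  by rewrite addr0 [LHS]mulr1.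
rewrite linearZ /= crit_coef_bas // (_ : (val c' == c) = false) ?scaler0 //.
by apply/eqP => E; apply/ne/val_inj.
Qed.

Lemma dtot_critp n z : z \in sm n -> dtot (critp z) = 0.
Proof.
move=> zn; rewrite (critp_sum zn) /crit_sum linear_sum big1 // => c _.
by rewrite linearZ /= dtot_crit_bas // scaler0.
Qed.

Lemma critp_dtot n z : z \in sm n.+1 -> critp (dtot z) = 0.
Proof.
have a0 := ltnW a_gt1; have b0 := ltnW b_gt1.
move=> zn; have := small_homotopy (dtot_sm zn).
have := congr1 dtot (small_homotopy zn).
rewrite !(linearB, linearD) /= (dtot_critp zn).
rewrite !dtot_dtot // add0r subr0 linear0 addr0 => -> /esym/eqP.
by rewrite -subr_eq0 addrAC subrr add0r oppr_eq0 => /eqP.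
Qed.

Lemma smallh_sm n z : z \in sm n -> smallh z \in sm n.+1.
Proof.
have a0 := ltnW a_gt1; have b0 := ltnW b_gt1.
apply: (supp_ind (f := smallh)) => l [i j] [m p] s rg /andP[/andP[/eqP lE /eqP ijn]].
case: s rg lE ijn => //= rg lE ijn _; case/andP: (rg) => /andP[/= ma pb] _.
have [l1|l1] := ltnP 0 l.1.
  rewrite smallhA //; case: ifP => [sm|_]; last exact: rpred0.
  rewrite rpredZ // wsupp_bas // /small /graded /= lE exponentS //.
  rewrite /step /= in sm *; case: (odd i) sm => /= sm;
    by rewrite /tot /madd /= !xpair_eqE; lia.
rewrite smallhB //; last by lia.
case: ifP => [sm|_]; last exact: rpred0.
rewrite rpredZ // wsupp_bas // /small /graded /= lE exponentS //.
rewrite /step /= in sm *; case: (odd j) sm => /= sm;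
  by rewrite /tot /madd /= !xpair_eqE; lia.
Qed.

(** By [small_homotopy] a cycle is its critical part plus dtot (smallh y). *)
Lemma small_exact n y : y \in sm n -> dtot y = 0 ->
  (forall c, (c < hh_dim n)%N -> crit_coef n c y = 0) ->
  exists2 t, t \in sm n.+1 & y = dtot t.
Proof.
move=> yn dy cy; exists (smallh y); first exact: smallh_sm.
have := small_homotopy yn; rewrite dy linear0 addr0 (critp_sum yn) => ->.
suff -> : crit_sum n y = 0 by rewrite subr0.
by rewrite /crit_sum big1 // => c _; rewrite cy // scale0r.
Qed.

Lemma crit_coef_dtot (n c : nat) y : (c < hh_dim n)%N -> y \in sm n.+1 ->
  crit_coef n c (dtot y) = 0.
Proof.
move=> cd yn; rewrite -(crit_coef_critp cd (dtot_sm yn)).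
by rewrite (critp_dtot yn) linear0.
Qed.

End Small.

(** * Monomial basis of the quantum complete intersection *)

(** A word over bool is a word in x (false) and y (true), and letters counts
both. *)
Definition letters (w : seq bool) : nat * nat := (count negb w, count id w).
(** The number of pairs with y before x: the exponent of q that appears when
the word is sorted with the relation yx = qxy. *)
Fixpoint inversions (w : seq bool) : nat :=
  if w is c :: w' then (c * count negb w' + inversions w')%N else 0%N.

Section QuantumMonomials.
Variables (k : fieldType) (q : k) (C : algType k) (x y : C) (a b : nat).
Hypothesis yx : y * x = q *: (x * y).
Hypothesis xa : x ^+ a = 0.
Hypothesis yb : y ^+ b = 0.

Lemma mul_yX i : y * x ^+ i = q ^+ i *: (x ^+ i * y).
Proof.
elim: i => [|i IHi]; first by rewrite !expr0 mulr1 mul1r scale1r.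
rewrite !exprSr mulrA IHi -scalerAl -(mulrA (x ^+ i) y) yx -scalerAr scalerA.
by rewrite !mulrA.
Qed.

Lemma mul_YX j i : y ^+ j * x ^+ i = q ^+ (j * i) *: (x ^+ i * y ^+ j).
Proof.
elim: j => [|j IHj]; first by rewrite !expr0 mulr1 mul1r scale1r.
rewrite exprS -mulrA IHj -scalerAr (mulrA y) mul_yX -scalerAl scalerA -exprD.
by rewrite mulSn addnC mulrA.
Qed.

Definition qmon (m : nat * nat) : C := x ^+ m.1 * y ^+ m.2.

Lemma qmonM m n : qmon m * qmon n = q ^+ (m.2 * n.1) *: qmon (madd m n).
Proof.
rewrite /qmon mulrA -(mulrA (x ^+ m.1)) mul_YX -scalerAr -scalerAl /= !exprD.
by rewrite !mulrA.
Qed.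

Lemma qmon_out m : ~~ in_range a b m -> qmon m = 0.
Proof.
rewrite negb_and -!leqNgt /qmon => /orP[/subnK<-|/subnK<-].
  by rewrite exprD xa mulr0 mul0r.
by rewrite exprD yb !mulr0.
Qed.

Lemma mulx_qmon m : x * qmon m = qmon (m.1.+1, m.2).
Proof. by rewrite /qmon mulrA -exprS. Qed.

Lemma muly_qmon m : y * qmon m = q ^+ m.1 *: qmon (m.1, m.2.+1).
Proof. by rewrite /qmon mulrA mul_yX -scalerAl -mulrA -exprS. Qed.

Lemma letter_qmon (c : bool) i w :
  (if c then y else x) * (q ^+ i *: qmon (letters w)) =
  q ^+ (c * count negb w + i) *: qmon (letters (c :: w)).
Proof.
rewrite -scalerAr; case: c; last by rewrite mulx_qmon.
by rewrite muly_qmon scalerA -exprD mul1n addnC.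
Qed.

End QuantumMonomials.

Lemma letters_cat w w' : letters (w ++ w') = madd (letters w) (letters w').
Proof. by rewrite /letters !count_cat. Qed.

Lemma inversions_cat w w' :
  inversions (w ++ w') = (inversions w + count id w * count negb w' + inversions w')%N.
Proof. by elim: w => //= c w ->; rewrite count_cat; case: c => /=; lia. Qed.

Lemma inversions_nseqF i : inversions (nseq i false) = 0%N.
Proof. by elim: i. Qed.

Lemma inversions_nseqT i : inversions (nseq i true) = 0%N.
Proof. by elim: i => //= i ->; rewrite count_nseq /= mul0n. Qed.

Lemma letters_nseqF i : letters (nseq i false) = (i, 0)%N.
Proof. by rewrite /letters !count_nseq mul1n mul0n. Qed.

Lemma letters_nseqT i : letters (nseq i true) = (0, i)%N.
Proof. by rewrite /letters !count_nseq mul1n mul0n. Qed.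

Lemma bilinear_eq0 (k : fieldType) (A : algType k) (W : lmodType k) (I : Type)
    (g : I -> A) (f : {linear A -> W}) (z : A) :
  (forall u, exists (s : seq I) (c : I -> k), u = \sum_(w <- s) c w *: g w) ->
  (forall w w', f (g w * z * g w') = 0) -> forall u v, f (u * z * v) = 0.
Proof.
move=> span f0 u v; have [s [c ->]] := span u; have [s' [c' ->]] := span v.
rewrite !mulr_suml linear_sum big1 // => w _; rewrite mulr_sumr linear_sum big1 //.
by move=> w' _; rewrite -!scalerAl -scalerAr !linearZ /= f0 !scaler0.
Qed.

Section FreeAlgebra.
Variable k : fieldType.
Local Notation A := (free2 k).

Lemma free2_span (u : A) : exists (s : seq (seq bool)) (c : seq bool -> k),
  u = \sum_(w <- s) c w *: << FMonom w >>.
Proof.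
exists (map (@fmonom_val bool) (msupp u)), (fun w => u@_(FMonom w)).
rewrite big_map [LHS]malg_gen_sum; apply: eq_bigr => w _.
by rewrite fmK.
Qed.

Lemma gen_fmM (w w' : {fmonom bool}) :
  << w >> * << w' >> = << mmul w w' >> :> A.
Proof. by rewrite malgM_def fgmulUU mulr1. Qed.

Lemma varxX i : varx k ^+ i = << FMonom (nseq i false) >>.
Proof.
elim: i => [|i IHi]; first by rewrite expr0; congr << _ >>; apply/val_inj; rewrite /= fm1.
rewrite exprS IHi /varx gen_fmM; congr << _ >>; apply/val_inj => /=.
by rewrite fmM /= fmU.
Qed.

Lemma varyX i : vary k ^+ i = << FMonom (nseq i true) >>.
Proof.
elim: i => [|i IHi].
  by rewrite expr0; congr << _ >>; apply/val_inj; rewrite /= fm1.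
rewrite exprS IHi /vary gen_fmM; congr << _ >>; apply/val_inj => /=.
by rewrite fmM /= fmU.
Qed.

Lemma gen_FMonomM w w' :
  << FMonom w >> * << FMonom w' >> = << FMonom (w ++ w') >> :> A.
Proof. by rewrite gen_fmM; congr << _ >>; apply/val_inj; rewrite /= fmM. Qed.

Variables (a b : nat) (q : k).

(** The coefficient of x^m.1 y^m.2 in the sorted form, defined on the free
algebra. It kills the ideal ([coord_ideal]), so that the monomials stay
linearly independent in the quotient. *)
Definition coord (m : nat * nat) : {linear A -> k^o} :=
  ext_fun (fun w : {fmonom bool} =>
    q ^+ inversions w *+ (letters w == m) : k^o).

Lemma coord_gen m w : coord m << FMonom w >> = q ^+ inversions w *+ (letters w == m).
Proof. exact: (ext_funU (W := k^o)). Qed.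

(** A word that contains x^a or y^b has too many letters to sort to m; both
sides of yx = qxy have the same letters and the left one has one inversion
more. *)
Lemma coord_rel m w w' z : in_range a b m -> qci_rel a b q z ->
  coord m (<< FMonom w >> * z * << FMonom w' >>) = 0.
Proof.
case/andP=> ma mb; case=> ->.
- rewrite varxX !gen_FMonomM coord_gen !letters_cat letters_nseqF.
  by rewrite (_ : (_ == m) = false) //; apply/eqP => E; move: ma; rewrite -E /=; lia.
- rewrite -[varx k]expr1 -[vary k]expr1 varxX varyX !gen_FMonomM mulrBr mulrBl.
  rewrite -free2_scaleAr -scalerAl !gen_FMonomM linearB linearZ /= !coord_gen.
  rewrite !letters_cat -[letters [:: true; false]]/(letters [:: false; true]).
  case: eqP => _; last by rewrite !mulr0n scaler0 subrr.
  apply/eqP; rewrite subr_eq0 !mulr1n -[_ *: _]/(_ * _) -exprS; apply/eqP.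
  by congr (_ ^+ _); rewrite !inversions_cat !count_cat /=; lia.
- rewrite varyX !gen_FMonomM coord_gen !letters_cat letters_nseqT.
  by rewrite (_ : (_ == m) = false) //; apply/eqP => E; move: mb; rewrite -E /=; lia.
Qed.

Lemma coord_ideal m z : in_range a b m ->
  z \in span_pred (ideal_gens (qci_rel a b q)) -> coord m z = 0.
Proof.
move=> rm /span_predP[n [c [s [Ss ->]]]]; rewrite linear_sum big1 // => i _.
have [u [r [v [rr ->]]]] := Ss i; rewrite linearZ /=.
suff -> : coord m (u * r * v) = 0 by rewrite scaler0.
apply: (bilinear_eq0 (g := fun w => << FMonom w >> : A)) => [|w w'].
  exact: free2_span.
exact: coord_rel.
Qed.

End FreeAlgebra.

Section Monomials.
Variables (k : fieldType) (a b : nat) (q : k).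
Hypotheses (a_gt1 : (1 < a)%N) (b_gt1 : (1 < b)%N).
Local Notation A := (free2 k).
Local Notation C := (qci q a_gt1 b_gt1).

Definition qproj (z : A) : C := aproj (qci_proper q a_gt1 b_gt1) z.
Fact qproj_linear : linear qproj. Proof. exact: aproj_linear. Qed.
HB.instance Definition _ := GRing.isLinear.Build k A C *:%R qproj qproj_linear.
Fact qproj_monoid_morphism : monoid_morphism qproj.
Proof. exact: aproj_monoid_morphism. Qed.
HB.instance Definition _ :=
  GRing.isMonoidMorphism.Build A C qproj qproj_monoid_morphism.

Definition qx : C := qproj (varx k).
Definition qy : C := qproj (vary k).

Lemma qproj_rel z : qci_rel a b q z -> qproj z = 0.
Proof.
move=> rz; rewrite -[RHS](raddf0 qproj); apply/aprojP; rewrite subr0.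
by apply: gen_in_span; exists 1, z, 1; rewrite mul1r mulr1.
Qed.

Lemma qyx : qy * qx = q *: (qx * qy).
Proof.
apply/eqP; rewrite -subr_eq0 /qx /qy -!rmorphM -linearZ -linearB /=.
by apply/eqP/qproj_rel; constructor 2.
Qed.

Lemma qxa : qx ^+ a = 0.
Proof. by rewrite /qx -rmorphXn; apply: qproj_rel; constructor 1. Qed.

Lemma qyb : qy ^+ b = 0.
Proof. by rewrite /qy -rmorphXn; apply: qproj_rel; constructor 3. Qed.

End Monomials.

Section Basis.
Variables (k : fieldType) (a b : nat) (q : k).
Hypotheses (a_gt1 : (1 < a)%N) (b_gt1 : (1 < b)%N).
Local Notation C := (qci q a_gt1 b_gt1).
Local Notation qproj := (qproj q a_gt1 b_gt1).
Local Notation qx := (qx q a_gt1 b_gt1).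
Local Notation qy := (qy q a_gt1 b_gt1).

Definition qcoord (m : nat * nat) (c : C) : k^o := coord q m (arepr c).

Lemma qprojK c : qproj (arepr c) = c.
Proof. exact: areprK. Qed.

Lemma qcoord_proj m z : in_range a b m -> qcoord m (qproj z) = coord q m z.
Proof.
move=> rm; apply/eqP; rewrite -subr_eq0 -linearB; apply/eqP.
by apply: (coord_ideal rm); apply/(aprojP (qci_proper q a_gt1 b_gt1)); exact: areprK.
Qed.

Lemma qcoord_linear m : in_range a b m -> linear (qcoord m).
Proof.
move=> rm c u v; rewrite -[u]qprojK -[v]qprojK.
by rewrite -linearP !qcoord_proj // linearP.
Qed.

Lemma qmonE m : qmon qx qy m = qproj << FMonom (nseq m.1 false ++ nseq m.2 true) >>.
Proof.
by rewrite /qmon /qx /qy -!rmorphXn -rmorphM /= varxX varyX gen_FMonomM.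
Qed.

Lemma qcoord_qmon m n : in_range a b m ->
  qcoord m (qmon qx qy n) = (n == m)%:R.
Proof.
move=> rm; rewrite qmonE qcoord_proj // coord_gen inversions_cat letters_cat.
rewrite inversions_nseqF inversions_nseqT letters_nseqF letters_nseqT.
rewrite !count_nseq /= !mul0n addn0 expr0 /madd /= addn0 add0n.
by case: n.
Qed.

Lemma qproj_gen w : qproj << FMonom w >> =
  q ^+ inversions w *: qmon qx qy (letters w).
Proof.
elim: w => [|c w IHw]; first by rewrite scale1r qmonE.
rewrite -cat1s -gen_FMonomM rmorphM /= IHw.
have -> : qproj << FMonom [:: c] >> = if c then qy else qx.
  by case: c; rewrite -fmuE.
exact: (letter_qmon (qyx q a_gt1 b_gt1)).
Qed.

Lemma qproj_sum z : qproj z =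
  \sum_(m : mon a b) coord q (exps m) z *: qmon qx qy (exps m).
Proof.
have [s [c ->]] := free2_span z; rewrite linear_sum.
under [RHS]eq_bigr do rewrite linear_sum scaler_suml.
rewrite exchange_big; apply: eq_bigr => w _; rewrite linearZ /= qproj_gen.
under eq_bigr do rewrite linearZ /= coord_gen.
have [/ins_in[m0 -> _]|out] := boolP (in_range a b (letters w)).
  rewrite (bigD1 m0) //= eqxx -[_ *: (_ *+ _)]/(_ * _) scalerA big1 ?addr0 // => m ne.
  rewrite (_ : (exps m0 == exps m) = false) ?scaler0 ?scale0r //.
  apply: contra_neqF ne => /eqP E.
  by have := insK m0; rewrite E insK => -[].
rewrite (qmon_out (qxa q a_gt1 b_gt1) (qyb q a_gt1 b_gt1) out) !scaler0 big1 // => m _.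
rewrite (_ : (letters w == exps m) = false) ?scaler0 ?scale0r //.
by apply: contraNF out => /eqP->; rewrite in_range_exps.
Qed.

Lemma qcoord_sum (c : C) :
  c = \sum_(m : mon a b) qcoord (exps m) c *: qmon qx qy (exps m).
Proof. by rewrite -{1}[c]qprojK qproj_sum. Qed.

End Basis.

(** * Hochschild chains as rescaled words *)

Section Tensor.
Variables (k : fieldType) (C : algType k).

Lemma pure_upd n (t : {ffun 'I_n -> C}) p : upd t p (t p) = t.
Proof. by apply/ffunP => j; rewrite ffunE; case: eqP => [->|]. Qed.

Lemma pure_eq0 n (t : {ffun 'I_n -> C}) p : t p = 0 -> pure t = 0.
Proof.
move=> t0; rewrite -(pure_upd t p) t0.
have := pure_multilinear t p (-1) 0 0.
by rewrite scaler0 addr0 scaleN1r addNr.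
Qed.

Lemma pure_scale n (t : {ffun 'I_n -> C}) p c u :
  pure (upd t p (c *: u)) = c *: pure (upd t p u).
Proof.
have := pure_multilinear t p c u 0; rewrite addr0 => ->.
by rewrite [X in _ + X](@pure_eq0 _ _ p) ?addr0 // ffunE eqxx.
Qed.

Section Basis.
Variables (I : finType) (e : I -> C) (co : I -> C -> k).
Hypothesis expand : forall c, c = \sum_i co i c *: e i.

(** The arguments are expanded on the basis one position at a time. *)
Lemma multilinear_eq0 n (W : lmodType k) (h : {ffun 'I_n -> C} -> W) :
  multilinear h -> (forall w : 'I_n -> I, h [ffun i => e (w i)] = 0) ->
  forall t, h t = 0.
Proof.
move=> hm h0.
suff P m (t : {ffun 'I_n -> C}) : (forall p : 'I_n, (m <= p)%N -> exists x, t p = e x) -> h t = 0.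
  by move=> t; apply: (P n) => p; rewrite leqNgt ltn_ord.
elim: m t => [|m IHm] t tE.
  have [w wE] := fin_all_exists (fun p => tE p isT).
  by rewrite -[t](_ : [ffun i => e (w i)] = t) //; apply/ffunP => i; rewrite ffunE wE.
have [mn|nm] := ltnP m n; last first.
  by apply: IHm => p; rewrite leqNgt (leq_trans (ltn_ord p) nm).
pose p := Ordinal mn; rewrite -(pure_upd t p) (expand (t p)).
pose f u := h (upd t p u).
pose g : {linear C -> W} := HB.pack f (GRing.isLinear.Build _ _ _ _ f (hm t p)).
rewrite -[h _]/(g _) linear_sum big1 // => x _; rewrite linearZ /= /f.
rewrite IHm ?scaler0 // => p' mp'; rewrite ffunE.
have [_|ne] := eqVneq p' p; first by exists x.
by apply: tE; rewrite ltn_neqAle mp' andbT; apply: contra_neq ne => mE; apply/val_inj.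
Qed.

End Basis.
End Tensor.

(** The product of the monomials of w, in order, is q to this power times the
monomial with the total exponents, as long as it is in range. *)
Fixpoint gauge (w : seq (nat * nat)) : nat :=
  if w is m :: w' then (m.2 * (msum w').1 + gauge w')%N else 0%N.

Fixpoint merge_at (i : nat) (w : seq (nat * nat)) : seq (nat * nat) :=
  match i, w with
  | 0, m :: m' :: w' => madd m m' :: w'
  | i'.+1, m :: w' => m :: merge_at i' w'
  | _, _ => w
  end.

Local Notation nth0 := (nth (0, 0)%N).

Lemma size_merge i w : (i.+1 < size w)%N -> size (merge_at i w) = (size w).-1.
Proof.
elim: i w => [|i IHi] [|m [|m' w]] //= h; rewrite IHi //=.
Qed.

Lemma nth_merge i w j : (i.+1 < size w)%N -> nth0 (merge_at i w) j =
  if (j < i)%N then nth0 w j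
  else if j == i then madd (nth0 w i) (nth0 w i.+1) else nth0 w j.+1.
Proof.
elim: i w j => [|i IHi] [|m [|m' w]] [|j] //= h; rewrite IHi //=.
Qed.

Lemma msum_merge i w : msum (merge_at i w) = msum w.
Proof.
elim: i w => [|i IHi] [|m w] //=; first by case: w => //= m' w; rewrite maddA.
by rewrite /msum /= -/(msum _) IHi.
Qed.

(** The product of two neighbours uses up its share of the gauge, so the
rescaled face has coefficient 1. *)
Lemma gauge_merge i w : (i.+1 < size w)%N ->
  gauge w = (gauge (merge_at i w) + (nth0 w i).2 * (nth0 w i.+1).1)%N.
Proof.
elim: i w => [|i IHi] [|m [|m' w]] //= h; first by rewrite /msum /=; lia.
by rewrite -/(msum (m' :: w)) msum_merge -addnA -IHi.
Qed.

Lemma msum_rcons w m : msum (rcons w m) = madd (msum w) m.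
Proof.
elim: w => [|n w IHw] /=; first by rewrite /msum /= maddC.
by rewrite /msum /= -/(msum _) -/(msum w) IHw maddA.
Qed.

Lemma gauge_rcons w m : gauge (rcons w m) = (gauge w + (msum w).2 * m.1)%N.
Proof.
elim: w => [|n w IHw] /=; first by rewrite /msum /= muln0.
rewrite IHw msum_rcons [in RHS]/msum /= -/(msum w); lia.
Qed.

Section BarSum.
Variables (k : fieldType) (a b : nat) (zeta xi : nat * nat -> k).
Local Notation bas := (bas k a b).

Lemma bar_sum l e u s m :
  bar zeta xi (bas l e u (rcons s m)) =
  \sum_(i < size s) (-1) ^+ i *: bas l e u (merge_at i (rcons s m))
  + ((-1) ^+ size s * chi zeta xi l m) *: bas l e (madd m u) s.
Proof.
elim: s => [|v s IHs] /=.
  by rewrite big_ord0 add0r expr0 mul1r -pushE bar_push bar_nil linear0 subr0 rmul_nil.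
rewrite -pushE bar_push IHs big_ord_recl /= expr0 scale1r -addrA; congr (_ + _).
  by case: s {IHs} => [|v' s]; rewrite rmul_cons.
rewrite linearD opprD linear_sum linearZ /= pushE -scaleNr; congr (_ + _ *: _).
  rewrite -sumrN; apply: eq_bigr => i _.
  by rewrite linearZ /= pushE -scaleNr exprS mulN1r.
by rewrite exprS mulN1r mulNr.
Qed.

End BarSum.

(** Moving x to the front saves passing it through the s letters y of the
word; moving y to the front makes it pass through the r letters x. *)
Definition twistx (k : fieldType) (q : k) (l : nat * nat) : k := (q ^+ l.2)^-1.
Definition twisty (k : fieldType) (q : k) (l : nat * nat) : k := q ^+ l.1.

Section Chains.
Variables (k : fieldType) (a b : nat) (q : k) (C : algType k).
Hypothesis q_neq0 : q != 0.
Variables (qm : nat * nat -> C) (co : mon a b -> C -> k).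
Hypothesis qmM : forall m n, qm m * qm n = q ^+ (m.2 * n.1) *: qm (madd m n).
Hypothesis qm_out : forall m, ~~ in_range a b m -> qm m = 0.
Hypothesis co_linear : forall m c u v, co m (c *: u + v) = c * co m u + co m v.
Hypothesis co_qm : forall m n, co m (qm n) = (n == exps m)%:R.
Hypothesis co_sum : forall c, c = \sum_m co m c *: qm (exps m).
Local Notation V := (cx k a b).
Local Notation bas := (bas k a b).
Local Notation in_range := (in_range a b).
Local Notation wsupp := (@wsupp k a b).
Local Notation gr n := (wsupp (graded a b n)).
Local Notation ez := (wsupp base).
Local Notation bar := (@bar k a b (twistx q) (twisty q)).
Local Notation augm := (@augm k a b).

Definition mon_tuple n (w : seq (nat * nat)) : {ffun 'I_n.+1 -> C} :=
  [ffun i : 'I_n.+1 => qm (nth0 w i)].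
Definition chain n (w : seq (nat * nat)) : tensor C n.+1 :=
  (q ^+ gauge w)^-1 *: pure (mon_tuple n w).

Lemma chain_out n w : size w = n.+1 -> ~~ all in_range w -> chain n w = 0.
Proof.
move=> sw /allPn[m mw out]; have iw : (index m w < n.+1)%N by rewrite -sw index_mem.
rewrite /chain (@pure_eq0 _ _ _ _ (Ordinal iw)) ?scaler0 //.
by rewrite ffunE /= nth_index // qm_out.
Qed.

Lemma face_merge n (i : 'I_n.+2) w : size w = n.+2 -> (i < n.+1)%N ->
  (q ^+ gauge w)^-1 *: pure (face i (mon_tuple n.+1 w)) = chain n (merge_at i w).
Proof.
move=> sw ilt; have iw : (i.+1 < size w)%N by rewrite sw.
have -> : face i (mon_tuple n.+1 w) =
    upd (mon_tuple n (merge_at i w)) (Ordinal ilt)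
      (q ^+ ((nth0 w i).2 * (nth0 w i.+1).1) *: qm (madd (nth0 w i) (nth0 w i.+1))).
  apply/ffunP => j; rewrite !ffunE -!val_eqE /= !(ltn_eqF ilt).
  have jlt := ltn_ord j; rewrite !inordK ?nth_merge //; try lia.
  case: (ltngtP j i) => [ji|ji|ji] //.
  by rewrite ji qmM.
rewrite pure_scale (_ : upd _ _ _ = mon_tuple n (merge_at i w)).
  rewrite scalerA /chain (gauge_merge iw) exprD invfM -mulrA mulVf ?mulr1 //.
  by rewrite expf_neq0.
apply/ffunP => j; rewrite !ffunE -val_eqE /= nth_merge //.
by case: (ltngtP j i).
Qed.

Lemma face_last n u s m : size s = n ->
  (q ^+ gauge (u :: rcons s m))^-1 *:
    pure (face ord_max (mon_tuple n.+1 (u :: rcons s m))) =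
  chi (twistx q) (twisty q) (msum (u :: rcons s m)) m *: chain n (madd m u :: s).
Proof.
move=> sn.
have -> : face ord_max (mon_tuple n.+1 (u :: rcons s m)) =
    upd (mon_tuple n (madd m u :: s)) ord0 (q ^+ (m.2 * u.1) *: qm (madd m u)).
  apply/ffunP => j; rewrite !ffunE eqxx /= -!val_eqE /=.
  case: (val j =P 0%N) => [_|/eqP j0].
    by rewrite nth_rcons sn ltnn eqxx qmM.
  have jlt := ltn_ord j; rewrite inordK; last lia.
  case: j jlt j0 => -[|j'] //= _ jlt _; rewrite nth_rcons sn ifT //; lia.
rewrite pure_scale (_ : upd _ _ _ = mon_tuple n (madd m u :: s)); last first.
  by apply/ffunP => j; rewrite !ffunE -val_eqE /=; case: (val j).
rewrite /chain !scalerA; congr (_ *: _).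
rewrite /chi /twistx /twisty -rcons_cons gauge_rcons msum_rcons.
rewrite ![msum (u :: s)]/msum /= -/(msum s).
have nz x : q ^+ x != 0 by rewrite expf_neq0.
rewrite exprVn -!exprM.
rewrite mulrC [in RHS](mulrC _^-1) -[RHS]mulrA -invfM; apply/eqP.
rewrite eqr_div ?mulf_neq0 // -!exprD /=; apply/eqP; congr (_ ^+ _).
by rewrite /madd /=; lia.
Qed.

Local Arguments gauge : simpl never.

(** [psi] sends a Hochschild word to its rescaled tensor; [phi] is its
inverse. *)
Definition psi_fun n (l e u : nat * nat) s : tensor C n.+1 :=
  if size s == n then chain n (u :: s) else 0.
Definition psi n : {linear V -> tensor C n.+1} := locked (word_ext (psi_fun n)).

Lemma psiE n l e u s : size s = n -> psi n (bas l e u s) = chain n (u :: s).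
Proof.
move=> sn; rewrite /psi -lock word_extE /psi_fun sn eqxx //.
by move=> out; apply: chain_out; rewrite /= ?sn.
Qed.

(** The three kinds of faces: the first is the augmentation, the inner ones
and the last form [bar]. *)
Lemma psi_boundary n z : z \in ez -> z \in gr n.+1 ->
  psi n (augm z - bar z) = hochschild_d (psi n.+1 z).
Proof.
move=> ze zn.
have zP : z \in wsupp (fun l e t m => base l e t m && graded a b n.+1 l e t m).
  move: ze zn => /supportedP gz /supportedP sz; apply/supportedP => -[[[l e] u] s] z0.
  by have := gz _ z0; have := sz _ z0 => -> ->.
have [hd hdE] : exists hd : {linear tensor C n.+2 -> tensor C n.+1},
    forall x, hd x = @hochschild_d k C n.+1 x by exists (@hochschild_d k C n.+1).
rewrite -hdE.
apply: (cx_ext_supp (f := psi n \o (augm \- bar)) (g := hd \o psi n.+1) _ zP).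
move=> l e u s rg /andP[/eqP-> /andP[/eqP lE /eqP]] /=; rewrite !add0n => sn.
case/lastP: s sn rg lE => // s m; rewrite size_rcons => -[sn] rg lE.
rewrite bar_sum [psi n.+1 _]psiE ?size_rcons ?sn //.
rewrite {1}/chain linearZ /= hdE hochschild_d_pure scaler_sumr big_ord_recr /=.
rewrite linearB /= linearD /= opprD addrA; congr (_ + _); last first.
  rewrite linearZ /= psiE // [RHS]scalerA [X in X *: pure _]mulrC -[RHS]scalerA face_last //.
  rewrite [RHS]scalerA exprS mulN1r mulNr scaleNr lE /exponent /= !muln0.
  by rewrite /tot /msum /= madd0.
rewrite big_ord_recl /= expr0 scale1r; congr (_ + _).
  rewrite face_merge //=; last by rewrite size_rcons sn.
  by case: s sn rg lE => [|v s] /= sn rg lE; rewrite augm_cons eqxx psiE //= -?sn ?size_rcons.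
rewrite linear_sum -sumrN; apply: eq_bigr => i _.
rewrite linearZ /= psiE; last by rewrite size_merge ?size_rcons ?sn //; have := ltn_ord i; lia.
rewrite [RHS]scalerA [X in X *: pure _]mulrC -[RHS]scalerA face_merge //=.
- by rewrite exprS mulN1r scaleNr.
- by rewrite size_rcons sn.
- by rewrite /bump /=; have := ltn_ord i; lia.
Qed.

Definition exps_seq n (w : {ffun 'I_n.+1 -> mon a b}) : seq (nat * nat) :=
  [seq exps (w i) | i <- enum 'I_n.+1].

Definition phi_word n (w : {ffun 'I_n.+1 -> mon a b}) : V :=
  let s := exps_seq w in
  q ^+ gauge s *: bas (msum s) (0, 0)%N (head (0, 0)%N s) (behead s).

Definition phi_fun n (t : {ffun 'I_n.+1 -> C}) : V :=
  \sum_(w : {ffun 'I_n.+1 -> mon a b}) (\prod_i co (w i) (t i)) *: phi_word w.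

Lemma phi_multilinear n : multilinear (@phi_fun n).
Proof.
move=> t p c u v; rewrite /phi_fun scaler_sumr -big_split; apply: eq_bigr => w _ /=.
have upd_prod x : \prod_i co (w i) (upd t p x i) =
    co (w p) x * \prod_(i | i != p) co (w i) (t i).
  rewrite (bigD1 p) //= ffunE eqxx; congr (_ * _); apply: eq_bigr => i ip.
  by rewrite ffunE (negPf ip).
by rewrite !upd_prod co_linear mulrDl scalerDl -mulrA [in RHS]scalerA.
Qed.

Definition phi_lift n : {linear tensor C n.+1 -> V} :=
  HB.pack (tensor_lift (@phi_fun n))
    (GRing.isLinear.Build _ _ _ _ (tensor_lift (@phi_fun n))
      (tensor_lift_linear (@phi_multilinear n))).
Definition phi n : {linear tensor C n.+1 -> V} := locked (phi_lift n).

Lemma phi_pure n t : phi n (pure t) = phi_fun t.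
Proof. by rewrite /phi -lock; exact/tensor_lift_pure/phi_multilinear. Qed.

Lemma size_exps_seq n (w : {ffun 'I_n.+1 -> mon a b}) : size (exps_seq w) = n.+1.
Proof. by rewrite size_map size_enum_ord. Qed.

Lemma nth_exps_seq n (w : {ffun 'I_n.+1 -> mon a b}) (i : 'I_n.+1) :
  nth0 (exps_seq w) i = exps (w i).
Proof. by rewrite (nth_map i) ?size_enum_ord // nth_ord_enum. Qed.

Lemma exps_inj : injective (@exps a b).
Proof. by move=> m n mn; have := insK m; rewrite mn insK => -[]. Qed.

Lemma exps_seq_onto n (s : seq (nat * nat)) : size s = n.+1 -> all in_range s ->
  exists w : {ffun 'I_n.+1 -> mon a b}, s = exps_seq w.
Proof.
move=> sn sr.
have [w wE] : exists w : 'I_n.+1 -> mon a b, forall i : 'I_n.+1, nth0 s i = exps (w i).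
  apply: (fin_all_exists (P := fun (i : 'I_n.+1) x => nth0 s i = exps x)) => i.
  have /ins_in[m -> _] : in_range (nth0 s i) by apply: (allP sr); rewrite mem_nth ?sn.
  by exists m.
exists (finfun w); apply: (@eq_from_nth _ (0, 0)%N) => [|i].
  by rewrite sn size_exps_seq.
by rewrite sn => ilt; rewrite (nth_exps_seq _ (Ordinal ilt)) ffunE -wE.
Qed.

Lemma phi_chain n (w : {ffun 'I_n.+1 -> mon a b}) :
  phi n (chain n (exps_seq w)) =
  bas (msum (exps_seq w)) (0, 0)%N (head (0, 0)%N (exps_seq w)) (behead (exps_seq w)).
Proof.
rewrite /chain linearZ /= phi_pure /phi_fun (bigD1 w) //= [X in _ + X]big1.
  rewrite big1 => [|i _]; last by rewrite ffunE co_qm nth_exps_seq eqxx.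
  by rewrite scale1r addr0 /phi_word scalerA mulVf ?scale1r ?expf_neq0.
move=> w' ne; have [i iP] : exists i, w' i != w i.
  apply/existsP; rewrite -negb_forall; apply: contra ne => /forallP h.
  by apply/eqP/ffunP => i; apply/eqP.
rewrite (bigD1 i) //= ffunE co_qm nth_exps_seq.
by rewrite (inj_eq exps_inj) eq_sym (negPf iP) mul0r scale0r.
Qed.

Lemma psi_phi n x : psi n (phi n x) = x.
Proof.
pose f : {linear tensor C n.+1 -> tensor C n.+1} := (psi n \o phi n) \- idfun.
suff : f x = 0 by move/eqP; rewrite subr_eq0 => /eqP.
apply: (tensor_linear_eq0 (f := f)) => [|t]; first exact: linearP.
apply: (multilinear_eq0 (h := fun t => f (pure t)) co_sum) => [t' p c u v|w].
  by rewrite pure_multilinear linearP.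
rewrite (_ : [ffun i => _] = mon_tuple n (exps_seq (finfun w))); last first.
  by apply/ffunP => i; rewrite !ffunE nth_exps_seq ffunE.
set s := exps_seq _.
have -> : pure (mon_tuple n s) = q ^+ gauge s *: chain n s.
  by rewrite /chain scalerA mulfV ?scale1r ?expf_neq0.
rewrite linearZ /= phi_chain -/s.
have : size s = n.+1 by rewrite size_exps_seq.
by case: s => //= m s [sn]; rewrite psiE // subrr scaler0.
Qed.

Lemma phi_psi n z : z \in ez -> z \in gr n -> phi n (psi n z) = z.
Proof.
move=> ze zn.
have zP : z \in wsupp (fun l e t m => base l e t m && graded a b n l e t m).
  move: ze zn => /supportedP gz /supportedP sz; apply/supportedP => -[[[l e] u] s] z0.
  by have := gz _ z0; have := sz _ z0 => -> ->.
apply: (cx_ext_supp (f := phi n \o psi n) (g := idfun) _ zP) => l e u s rg.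
case/andP=> /eqP-> /andP[/eqP-> /eqP]; rewrite !add0n => sn.
have [||w wE] := @exps_seq_onto n (u :: s); rewrite /= ?sn //.
rewrite psiE // wE phi_chain -wE /= /exponent /= !muln0.
by rewrite madd0.
Qed.

Lemma phi_supp n x : phi n x \in ez /\ phi n x \in gr n.
Proof.
have [m [c [t ->]]] := tensor_span x; rewrite linear_sum.
have key w : @phi_word n w \in ez /\ @phi_word n w \in gr n.
  rewrite /phi_word; have := size_exps_seq w; case: (exps_seq w) => //= v s [sn].
  by split; rewrite rpredZ // wsupp_bas // /graded /exponent /= !muln0 madd0 eqxx sn /=.
by split; apply: rpred_sum => i _; rewrite linearZ rpredZ //= phi_pure;
  apply: rpred_sum => w _; rewrite rpredZ //; have [] := key w.
Qed.

End Chains.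

(** * Comparison of the two complexes *)

(** A total, linear and onto relation R between V and k^d such that exactly S
is related to 0 induces an isomorphism from V/S to k^d. *)

Section RelationDim.
Variables (k : fieldType) (V : lmodType k) (S : V -> Prop) (d : nat).
Variable R : V -> 'rV[k]_d -> Prop.
Hypothesis R_lin : forall x v w c c', R v c -> R w c' -> R (x *: v + w) (x *: c + c').
Hypothesis R_total : forall v, exists c, R v c.
Hypothesis R_onto : forall c, exists v, R v c.
Hypothesis R0 : forall v, R v 0 -> S v.
Hypothesis RS : forall v c, R v c -> S v -> c = 0.
Hypothesis S0 : S 0.

Lemma relation_has_dim : has_dim (lquot S) d.
Proof.
have R00 : R 0 0.
  have [c Rc] := R_total 0; have := R_lin (-1) Rc Rc.
  by rewrite !scaleN1r !addNr.
have R_fun v c c' : R v c -> R v c' -> c = c'.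
  move=> Rc Rc'; have := R_lin (-1) Rc Rc'; rewrite !scaleN1r addNr.
  by move/RS/(_ S0)/eqP; rewrite addrC subr_eq0 => /eqP.
have R_span v : v \in span_pred S -> R v 0.
  move=> /span_predP[n [c [s [Ss ->]]]]; elim/big_rec: _ => // i w _ Rw.
  rewrite -[0](addr0 (0 : 'rV_d)) -{1}[0](scaler0 _ (c i)); apply: R_lin => //.
  by have [e Re] := R_total (s i); rewrite -(RS Re (Ss i)).
pose f v := projT1 (cid (R_total v)).
have fP v : R v (f v) by exact: projT2 (cid (R_total v)).
have f_eq v w : lproj S v = lproj S w -> f v = f w.
  move/lprojP/R_span => Rvw; apply: (R_fun v) => //.
  by have := R_lin 1 Rvw (fP w); rewrite !scale1r add0r subrK.
constructor; exists (fun x => f (lrepr x)) => [c x y|].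
  apply: (R_fun (c *: lrepr x + lrepr y)); last by apply: R_lin.
  rewrite (f_eq _ (c *: lrepr x + lrepr y)) //.
  by rewrite lreprK linearP /= !lreprK.
exists (fun c => lproj S (projT1 (cid (R_onto c)))) => [x|c].
  case: cid => v /= Rv; rewrite -[RHS]lreprK; apply/lprojP/gen_in_span/R0.
  have := R_lin (-1) (fP (lrepr x)) Rv.
  by rewrite !scaleN1r !addNr addrC.
case: cid => v /= Rv; apply: (R_fun v) => //.
by rewrite (f_eq _ v) // lreprK.
Qed.

End RelationDim.

Section Comparison.
Variables (k : fieldType) (a b : nat) (q : k) (C : algType k).
Hypotheses (a_gt1 : (1 < a)%N) (b_gt1 : (1 < b)%N) (q_neq0 : q != 0).
Hypothesis q_root : forall m, (0 < m)%N -> q ^+ m != 1.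
Hypothesis char0 : forall m, (0 < m)%N -> (m%:R : k) != 0.
Variables (qm : nat * nat -> C) (co : mon a b -> C -> k).
Hypothesis qmM : forall m n, qm m * qm n = q ^+ (m.2 * n.1) *: qm (madd m n).
Hypothesis qm_out : forall m, ~~ in_range a b m -> qm m = 0.
Hypothesis co_linear : forall m c u v, co m (c *: u + v) = c * co m u + co m v.
Hypothesis co_qm : forall m n, co m (qm n) = (n == exps m)%:R.
Hypothesis co_sum : forall c, c = \sum_m co m c *: qm (exps m).
Local Notation V := (cx k a b).
Local Notation wsupp := (@wsupp k a b).
Local Notation gr n := (wsupp (graded a b n)).
Local Notation szle m := (wsupp (size_le m)).
Local Notation sm n := (wsupp (small a b n)).
Local Notation ez := (wsupp base).
Local Notation zeta := (twistx q).
Local Notation xi := (twisty q).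
Local Notation bar := (@bar k a b zeta xi).
Local Notation dtot := (@dtot k a b zeta xi).
Local Notation augm := (@augm k a b).
Local Notation sect := (@sect k a b).
Local Notation psi := (psi a b q qm).
Local Notation phi := (phi q co_linear).
Local Notation d n := (hh_dim a b n).
Local Notation crit_coef := (@crit_coef k a b).
Local Notation crit_bas := (@crit_bas k a b).

Let a_gt0 : (0 < a)%N := ltnW a_gt1.
Let b_gt0 : (0 < b)%N := ltnW b_gt1.

Lemma twistx1 l : l.2 = 0%N -> zeta l = 1.
Proof. by move=> l0; rewrite /twistx l0 invr1. Qed.

Lemma twisty1 l : l.1 = 0%N -> xi l = 1.
Proof. by move=> l0; rewrite /twisty l0. Qed.

Lemma twistxX l m : (0 < l.2)%N -> (0 < m)%N -> zeta l ^+ m != 1.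
Proof.
move=> l0 m0; rewrite /twistx exprVn -exprM invr_eq1 q_root //.
by rewrite muln_gt0 l0.
Qed.

Lemma boundary_base x : x \in ez -> augm x - bar x \in ez.
Proof.
move=> xe; rewrite rpredB //; first exact: augm_base.
exact: wsupp_bar xe.
Qed.

Lemma boundary_gr n x : x \in gr n.+1 -> augm x - bar x \in gr n.
Proof. by move=> xn; rewrite rpredB ?augm_gr ?bar_gr. Qed.

Lemma boundary_gr0 x : x \in gr 0 -> augm x - bar x = 0.
Proof.
move=> x0; have xs := gr_szle x0; rewrite augm_szle0 // sub0r.
have -> : bar x = 0; last by rewrite oppr0.
apply: lowp0; apply: wsupp_bar x0 => l e t n.
by rewrite /graded addnS andbF.
Qed.

Lemma phiK n (x : tensor C n.+1) : psi n (phi n x) = x.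
Proof. exact: psi_phi. Qed.

Lemma boundary_chain n x : x \in ez -> x \in gr n.+1 ->
  augm x - bar x = phi n (hochschild_d (psi n.+1 x)).
Proof.
move=> xe xn; rewrite -(psi_boundary q_neq0 qmM qm_out xe xn).
have be := boundary_base xe; have bn := boundary_gr xn.
by rewrite (phi_psi q_neq0 qm_out co_linear co_qm be bn).
Qed.

Lemma cycle_phi n (z : hcycle C n) :
  augm (phi n (val z)) - bar (phi n (val z)) = 0.
Proof.
have [xe xn] := phi_supp q co_linear (val z).
have zc : hochschild_d (val z) == 0 := valP z.
case: n z xe xn zc => [|n] z xe xn /eqP zc; first exact: boundary_gr0.
by rewrite (boundary_chain xe xn) phiK zc linear0.
Qed.

(** zz joins the Hochschild cycle z to a small cycle, of which c collects the
critical coefficients. *)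
Definition hh_rel n (z : hcycle C n) (c : 'rV[k]_(d n)) : Prop :=
  exists2 zz, zz \in gr n.+1 &
    [/\ dtot zz \in szle 0, augm zz = phi n (val z) &
        forall i, c 0 i = crit_coef n i (dtot zz)].

Lemma hh_rel_lin n x (z w : hcycle C n) c c' :
  hh_rel z c -> hh_rel w c' -> hh_rel (x *: z + w) (x *: c + c').
Proof.
move=> [zz zn [z1 z2 z3]] [ww wn [w1 w2 w3]]; exists (x *: zz + ww).
  by rewrite rpredD ?rpredZ.
split=> [||i].
- by rewrite linearP rpredD ?rpredZ.
- by rewrite linearP /= z2 w2 -linearP.
- by rewrite !mxE z3 w3 !linearP.
Qed.

Lemma hh_rel_total n (z : hcycle C n) : exists c, hh_rel z c.
Proof.
have [xe xn] := phi_supp q co_linear (val z).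
have [zz zn [z1 z2]] := augm_lift a_gt0 b_gt0 xe xn (cycle_phi z).
by exists (\row_i crit_coef n i (dtot zz)), zz => //; split=> // i; rewrite mxE.
Qed.

(** If z is the boundary of y, correct zz by the lift of y and by
[row_exact]: its differential becomes that of a small chain, which has no
critical coefficient. *)
Lemma hh_rel_boundary n (z : hcycle C n) c :
  hh_rel z c -> is_boundary z -> c = 0.
Proof.
move=> [zz zn [dzz azz cE]] [y yE].
pose x' := phi n.+1 y; have [xe xn] : x' \in ez /\ x' \in gr n.+1 by apply: phi_supp.
have x'E : augm x' - bar x' = augm zz by rewrite (boundary_chain xe xn) phiK azz yE.
pose zz' := zz - dtot (sect x').
have zz'n : zz' \in gr n.+1 by rewrite rpredB // dtot_gr // sect_gr.
have dzz' : dtot zz' = dtot zz by rewrite linearB /= dtot_dtot // subr0.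
have [||w wn [w0 dw]] := @row_exact k a b a_gt0 b_gt0 zeta xi _ _ _ (gr_szle zz'n) zz'n.
- by rewrite linearB /= augm_dtot augm_sect // x'E subrr.
- by rewrite dzz'.
have y'n : zz' - dtot w \in sm n.+1 by rewrite gr_szle_sm // rpredB // dtot_gr.
apply/rowP => i; rewrite mxE cE -dzz'.
have -> : dtot zz' = dtot (zz' - dtot w) by rewrite [RHS]linearB /= dtot_dtot // subr0.
by apply: (crit_coef_dtot a_gt1 b_gt1 twistx1 twisty1 twistxX char0).
Qed.

(** The small cycle dtot zz is a boundary dtot t, so zz - t is a cycle of the
acyclic total complex, and augmenting a preimage bounds z. *)
Lemma hh_rel0 n (z : hcycle C n) : hh_rel z 0 -> is_boundary z.
Proof.
move=> [zz zn [dzz azz cE]].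
have yn : dtot zz \in sm n by rewrite gr_szle_sm // dtot_gr.
have [||t tn tE] := small_exact a_gt1 b_gt1 twistx1 twisty1 twistxX char0 yn.
- exact: dtot_dtot.
- by move=> c cd; rewrite -(cE (Ordinal cd)) mxE.
have [||w wn wE] := @dtot_exact k a b a_gt0 b_gt0 zeta xi n.+1 (zz - t).
- by rewrite rpredB // (sm_gr tn).
- by rewrite linearB /= tE subrr.
exists (psi n.+1 (augm w)).
rewrite -(psi_boundary q_neq0 qmM qm_out) ?augm_base ?augm_gr //.
rewrite -augm_dtot -wE linearB /= (augm_szle0 (sm_szle tn)) subr0 azz.
by rewrite phiK.
Qed.

(** A combination of critical words is a cycle, hence dtot zz for some zz; the
augmentation of zz is the Hochschild cycle. *)
Lemma hh_rel_onto n (c : 'rV[k]_(d n)) : exists z : hcycle C n, hh_rel z c.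
Proof.
pose y : V := \sum_i c 0 i *: crit_bas n i.
have yn : y \in sm n by apply: rpred_sum => i _; rewrite rpredZ // crit_bas_sm.
have dy : dtot y = 0.
  rewrite linear_sum big1 // => i _; rewrite linearZ /=.
  by rewrite (dtot_crit_bas a_gt1 b_gt1 twistx1 twisty1 char0) // scaler0.
have [zz zn yE] := dtot_exact a_gt0 b_gt0 (sm_gr yn) dy.
have xe : augm zz \in ez := augm_base zz.
have xn : augm zz \in gr n := augm_gr zn.
have bx : augm (augm zz) - bar (augm zz) = 0.
  by rewrite -augm_dtot -yE augm_szle0 // (sm_szle yn).
have zc : psi n (augm zz) \in @cycle_pred k C n.
  apply/eqP; case: (n) xn => [//|m] xm.
  by rewrite -(psi_boundary q_neq0 qmM qm_out) // bx linear0.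
exists (Hcycle zc), zz => //; split=> [||i].
- by rewrite -yE (sm_szle yn).
- by rewrite (phi_psi q_neq0 qm_out co_linear co_qm).
rewrite -yE linear_sum (bigD1 i) //= linearZ /= crit_coef_bas // eqxx big1 => [|j ji].
  by rewrite addr0 [RHS]mulr1.
rewrite linearZ /= crit_coef_bas // (_ : (val j == i) = false) ?scaler0 //.
by apply/negbTE; apply: contra ji => /eqP E; apply/eqP/val_inj.
Qed.

Lemma hochschild_dim n : has_dim (HH C n) (d n).
Proof.
apply: (relation_has_dim (R := @hh_rel n)).
- exact: hh_rel_lin.
- exact: hh_rel_total.
- exact: hh_rel_onto.
- exact: hh_rel0.
- exact: hh_rel_boundary.
by exists 0; rewrite [RHS]linear0; exact: raddf0.
Qed.

End Comparison.

Theorem mainTheorem8 (k : fieldType) (char0 : [pchar k] =i pred0)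
    (a b : nat) (a_ge2 : (2 <= a)%N) (b_ge2 : (2 <= b)%N)
    (q : k) (q_neq0 : q != 0)
    (q_not_root_of_unity : forall m : nat, (0 < m)%N -> q ^+ m != 1)
    (n : nat) :
  has_dim (HH (qci q a_ge2 b_ge2) n)
    (if n == 0%N then a + b - 1 else a + b - 2)%N.
Proof.
apply: (hochschild_dim a_ge2 b_ge2 q_neq0 q_not_root_of_unity _
  (qmonM (qyx q a_ge2 b_ge2))
  (qmon_out (qxa q a_ge2 b_ge2) (qyb q a_ge2 b_ge2))
  (co := fun m => qcoord (exps m))).
- by move=> m m0; rewrite (pcharf0P k).1 // -lt0n.
- by move=> m; apply: qcoord_linear; apply: in_range_exps.
- by move=> m n'; rewrite qcoord_qmon //; apply: in_range_exps.
- exact: qcoord_sum.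
Qed.
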